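(* Let $N\geq 1$, $0<R\leq\infty$, and let $V_{2}\geq 0$ and $W_{2}$ be smooth functions on $(0,R)$. Assume that $\left(V_{2},\,W_{2}+N\frac{V_{2}'}{r}\right)$ is an $(N+2)$-dimensional Bessel pair on $(0,R)$. Then: (1) For all radial functions $u\in C_{0}^{\infty}(B_{R}\setminus\{0\})$, $$\int_{B_{R}}V_{2}(|x|)\,|\Delta u|^{2}\,dx\geq\int_{B_{R}}W_{2}(|x|)\,|\nabla u|^{2}\,dx. \qquad ( * )$$ (2) Moreover, if for all $u\in C_{0}^{\infty}(0,R)$ $$2\int_{0}^{R}V_{2}(r)r^{N-3}|u'|^{2}dr-\int_{0}^{R}V_{2}''(r)r^{N-3}|u|^{2}dr-(N-5)\int_{0}^{R}V_{2}'(r)r^{N-4}|u|^{2}dr+(3N-9)\int_{0}^{R}V_{2}(r)r^{N-5}|u|^{2}dr-\int_{0}^{R}W_{2}(r)r^{N-3}|u|^{2}dr\geq 0,$$ then inequality $( * )$ holds for all $u\in C_{0}^{\infty}(B_{R}\setminus\{0\})$.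
   Context: $B_R$ is the open ball of radius $R$ centered at the origin in $\mathbb{R}^N$ (with $B_\infty=\mathbb{R}^N$). $C_0^\infty(\Omega)$ is the space of smooth functions with compact support in $\Omega$. For an integer $n\ge 1$, a pair $(V,W)$ of functions on $(0,R)$ (with $V\ge 0$ and $W$ of arbitrary sign) is an $n$-dimensional Bessel pair on $(0,R)$ if there exists a positive function $\varphi$ on $(0,R)$ such that $\left(r^{n-1}V\varphi'\right)'+r^{n-1}W\varphi=0$ on $(0,R)$. *)

(* Defs.v *)
From HB Require Import structures.
From mathcomp Require Import all_boot all_order all_algebra.
From mathcomp Require Import all_classical all_reals all_analysis.

Set Implicit Arguments.
Unset Strict Implicit.
Unset Printing Implicit Defensive.

Import Order.TTheory GRing.Theory Num.Theory.
Import numFieldNormedType.Exports.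

Local Open Scope classical_set_scope.
Local Open Scope ring_scope.

Section tuple_measure.
Context d (T : measurableType d) {R : realType}.

Definition tcons n (z : T * n.-tuple T) : n.+1.-tuple T := [tuple of z.1 :: z.2].

Lemma measurable_tcons n : measurable_fun [set: T * n.-tuple T] (@tcons n).
Proof. exact: measurable_cons. Qed.

Section measure_cons.
Variables (n : nat) (nu : {sigma_finite_measure set T -> \bar R})
  (mu : {sigma_finite_measure set (n.-tuple T) -> \bar R}).

Definition measure_cons : set (n.+1.-tuple T) -> \bar R :=
  pushforward (nu \x mu)%E (@tcons n).

HB.instance Definition _ := Measure.copy measure_cons
  (measure_function_pushforward__canonical__measure_function_Measure
    [the {measure set _ -> \bar R} of (nu \x mu)%E] (@measurable_tcons n)).

Lemma measure_cons_sigma_finite : sigma_finite setT measure_cons.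
Proof.
have /sigma_finiteP[F [TF ndF Foo]] := sigma_finiteT nu.
have /sigma_finiteP[G [TG ndG Goo]] := sigma_finiteT mu.
pose un (t : n.+1.-tuple T) : T * n.-tuple T := (thead t, [tuple of behead t]).
have mun : measurable_fun setT un.
  apply: measurable_fun_pair; first exact: measurable_tnth.
  exact: measurable_behead.
have unK z : un (tcons z) = z.
  by case: z => a t; congr pair; exact/val_inj.
exists (fun k => un @^-1` (F k `*` G k)).
  apply/esym/seteqP; split => // t _.
  have [i _ Fi] : (\bigcup_k F k) (un t).1 by rewrite -TF.
  have [j _ Gj] : (\bigcup_k G k) (un t).2 by rewrite -TG.
  exists (maxn i j) => //; split.
    by move: Fi; exact/subsetPset/ndF/leq_maxl.
  by move: Gj; exact/subsetPset/ndG/leq_maxr.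
move=> k; have [mFk Fk] := Foo k; have [mGk Gk] := Goo k; split.
  by rewrite -[X in measurable X]setTI; apply: mun => //; exact: measurableX.
have E : @tcons n @^-1` (un @^-1` (F k `*` G k)) = F k `*` G k.
  apply/funext => z; rewrite -[in RHS](unK z); reflexivity.
rewrite /measure_cons /pushforward E product_measure1E//.
by rewrite lte_mul_pinfty// ge0_fin_numE.
Qed.

HB.instance Definition _ := Measure_isSigmaFinite.Build _ _ _ measure_cons
  measure_cons_sigma_finite.

End measure_cons.

Fixpoint measure_tuple (nu : {sigma_finite_measure set T -> \bar R}) (n : nat) :
    {sigma_finite_measure set (n.-tuple T) -> \bar R} :=
  if n is m.+1 then measure_cons nu (measure_tuple nu m) else \d_[tuple].

Lemma measure_tuple_box (nu : {sigma_finite_measure set T -> \bar R}) n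
    (A : 'I_n -> set T) : (forall i, measurable (A i)) ->
  measure_tuple nu n [set t | forall i, A i (tnth t i)] = (\prod_i nu (A i))%E.
Proof.
elim: n A => [|n IH] A mA.
  by rewrite big_ord0 /= diracE mem_set// => -[].
have mB : measurable [set t : n.-tuple T | forall i, A (lift ord0 i) (tnth t i)].
  rewrite (_ : [set _ | _] = \bigcap_(i in [set: 'I_n])
      ((fun t : n.-tuple T => tnth t i) @^-1` A (lift ord0 i))).
    apply: fin_bigcap_measurable => [|i _]; first exact: finite_finset.
    by rewrite -[X in measurable X]setTI; exact: measurable_tnth.
  by apply/seteqP; split => t /= At i; [move=> _|]; exact: At.
rewrite big_ord_recl -IH//= /measure_cons /pushforward -product_measure1E//.
congr (product_measure1 _ _ _); apply/seteqP; split => -[a t] /=.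
  by move=> At; split=> [|i]; [exact: (At ord0)|have := At (lift ord0 i); rewrite tnthS].
move=> [A0 At] i; case: (unliftP ord0 i) => [j|] ->; last by [].
by rewrite tnthS; exact: At.
Qed.

End tuple_measure.

Definition lebesgue_tuple {R : realType} (n : nat) :
    {sigma_finite_measure set (n.-tuple (measurableTypeR R)) -> \bar R} :=
  measure_tuple lebesgue_measure n.

Section euclidean.
Context {R : realType}.

Section space.
Context {N : nat}.
Implicit Types (u : 'rV[R]_N -> R) (x : 'rV[R]_N).

(* The library's norm on 'rV[R]_N is the sup norm. *)
Definition enorm x : R := Num.sqrt (\sum_i x 0 i ^+ 2).

Definition eball (rho : \bar R) : set 'rV[R]_N := [set x | ((enorm x)%:E < rho)%E].

Definition partial (i : 'I_N) u : 'rV[R]_N -> R := 'D_(delta_mx 0 i) u.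

Definition grad u x : 'rV[R]_N := \row_i partial i u x.

Definition laplacian u x : R := \sum_i partial i (partial i u) x.

Definition smooth u : Prop :=
  forall (s : seq 'I_N) x,
    {for x, continuous (foldr partial u s)} /\
    forall i, derivable (foldr partial u s) x (delta_mx 0 i).

(* C_0^oo(D) for D open; its elements are identified with their extension by
   zero to the whole space. *)
Definition smooth_compact_support (D : set 'rV[R]_N) u : Prop :=
  [/\ smooth u, compact (closure [set x | u x != 0])
    & closure [set x | u x != 0] `<=` D].

Definition radial u : Prop := exists g : R -> R, forall x, u x = g (enorm x).

(* The product sigma-algebra lives on tuples, differential calculus on row
   vectors; vec identifies the two. *)
Definition integral_Rn (D : set 'rV[R]_N) (f : 'rV[R]_N -> R) : R :=
  let vec (t : N.-tuple (measurableTypeR R)) : 'rV[R]_N := \row_i tnth t i in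
  \int[lebesgue_tuple N]_(t in vec @^-1` D) f (vec t).

End space.

Section line.
Implicit Types (f V W phi : R -> R) (rho : \bar R).

Definition itv0 rho : set R := [set r | 0 < r /\ (r%:E < rho)%E].

Definition smooth_on (D : set R) f : Prop :=
  forall k r, D r -> derivable (derive1n k f) r 1.

Definition smooth_compact_support1 (D : set R) f : Prop :=
  [/\ smooth_on setT f, compact (closure [set r | f r != 0])
    & closure [set r | f r != 0] `<=` D].

(* (V, W) is an n-dimensional Bessel pair on (0, rho), for n >= 1; the solution
   phi of the differential equation is understood in the classical sense. *)
Definition bessel_pair (n : nat) rho V W : Prop :=
  (forall r, itv0 rho r -> 0 <= V r) /\
  exists phi, forall r, itv0 rho r ->
    let flux s := s ^+ n.-1 * V s * derive1 phi s in
    [/\ 0 < phi r, derivable phi r 1, derivable flux r 1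
      & derive1 flux r + r ^+ n.-1 * W r * phi r = 0].

End line.

End euclidean.

(* Main.v *)
Require Import Defs.
From HB Require Import structures.
From mathcomp Require Import all_boot all_order all_algebra.
From mathcomp Require Import all_classical all_reals all_analysis.
From mathcomp Require Import measurable_realfun.
From mathcomp Require Import ring lra.
Import Order.TTheory GRing.Theory Num.Theory.
Import numFieldNormedType.Exports.
Local Open Scope classical_set_scope.
Local Open Scope ring_scope.
Set Implicit Arguments.
Unset Strict Implicit.
Unset Printing Implicit Defensive.

(** In polar coordinates the Laplacian splits as [r^2 Lap = rad + sph], where [rad]
    differentiates along rays and [sph], the Laplacian of spheres, is half the sum
    of the squares of the rotation fields [rot i j = x_i d_j - x_j d_i]. Likewise
    [r^2 |grad u|^2] is the square of the Euler derivative plus half the sum of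
    the squares of the [rot i j u]. Rotations commute with everything radial and
    are skew against radial weights, so expanding the square of the Laplacian
    and integrating its mixed term by parts ([energy_split]) writes the
    difference of the two sides of the inequality as a sum of three parts.

    The radial part only involves radial derivatives and is nonnegative on each
    ray: for [k = f' / r] it is the energy of the pair [(V, W + N V' / r)] in
    dimension [N + 2], and the positive solution of the Bessel equation completes
    the square ([bessel_ray_ge0], [radial_part_ge0]).

    The angular part is a sum over the functions [rot i j u]. On each ray an
    integration by parts identifies it with the one-dimensional form assumed to
    be nonnegative in the second half of the theorem ([angular_line_ge0],
    [angular_part_ge0]). It vanishes for radial functions, which gives the first
    half.

    The spherical part is the integral of [V r^-4 ((sph u)^2 - (N - 1) |grad_S u|^2)]
    with [|grad_S u|^2] half the sum of the squares of the [rot i j u]. It is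
    nonnegative because the first positive eigenvalue of the unit sphere is
    [N - 1] ([spherical_gap]). Instead of spherical harmonics, the proof
    integrates Bochner's inequality, all of whose terms are rotation derivatives
    ([bochner_rot]), when [N >= 3], and uses Wirtinger's inequality on circles
    when [N = 2].

    No measure on spheres is needed. That an integral over space is nonnegative
    as soon as its integrals over rays are ([polar_ge0]), or its integrals over
    the orbits of a rotation ([rotation_average_ge0]), follows from Fubini's
    theorem for a one-parameter family of divergences ([Iint_average]). *)

(** * Integrals of continuous functions of bounded support *)

Definition vec {R : realType} n (t : n.-tuple (measurableTypeR R)) : 'rV[R]_n :=
  \row_i tnth t i.

Definition box {R : realType} n (M : R) : set (n.-tuple (measurableTypeR R)) :=
  [set t | forall i, `[- M, M]%classic (tnth t i)].

Arguments box {R} n M.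

Section measure.
Context {R : realType}.

Lemma measurable_box n (M : R) : measurable (box n M).
Proof.
rewrite (_ : box n M = \bigcap_(i in [set: 'I_n])
    ((fun t : n.-tuple (measurableTypeR R) => tnth t i) @^-1` `[- M, M]%classic)).
  apply: fin_bigcap_measurable => [|i _]; first exact: finite_finset.
  by rewrite -[X in measurable X]setTI; exact: measurable_tnth.
by apply/seteqP; split => t /= At i; [move=> _|]; exact: At.
Qed.

Lemma lebesgue_box n (M : R) : (lebesgue_tuple n (box n M) < +oo)%E.
Proof.
have -> : lebesgue_tuple n (box n M) = (\prod_(i < n) (lebesgue_measure (`[(- M)%R, M]%classic : set R)))%E.
  exact: (measure_tuple_box lebesgue_measure (fun=> measurable_itv _)).
rewrite lebesgue_measure_itv/=.
have : exists2 r : R, (if ((- M)%:E < M%:E)%E then (M%:E - (- M)%:E)%E else 0%E) = r%:E & 0 <= r.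
  case: ifP => [|_]; last by exists 0.
  by rewrite lte_fin => MM; rewrite -EFinB; exists (M - - M) => //; rewrite subr_ge0 ltW.
move=> [r -> r0]; rewrite prodEFin; exact: ltry.
Qed.

(** The product sigma-algebra contains the open sets of ['rV[R]_n] because an
    open set is the union of the countably many cubes with rational centre and
    side [2 / (k + 1)] that it contains. *)
Lemma measurable_vec_open n (U : set 'rV[R]_n) : open U ->
  measurable ((@vec R n) @^-1` U).
Proof.
move=> oU.
pose B (p : 'rV[rat]_n * nat) : set (n.-tuple (measurableTypeR R)) :=
  [set t | forall i, `]ratr (p.1 0 i) - p.2.+1%:R^-1, ratr (p.1 0 i) + p.2.+1%:R^-1[%classic (tnth t i)].
have mB p : measurable (B p).
  rewrite (_ : B p = \bigcap_(i in [set: 'I_n])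
    ((fun t : n.-tuple (measurableTypeR R) => tnth t i) @^-1`
      `]ratr (p.1 0 i) - p.2.+1%:R^-1, ratr (p.1 0 i) + p.2.+1%:R^-1[%classic)).
    apply: fin_bigcap_measurable => [|i _]; first exact: finite_finset.
    by rewrite -[X in measurable X]setTI; exact: measurable_tnth.
  by apply/seteqP; split => t /= At i; [move=> _|]; exact: At.
rewrite (_ : _ @^-1` _ = \bigcup_p
    (if `[< B p `<=` (@vec R n) @^-1` U >] then B p else set0)).
  apply: countable_bigcupT_measurable => [|p]; first exact: countableP.
  by case: ifP.
apply/seteqP; split => [t Ut|t [p _]]; last by case: asboolP => // + Bt; exact.
have [e /= e0 eU] := (nbhs_ballP _ _).1 (open_nbhs_nbhs (conj oU Ut)).
have e20 : 0 < e / 2 by rewrite divr_gt0.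
have [k _ kP] := near_infty_natSinv_lt (PosNum e20).
have ke : k.+1%:R^-1 < e / 2 by apply: kP => /=.
have k0 : 0 < k.+1%:R^-1 :> R by rewrite invr_gt0.
have qP (i : 'I_n) : exists q : rat, `|tnth t i - ratr q| < k.+1%:R^-1.
  have tk : tnth t i < (tnth t i : R) + k.+1%:R^-1 by rewrite ltrDl.
  have [q] := rat_in_itvoo tk.
  rewrite in_itv/= => /andP[q1 q2]; exists q.
  by rewrite distrC ger0_norm ?subr_ge0 ?(ltW q1)// ltrBlDl.
pose p : 'rV[rat]_n * nat := (\row_i xget 0 [set q : rat | `|tnth t i - ratr q| < k.+1%:R^-1], k).
have pP i : `|tnth t i - ratr (p.1 0 i)| < k.+1%:R^-1.
  rewrite /p/= mxE; case: xgetP => [//|h].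
  by have [q /= qq] := qP i; have := h q.
exists p => //; rewrite asboolT.
  by move=> i; have := pP i; rewrite ltr_distl => pi; rewrite /= in_itv.
move=> s Bs; apply: eU; split=> [|a i]; first by []; rewrite !mxE /ball/=.
have := Bs i; rewrite /= in_itv/= -ltr_distl => si.
rewrite (le_lt_trans (ler_distD (ratr (p.1 0 i)) _ _))//.
by rewrite [e]splitr ltrD// (lt_trans _ ke)//; rewrite distrC.
Qed.


Lemma measurable_vec n (f : 'rV[R]_n -> R) : continuous f ->
  measurable_fun [set: n.-tuple (measurableTypeR R)] (f \o @vec R n).
Proof.
move=> /continuousP cf; apply: (measurability _ (RGenOpens.measurableE R)).
move=> _ [_ [a [b ->] <-]]; rewrite setTI comp_preimage.
by apply: measurable_vec_open; apply: cf; exact: itv_open.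
Qed.

Lemma continuous_row (T : topologicalType) n (f : T -> 'rV[R]_n) :
  (forall i, continuous (fun t => f t 0 i)) -> continuous f.
Proof.
move=> cf t; apply/cvgrPdist_lt => e e0; near=> s.
rewrite /Num.norm/= mx_normrE; apply/bigmax_ltP; split=> // -[i j] _ /=.
rewrite !mxE (ord1 i); move: j {i}; near: s.
by apply: filter_forall => j; have /cvgrPdist_lt := cf j t; exact.
Unshelve. all: by end_near. Qed.

Lemma finite_support_integrable d (T : measurableType d)
    (mu : {measure set T -> \bar R}) (A : set T) (f : T -> R) (C : R) :
    measurable A -> (mu A < +oo)%E -> measurable_fun setT f ->
    (forall t, f t != 0 -> A t) -> (forall t, `|f t| <= C) ->
  mu.-integrable setT (EFin \o f).
Proof.
move=> mA Aoo mf fA fC.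
rewrite (_ : EFin \o f = (EFin \o f) \_ A); last first.
  apply/funext => t; rewrite patchE /=; case: ifPn => // /negP tA.
  by have [->//|/fA/mem_set] := eqVneq (f t) 0.
apply: (integrable_mkcond _ mA).1; apply: measurable_bounded_integrable => //.
  exact: measurable_funTS.
by exists C; split; [exact: num_real|move=> x Cx t _ /=; rewrite (le_trans (fC t))// ltW].
Qed.

(** Every integrand below belongs to this class, which makes integrability
    automatic. *)
Definition test_fun n (f : 'rV[R]_n -> R) := continuous f /\
  exists M : R, forall x, f x != 0 -> forall i, `|x 0 i| <= M.

Lemma bounded_on_box n (f : 'rV[R]_n -> R) (M : R) : continuous f ->
  exists C : R, forall x : 'rV[R]_n, (forall i, `|x 0 i| <= M) -> `|f x| <= C.
Proof.
move=> cf; pose M' := Num.max 0 M.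
pose A := [set x : 'rV[R]_n | forall i, `[-M', M']%classic (x ord0 i)].
have cA : compact A by apply: (@rV_compact R n (fun=> [set` `[- M', M']])) => i; exact: segment_compact.
have A0 : A !=set0 by exists 0 => i; rewrite /= mxE in_itv/= oppr_le0 le_max lexx.
have cf' : {within A, continuous (fun x => `|f x|)}.
  by apply: continuous_subspaceT => x; apply: continuous_comp (cf x) _; exact: norm_continuous.
have [c _ cP] := EVT_max_rV A0 cA cf'.
exists `|f c| => x xM; apply: cP; rewrite inE => i /=.
by rewrite in_itv/= -ler_norml le_max xM orbT.
Qed.

Lemma test_fun_integrable n (f : 'rV[R]_n -> R) : test_fun f ->
  (lebesgue_tuple n).-integrable setT (EFin \o (f \o @vec R n)).
Proof.
move=> [cf [M fM]]; have [C fC] := bounded_on_box M cf.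
apply: (@finite_support_integrable _ _ _ (box n M) _ (Num.max 0 C)).
- exact: measurable_box.
- exact: lebesgue_box.
- exact: measurable_vec.
- by move=> t /= /fM + i => /(_ i); rewrite mxE /= in_itv/= -ler_norml.
- move=> t /=; have [->|] := eqVneq (f (vec t)) 0; first by rewrite normr0 le_max lexx.
  move=> /fM/fC ftC.
  by rewrite le_max ftC orbT.
Qed.

Definition Iint n (f : 'rV[R]_n -> R) : R :=
  \int[lebesgue_tuple n]_t f (vec t).

Lemma integral_RnE n (D : set 'rV[R]_n) (f : 'rV[R]_n -> R) :
  (forall x, ~ D x -> f x = 0) -> integral_Rn D f = Iint f.
Proof.
move=> fD; rewrite /integral_Rn /Iint Rintegral_mkcond.
apply: eq_Rintegral => t _; rewrite patchE; case: ifPn => // /negP tD.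
by rewrite fD// => Dt; apply: tD; rewrite inE.
Qed.

Lemma IintD n (f g : 'rV[R]_n -> R) : test_fun f -> test_fun g ->
  Iint (fun x => f x + g x) = Iint f + Iint g.
Proof. by move=> tf tg; rewrite /Iint RintegralD//; exact: test_fun_integrable. Qed.

Lemma IintZ n (f : 'rV[R]_n -> R) (c : R) : test_fun f ->
  Iint (fun x => c * f x) = c * Iint f.
Proof. by move=> tf; rewrite /Iint RintegralZl//; exact: test_fun_integrable. Qed.

Lemma Iint_ge0 n (f : 'rV[R]_n -> R) : (forall x, 0 <= f x) -> 0 <= Iint f.
Proof. by move=> f0; apply: Rintegral_ge0 => x _; exact: f0. Qed.


(** The counterpart of [tcons] on row vectors. *)
Definition rcons0 n (a : R) (x : 'rV[R]_n) : 'rV[R]_n.+1 :=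
  \row_i if unlift ord0 i is Some j then x 0 j else a.

Lemma rcons00 n a (x : 'rV[R]_n) : rcons0 a x 0 ord0 = a.
Proof. by rewrite mxE unlift_none. Qed.

Lemma rcons0S n a (x : 'rV[R]_n) j : rcons0 a x 0 (lift ord0 j) = x 0 j.
Proof. by rewrite mxE liftK. Qed.

Lemma vec_tcons n (z : R * n.-tuple (measurableTypeR R)) :
  vec (tcons z) = rcons0 z.1 (vec z.2).
Proof.
apply/rowP => i; case: (unliftP ord0 i) => [j|] ->.
  by rewrite rcons0S !mxE /tcons tnthS.
by rewrite rcons00 mxE.
Qed.

Lemma lebesgue_itv_fin (M : R) :
  lebesgue_measure (`[- M, M]%classic : set R) \is a fin_num.
Proof. by rewrite lebesgue_measure_itv/=; case: ifP => // _; rewrite -EFinB. Qed.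

(** Joint measurability is assumed rather than continuity: [Iint_average] cuts
    a continuous family to an interval of parameters. *)
Section fubini.
Variables (n : nat) (f : R -> 'rV[R]_n -> R) (C M : R).
Let mu1 : {sigma_finite_measure set (measurableTypeR R) -> \bar R} := lebesgue_measure.
Let mu2 := lebesgue_tuple n : {sigma_finite_measure set (n.-tuple (measurableTypeR R)) -> \bar R}.
Let F (z : measurableTypeR R * n.-tuple (measurableTypeR R)) := f z.1 (vec z.2).
Hypothesis mf : measurable_fun setT F.
Hypothesis fC : forall t x, `|f t x| <= C.
Hypothesis fM : forall t x, f t x != 0 -> `|t| <= M /\ forall i, `|x 0 i| <= M.

Lemma integrable_product : (mu1 \x mu2)%E.-integrable setT (EFin \o F).
Proof.
apply: (@finite_support_integrable _ _ (mu1 \x mu2)%E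
  ((`[-M, M]%classic : set (measurableTypeR R)) `*` box n M) F C) => //.
- by apply: measurableX; [exact: measurable_itv|exact: measurable_box].
- rewrite /= product_measure1E//; last exact: measurable_box.
  rewrite lte_mul_pinfty//; [|exact: lebesgue_box].
  exact: lebesgue_itv_fin.
- move=> [t x] /fM [/= tM xM]; split; first by rewrite /= in_itv/= -ler_norml.
  by move=> i /=; rewrite in_itv/= -ler_norml; have := xM i; rewrite mxE.
- by move=> z; exact: fC.
Qed.

Lemma integrable_product_swap :
  (mu2 \x mu1)%E.-integrable setT (EFin \o (fun z => F (z.2, z.1))).
Proof.
apply: (@finite_support_integrable _ _ (mu2 \x mu1)%E
  (box n M `*` (`[-M, M]%classic : set (measurableTypeR R))) (fun z => F (z.2, z.1)) C) => //.
- by apply: measurableX; [exact: measurable_box|exact: measurable_itv].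
- rewrite /= product_measure1E//; last exact: measurable_box.
  rewrite lte_mul_pinfty//.
  + by rewrite ge0_fin_numE//; exact: lebesgue_box.
  + by rewrite -ge0_fin_numE//; exact: lebesgue_itv_fin.
- by apply: (measurableT_comp mf); apply: measurable_fun_pair.
- move=> [x t] /fM [/= tM xM]; split; last by rewrite /= in_itv/= -ler_norml.
  by move=> i /=; rewrite in_itv/= -ler_norml; have := xM i; rewrite mxE.
- by move=> z; exact: fC.
Qed.

Lemma integrable_section1 t : mu2.-integrable setT (EFin \o (fun s => F (t, s))).
Proof.
apply: (@finite_support_integrable _ _ mu2 (box n M) (fun s => F (t, s)) C) => //.
- exact: measurable_box.
- exact: lebesgue_box.
- by apply: measurableT_comp => //; exact: measurable_pair1.
- by move=> x /fM [/= tM xM] i /=; rewrite in_itv/= -ler_norml; have := xM i; rewrite mxE.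
- by move=> z; exact: fC.
Qed.

Lemma integrable_section2 s : mu1.-integrable setT (EFin \o (fun t => F (t, s))).
Proof.
apply: (@finite_support_integrable _ _ mu1
  (`[-M, M]%classic : set (measurableTypeR R)) (fun t => F (t, s)) C) => //.
- by rewrite -ge0_fin_numE//; exact: lebesgue_itv_fin.
- by apply: measurableT_comp => //; exact: measurable_pair2.
- by move=> x /fM [/= tM xM] /=; rewrite in_itv/= -ler_norml.
- by move=> z; exact: fC.
Qed.

Lemma Rintegral_EFin d (T : measurableType d) (mu : {measure set T -> \bar R}) (g : T -> R) :
  mu.-integrable setT (EFin \o g) -> (\int[mu]_t g t)%:E = (\int[mu]_t (g t)%:E)%E.
Proof.
by move=> ig; rewrite /Rintegral fineK//; exact: integrable_fin_num.
Qed.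

Lemma integrable_inner1 : mu1.-integrable setT (EFin \o (fun t => Iint (f t))).
Proof.
have := integrable_fubini_F integrable_product.
by apply: eq_integrable => // t _ /=; rewrite /Iint Rintegral_EFin//; exact: integrable_section1.
Qed.

Lemma integrable_inner2 :
  mu2.-integrable setT (EFin \o (fun s => \int[mu1]_t f t (vec s))).
Proof.
have := integrable_fubini_F integrable_product_swap.
by apply: eq_integrable => // t _ /=; rewrite Rintegral_EFin//; exact: integrable_section2.
Qed.

Lemma fubini_Iint :
  \int[mu1]_t Iint (f t) = Iint (fun x => \int[mu1]_t f t x).
Proof.
apply: EFin_inj; rewrite Rintegral_EFin; last exact: integrable_inner1.
rewrite /Iint Rintegral_EFin; last exact: integrable_inner2.
transitivity (\int[mu1]_t \int[mu2]_s (F (t, s))%:E)%E.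
  by apply: eq_integral => t _; rewrite Rintegral_EFin//; exact: integrable_section1.
rewrite (@Fubini _ _ _ _ _ mu1 mu2 (EFin \o F) integrable_product).
by apply: eq_integral => s _; rewrite Rintegral_EFin//; exact: integrable_section2.
Qed.

End fubini.

Lemma measurable_cons_continuous n (G : 'rV[R]_n.+1 -> R) : continuous G ->
  measurable_fun setT (fun z : measurableTypeR R * n.-tuple (measurableTypeR R) =>
    G (rcons0 z.1 (vec z.2))).
Proof.
move=> cG.
have := measurableT_comp (measurable_vec cG) (@measurable_tcons _ (measurableTypeR R) n).
by apply: eq_measurable_fun => z _ /=; rewrite vec_tcons.
Qed.

Section cons.
Variables (n : nat) (G : 'rV[R]_n.+1 -> R).
Hypothesis tG : test_fun G.

Let bG : exists CM : R * R, (forall t x, `|G (rcons0 t x)| <= CM.1) /\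
  forall t x, G (rcons0 t x) != 0 -> `|t| <= CM.2 /\ forall i, `|x 0 i| <= CM.2.
Proof.
case: tG => cG [M GM]; have [C GC] := bounded_on_box M cG.
exists (Num.max 0 C, M); split => t x /=.
  have [->|/GM/GC GtC] := eqVneq (G (rcons0 t x)) 0.
    by rewrite normr0 le_max lexx.
  by rewrite le_max GtC orbT.
move=> /GM H; split; first by have := H ord0; rewrite rcons00.
by move=> i; have := H (lift ord0 i); rewrite rcons0S.
Qed.

(** The measure is the image under [tcons] of a product measure, so that one
    coordinate splits off. *)
Lemma Iint_cons :
  Iint G = \int[lebesgue_measure]_t Iint (fun x => G (rcons0 t x)).
Proof.
have [[C M] [/= GC GM]] := bG; have [cG _] := tG.
have mG := measurable_cons_continuous cG.
have iG := @integrable_product n (fun t x => G (rcons0 t x)) C M mG GC GM.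
have -> : \int[lebesgue_measure]_t Iint (fun x => G (rcons0 t x)) =
    fine (\int[(lebesgue_measure \x lebesgue_tuple n)%E]_z (G (rcons0 z.1 (vec z.2)))%:E)%E.
  rewrite -(integral12_prod_meas1 iG) /Rintegral; congr fine.
  apply: eq_integral => t _; rewrite /fubini_F Rintegral_EFin//.
  exact: (@integrable_section1 n (fun t x => G (rcons0 t x)) C M).
rewrite /Iint /Rintegral; congr fine.
transitivity (\int[pushforward (lebesgue_measure \x lebesgue_tuple n)%E (@tcons _ (measurableTypeR R) n)]_t (G (vec t))%:E)%E.
  by [].
rewrite (integral_pushforward (@measurable_tcons _ (measurableTypeR R) n) (f := EFin \o (G \o @vec R n.+1)))//.
- by apply: eq_integral => z _ /=; rewrite vec_tcons.
- by apply/measurable_EFinP; exact: measurable_vec.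
- by apply: eq_integrable iG => // z _ /=; rewrite vec_tcons.
Qed.

End cons.
End measure.

(** * Calculus on the line *)
Section line.
Context {R : realType}.
Implicit Types (f g F G : R -> R).
Local Notation mu := (@lebesgue_measure R).

Lemma continuous_integrable_itv f (a b : R) : continuous f ->
  mu.-integrable `[a, b] (EFin \o f).
Proof.
move=> cf; apply: continuous_compact_integrable; first exact: segment_compact.
exact: continuous_subspaceT.
Qed.

Lemma is_derive_continuous f (x d : R) : is_derive x 1 f d -> {for x, continuous f}.
Proof.
by move=> fd; apply: differentiable_continuous; apply/derivable1_diffP; exact: ex_derive.
Qed.

Lemma Rintegral_derive f F (a b : R) : a <= b -> continuous f ->
  (forall x : R, a <= x <= b -> is_derive x 1 F (f x)) ->
  \int[mu]_(x in `[a, b]) f x = F b - F a.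
Proof.
rewrite le_eqVlt => /predU1P[<- _ _|ab cf dF].
  by rewrite set_itv1 Rintegral_set1 subrr.
rewrite /Rintegral (@continuous_FTC2 _ f F a b)//.
- exact: continuous_subspaceT.
- split.
  + by move=> x /[!in_itv]/= /andP[/ltW ax /ltW xb]; apply: ex_derive; apply: dF; rewrite ax.
  + by apply: cvg_at_right_filter; apply: is_derive_continuous (dF _ _); rewrite lexx ltW.
  + by apply: cvg_at_left_filter; apply: is_derive_continuous (dF _ _); rewrite lexx ltW.
- move=> x /[!in_itv]/= /andP[/ltW ax /ltW xb]; rewrite derive1E.
  by apply: derive_val; apply: dF; rewrite ax.
Qed.

Lemma antiderivative f (a b : R) : continuous f ->
  exists F, forall x : R, a <= x <= b -> is_derive x 1 F (f x).
Proof.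
move=> cf; exists (fun x => \int[mu]_(t in `[a - 1, x]) f t) => x /andP[ax xb].
have a1x : a - 1 < x by rewrite (lt_le_trans _ ax)// ltrBlDr ltrDl.
have xb1 : x < b + 1 by rewrite (le_lt_trans xb)// ltrDl.
have [dF <-] := continuous_FTC1_closed xb1 (continuous_integrable_itv _ _ cf) a1x (cf x).
by rewrite derive1E; exact: DeriveDef.
Qed.

(** [B] is merely differentiable, and its derivative need not be integrable a
    priori: where [V] vanishes, the derivative of a solution of the Bessel
    equation may be discontinuous. Comparison with an antiderivative of [f]
    only uses that a function with nonnegative derivative is nondecreasing. *)
Lemma le_Rintegral_derive f (B dB : R -> R) (a b : R) : a <= b -> continuous f ->
  (forall x : R, a <= x <= b -> is_derive x 1 B (dB x)) ->
  (forall x : R, a <= x <= b -> dB x <= f x) ->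
  B b - B a <= \int[mu]_(x in `[a, b]) f x.
Proof.
move=> ab cf dBP dBf; have [F dF] := antiderivative a b cf.
rewrite (Rintegral_derive ab cf dF) -subr_ge0.
have dFB x : a <= x <= b -> is_derive x 1 (F \- B) (f x - dB x).
  by move=> axb; have := dF x axb; have := dBP x axb => ? ?; exact: is_deriveB.
have ioo x : x \in `]a, b[ -> a <= x <= b.
  by rewrite in_itv/= => /andP[/ltW -> /ltW ->].
have : (F \- B) a <= (F \- B) b.
  apply: (@ger0_derive1_le_cc _ (F \- B) a b) => //.
  - by move=> x /ioo axb; have := dFB x axb => ?; exact: ex_derive.
  - move=> x /ioo axb; rewrite derive1E; have := dFB x axb => ?.
    by rewrite derive_val subr_ge0 dBf.
  - apply: derivable_within_continuous => x; rewrite in_itv/= => axb.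
    by have := dFB x axb => ?; exact: ex_derive.
  - by rewrite in_itv/= lexx.
  - by rewrite in_itv/= lexx ab.
by rewrite /=; lra.
Qed.

Lemma RintegralT_itv f (a b : R) : (forall x, ~~ (a <= x <= b) -> f x = 0) ->
  \int[mu]_x f x = \int[mu]_(x in `[a, b]) f x.
Proof.
move=> f0; rewrite [RHS]Rintegral_mkcond; apply: eq_Rintegral => x _.
rewrite patchE; case: ifPn => // xab; apply: f0; apply: contra xab => xab.
by rewrite inE /= in_itv.
Qed.

Lemma RintegralT_derive_eq0 f F (M : R) : continuous f ->
  (forall x : R, is_derive x 1 F (f x)) ->
  (forall x, f x != 0 -> `|x| <= M) -> (forall x, F x != 0 -> `|x| <= M) ->
  \int[mu]_x f x = 0.
Proof.
move=> cf dF fM FM; pose m := Num.max 0 M + 1.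
have Mm : M < m by rewrite /m (@le_lt_trans _ _ (Num.max 0 M))// ?le_max ?lexx ?orbT ?ltrDl.
have m0 : 0 < m by rewrite ltr_pwDr// le_max lexx.
rewrite (@RintegralT_itv _ (- m) m); last first.
  move=> x; rewrite -ler_norml; apply: contraNeq => /fM xM.
  by rewrite (le_trans xM)// ltW.
rewrite (@Rintegral_derive f F)//; last by rewrite ge0_cp// ltW.
have F0 x : `|x| = m -> F x = 0.
  by move=> xm; apply/eqP; apply: contraLR Mm => /FM; rewrite xm -leNgt.
by rewrite !F0 ?subrr// ?normrN gtr0_norm.
Qed.

End line.

(** * Integrals of divergences *)
Section divergence.
Context {R : realType}.

Lemma is_derive_line (V : normedModType R) (F : V -> R) (c : R -> V) v t d :
  (forall s, c s = c t + (s - t) *: v) ->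
  is_derive (c t) v F d -> is_derive t 1 (F \o c) d.
Proof.
move=> cE dF.
have E : (fun h : R => h^-1 *: ((F \o c \o shift t) (h *: (1 : R)) - (F \o c) t)) =
         (fun h : R => h^-1 *: ((F \o shift (c t)) (h *: v) - F (c t))).
  apply/funext => h /=; congr (_ *: (F _ - _)).
  by rewrite cE addrK addrC; congr (_ *: _ + _); rewrite /GRing.scale/= mulr1.
by case: dF => dF1 dF2; apply: DeriveDef; rewrite /derivable /derive E.
Qed.

Lemma is_derive_slice (V W : normedModType R) (F : W -> R) (c : V -> W) v w x d :
  (forall h : R, c (h *: v + x) = h *: w + c x) ->
  is_derive (c x) w F d -> is_derive x v (F \o c) d.
Proof.
move=> cE dF.
have E : (fun h : R => h^-1 *: ((F \o c \o shift x) (h *: v) - (F \o c) x)) =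
         (fun h : R => h^-1 *: ((F \o shift (c x)) (h *: w) - F (c x))).
  by apply/funext => h /=; rewrite cE.
by case: dF => dF1 dF2; apply: DeriveDef; rewrite /derivable /derive E.
Qed.

Lemma rcons0_continuous1 n (x : 'rV[R]_n) : continuous (fun t => rcons0 t x).
Proof.
apply: continuous_row => i; case: (unliftP ord0 i) => [j|] -> t.
  under eq_fun do rewrite rcons0S; exact: cst_continuous.
by under eq_fun do rewrite rcons00; exact: cvg_id.
Qed.

Lemma rcons0_continuous2 n (t : R) : continuous (@rcons0 R n t).
Proof.
apply: continuous_row => i; case: (unliftP ord0 i) => [j|] -> x.
  under eq_fun do rewrite rcons0S; exact: coord_continuous.
by under eq_fun do rewrite rcons00; exact: cst_continuous.
Qed.

(** A derivative along the first coordinate integrates to zero on each line, and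
    Fubini puts that coordinate innermost; a derivative along another one is
    treated slice by slice, by induction on the dimension. *)
Lemma Iint_partial n (i : 'I_n) (F G : 'rV[R]_n -> R) :
  test_fun F -> test_fun G ->
  (forall x, is_derive x (delta_mx 0 i) F (G x)) -> Iint G = 0.
Proof.
elim: n i F G => [[]//|n IH] i F G [cF [M FM]] [cG [M' GM]] dF.
rewrite Iint_cons; last by split => //; exists M'.
case: (unliftP ord0 i) dF => [j|] -> dF.
  rewrite (_ : (fun t => _) = cst 0); first by rewrite Rintegral_cst//= mul0r.
  apply/funext => t; apply: (IH j (fun x => F (rcons0 t x))).
  - split; first by move=> x; apply: continuous_comp (cF _); exact: rcons0_continuous2.
    by exists M => x /FM H k; have := H (lift ord0 k); rewrite rcons0S.
  - split; first by move=> x; apply: continuous_comp (cG _); exact: rcons0_continuous2.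
    by exists M' => x /GM H k; have := H (lift ord0 k); rewrite rcons0S.
  - move=> x; apply: is_derive_slice (dF _) => h; apply/rowP => k.
    case: (unliftP ord0 k) => [l|] ->.
      by rewrite !mxE liftK !mxE (inj_eq lift_inj).
    by rewrite !mxE unlift_none (negPf (neq_lift _ _)) andbF mulr0 add0r.
have [C GC] := bounded_on_box M' cG.
have mG := measurable_cons_continuous cG.
have GC' t x : `|G (rcons0 t x)| <= Num.max 0 C.
  have [->|/GM/GC GtC] := eqVneq (G (rcons0 t x)) 0.
    by rewrite normr0 le_max lexx.
  by rewrite le_max GtC orbT.
have GM2 t x : G (rcons0 t x) != 0 -> `|t| <= M' /\ forall i, `|x 0 i| <= M'.
  move=> /GM H; split; first by have := H ord0; rewrite rcons00.
  by move=> k; have := H (lift ord0 k); rewrite rcons0S.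
rewrite (@fubini_Iint R n (fun t x => G (rcons0 t x)) _ M' mG GC' GM2).
rewrite (_ : (fun x => _) = cst 0); first by rewrite /Iint Rintegral_cst//= mul0r.
apply/funext => x.
apply: (@RintegralT_derive_eq0 R (fun t : R => G (rcons0 t x)) (fun t : R => F (rcons0 t x)) (Num.max M M')).
- by move=> t; exact: (continuous_comp (@rcons0_continuous1 _ x t) (cG _)).
- move=> t; apply: (@is_derive_line _ F (fun t => rcons0 t x) (delta_mx 0 ord0) t _ _ (dF (rcons0 t x))) => s; apply/rowP => k.
  case: (unliftP ord0 k) => [l|] ->.
    by rewrite !mxE liftK eq_sym (negPf (neq_lift _ _)) andbF mulr0 addr0.
  by rewrite !mxE unlift_none eqxx mulr1 addrC subrK.
- by move=> t /GM /(_ ord0); rewrite rcons00 le_max => ->; rewrite orbT.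
- by move=> t /FM /(_ ord0); rewrite rcons00 le_max => ->.
Qed.

(** Fubini in place of a change of variables: integrated over [x] first, the
    family [Phi] gives zero; integrated over [t] first, it gives a lower bound
    of [g]. In the applications [Phi t] is a divergence. *)
Lemma Iint_average n (a b M : R) (Phi : R -> 'rV[R]_n -> R) (g : 'rV[R]_n -> R) :
  continuous (fun z : R * 'rV[R]_n => Phi z.1 z.2) ->
  (forall t x, a <= t <= b -> Phi t x != 0 -> forall i, `|x 0 i| <= M) ->
  (forall t, a <= t <= b -> Iint (Phi t) = 0) ->
  test_fun g ->
  (forall x, \int[lebesgue_measure]_(t in `[a, b]) Phi t x <= g x) ->
  0 <= Iint g.
Proof.
move=> cPhi PhiM IPhi tg Phig.
pose f t x := \1_(`[a, b]%classic : set R) t * Phi t x.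
pose L := Num.max M (Num.max `|a| `|b|).
pose Psi (x : 'rV[R]_n.+1) := Phi (x 0 ord0) (\row_j x 0 (lift ord0 j)).
have cPsi : continuous Psi.
  move=> x; pose c (y : 'rV[R]_n.+1) := (y 0 ord0, \row_j y 0 (lift ord0 j) : 'rV[R]_n).
  suff cc : {for x, continuous c} by exact: (continuous_comp cc (cPhi (c x))).
  have c2 : continuous (fun y : 'rV[R]_n.+1 => \row_j y 0 (lift ord0 j) : 'rV[R]_n).
    apply: continuous_row => j; under eq_fun do rewrite mxE.
    exact: coord_continuous.
  exact: (cvg_pair (@coord_continuous _ _ _ _ _ x) (c2 x)).
have PsiE t x : Psi (rcons0 t x) = Phi t x.
  by rewrite /Psi rcons00; congr (Phi _ _); apply/rowP => j; rewrite mxE rcons0S.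
have f0 t x : f t x != 0 -> [/\ a <= t <= b, f t x = Phi t x & Phi t x != 0].
  rewrite /f indicE; case: (boolP (t \in _)) => [|_]; last by rewrite mul0r eqxx.
  by rewrite inE/= in_itv/= mul1r.
have fL t x : f t x != 0 -> `|t| <= L /\ forall i, `|x 0 i| <= L.
  move=> /f0[/andP[at_ tb] _ /PhiM xM]; split; last first.
    by move=> i; rewrite le_max xM// at_.
  rewrite /L le_max; apply/orP; right; rewrite le_max.
  have [t0|t0] := ler0P t; apply/orP; [left|right].
    by have := ler_norm (- a); rewrite normrN; lra.
  by have := ler_norm b; lra.
have [C PsiC] := bounded_on_box L cPsi.
have fC t x : `|f t x| <= Num.max 0 C.
  have [->|ftx] := eqVneq (f t x) 0; first by rewrite normr0 le_max lexx.
  have [tL xL] := fL _ _ ftx; have [_ -> _] := f0 _ _ ftx.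
  rewrite le_max -PsiE PsiC ?orbT// => i; case: (unliftP ord0 i) => [j|] ->.
    by rewrite rcons0S.
  by rewrite rcons00.
have mf : measurable_fun setT (fun z : measurableTypeR R * n.-tuple (measurableTypeR R) => f z.1 (vec z.2)).
  apply: measurable_funM.
    apply: (measurableT_comp (measurable_indic _)) => //; exact: measurable_itv.
  have := measurable_cons_continuous cPsi.
  by apply: eq_measurable_fun => z _ /=; rewrite PsiE.
have fE t x : f t x = ((fun s => Phi s x) \_ `[a, b]) t.
  by rewrite patchE /f indicE; case: ifP; rewrite ?mul1r ?mul0r.
have iG := integrable_inner2 mf fC fL.
have /= := fubini_Iint mf fC fL.
rewrite (_ : (fun t => Iint (f t)) = cst 0); last first.
  apply/funext => t /=; have [tab|tab] := boolP (a <= t <= b).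
    rewrite -[RHS](IPhi t tab); congr Iint; apply/funext => x.
    by rewrite fE patchE mem_set//= in_itv.
  rewrite (_ : f t = cst 0); first by rewrite /Iint Rintegral_cst//= mul0r.
  by apply/funext => x /=; apply/eqP; apply: contraNT tab => /f0[].
rewrite Rintegral_cst//= mul0r => E0; rewrite [leLHS]E0.
apply: le_Rintegral => // [|s _]; first exact: test_fun_integrable.
rewrite (le_trans _ (Phig (vec s)))// Rintegral_mkcond le_eqVlt; apply/orP; left.
by apply/eqP; apply: eq_Rintegral => t _; rewrite fE.
Qed.

End divergence.

(** * Functions of class C^k *)

Section continuity.
Context {R : realType} {T : topologicalType}.
Implicit Types f g : T -> R.

Lemma ctsD f g : continuous f -> continuous g -> continuous (fun x => f x + g x).
Proof. by move=> cf cg x; apply: cvgD; [exact: cf|exact: cg]. Qed.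

Lemma ctsB f g : continuous f -> continuous g -> continuous (fun x => f x - g x).
Proof. by move=> cf cg x; apply: cvgB; [exact: cf|exact: cg]. Qed.

Lemma ctsM f g : continuous f -> continuous g -> continuous (fun x => f x * g x).
Proof. by move=> cf cg x; apply: cvgM; [exact: cf|exact: cg]. Qed.

Lemma cts_cst (c : R) : continuous (fun _ : T => c).
Proof. by move=> x; exact: cvg_cst. Qed.

Lemma cts_sum I (r : seq I) (P : pred I) (F : I -> T -> R) :
  (forall i, continuous (F i)) -> continuous (fun x => \sum_(i <- r | P i) F i x).
Proof. by move=> cF x; apply: cvg_big => [|i _]; [exact: add_continuous|exact: cF]. Qed.

Lemma ctsX f k : continuous f -> continuous (fun x => f x ^+ k).
Proof.
move=> cf; elim: k => [|k IH]; first exact: cts_cst.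
by under eq_fun do rewrite exprS; exact: ctsM.
Qed.

End continuity.

Section c1.
Lemma is_derive_derivable (R : numFieldType) (V W : normedModType R) (f : V -> W) a v d :
  is_derive a v f d -> derivable f a v.
Proof. by case. Qed.

Lemma is_derive_val (R : numFieldType) (V W : normedModType R) (f : V -> W) a v d :
  is_derive a v f d -> 'D_v f a = d.
Proof. by case. Qed.

Context {R : realType} {n : nat}.
Implicit Types (f g F G : 'rV[R]_n -> R) (x v h : 'rV[R]_n).

(** Finite regularity is needed next to [smooth]: a smooth function times a
    radial weight will only be known to be of class C^1. *)
Fixpoint Ck (k : nat) F : Prop :=
  if k is k'.+1 then
    continuous F /\ forall i, (forall x, derivable F x (delta_mx 0 i)) /\ Ck k' (partial i F)
  else continuous F.

Local Notation C1 := (Ck 1).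

Definition lform (a h : 'rV[R]_n) : R := \sum_i h 0 i * a 0 i.

Lemma lform_linear a : linear (lform a).
Proof.
move=> c u v; rewrite /lform scaler_sumr -big_split/=; apply: eq_bigr => i _.
by rewrite !mxE mulrDl -mulrA.
Qed.

HB.instance Definition _ a := GRing.isLinear.Build _ _ _ _ (lform a) (lform_linear a).

Lemma lform_continuous a : continuous (lform a).
Proof.
by apply: cts_sum => i; apply: ctsM; [exact: coord_continuous|exact: cts_cst].
Qed.

Lemma partial_MVT F i x (s : R) : C1 F -> exists2 c, `|c| <= `|s| &
  F (x + s *: delta_mx 0 i) - F x = s * partial i F (x + c *: delta_mx 0 i).
Proof.
move=> [cF dF].
have dline (t : R) : is_derive t 1 (fun t : R => F (x + t *: delta_mx 0 i)) (partial i F (x + t *: delta_mx 0 i)).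
  apply: (@is_derive_line _ _ F (fun t : R => x + t *: delta_mx 0 i) (delta_mx 0 i)) => [r|].
    by rewrite -addrA -scalerDl addrCA subrr addr0.
  by apply: derivableP; exact: (dF i).1.
have cl : continuous (fun t : R => F (x + t *: delta_mx 0 i)).
  by move=> t; apply: is_derive_continuous (dline t).
have [s0|s0] := leP 0 s.
  have [c cs E] := MVT_segment s0 (fun t _ => dline t) (continuous_subspaceT cl).
  move: cs; rewrite in_itv/= => /andP[c0 cs].
  exists c; first by rewrite !ger0_norm.
  by rewrite scale0r addr0 subr0 in E; rewrite E mulrC.
have [c cs E] := MVT_segment (ltW s0) (fun t _ => dline t) (continuous_subspaceT cl).
move: cs; rewrite in_itv/= => /andP[c0 cs].
exists c; first by rewrite !ler0_norm ?lerN2// ltW.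
by rewrite scale0r addr0 sub0r in E; rewrite -opprB E; ring.
Qed.

(** The increment of [F] telescopes along the edges of a box, and the mean value
    theorem on each edge brings in a continuous partial derivative. *)
Lemma C1_differentiable F x : C1 F ->
  differentiable F x /\ 'd F x = lform (grad F x) :> ('rV[R]_n -> R).
Proof.
move=> C1F.
suff E : forall e : R, 0 < e -> \forall h \near (0 : 'rV[R]_n),
    `|F (h + x) - (F x + lform (grad F x) h)| <= e * `|h|.
  have dE : 'd F x = lform (grad F x) :> ('rV[R]_n -> R).
    by apply: diff_unique; [exact: lform_continuous|apply/eqaddoP].
  split=> //; apply/diff_locallyP; split; rewrite dE; first exact: lform_continuous.
  exact/eqaddoP.
  move=> e e0; have e'0 : 0 < e / n.+1%:R by rewrite divr_gt0.
  have : \forall y \near x, forall i, `|partial i F x - partial i F y| < e / n.+1%:R.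
    have H i : \forall y \near x, `|partial i F x - partial i F y| < e / n.+1%:R.
      by have /cvgrPdist_lt := (C1F.2 i).2 x; exact.
    exact: (filter_forall (nbhs_filter x) H).
  move=> /(nbhs_ballP x)[d /= d0 dP]; near=> h.
  have hd : `|h| < d.
    near: h; apply/(nbhs_ballP (0 : 'rV[R]_n)); exists d => // y.
    by rewrite mx_norm_ball /ball_/= sub0r normrN.
  (* The corners of the broken line from [x] to [h + x]. *)
  pose p (k : nat) : 'rV[R]_n := \row_j (x 0 j + if (j < k)%N then h 0 j else 0).
  have pS (k : 'I_n) : p k.+1 = p k + h 0 k *: delta_mx 0 k.
    apply/rowP => j; rewrite !mxE eqxx/= ltnS leq_eqVlt -addrA; congr (_ + _).
    have [jk|jk] := eqVneq j k; first by rewrite jk eqxx ltnn mulr1 add0r.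
    by rewrite (_ : (j == k :> nat) = false) ?mulr0 ?addr0//; apply/negbTE.
  have p0 : p 0%N = x by apply/rowP => j; rewrite mxE addr0.
  have pn : p n = h + x by apply/rowP => j; rewrite !mxE ltn_ord addrC.
  have -> : F (h + x) - (F x + lform (grad F x) h) =
      \sum_(k < n) (F (p k.+1) - F (p k) - h 0 k * partial k F x).
    rewrite sumrB -(big_mkord xpredT (fun k => F (p k.+1) - F (p k))).
    rewrite telescope_sumr// p0 pn opprD addrA; congr (_ - _); apply: eq_bigr => k _; by rewrite mxE.
  rewrite (le_trans (ler_norm_sum _ _ _))//.
  have hk k : `|h 0 k| <= `|h|.
    by rewrite [leRHS]/Num.norm/= mx_normrE; exact: (le_bigmax _ (fun ij => `|h ij.1 ij.2|) (0, k)).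
  rewrite (@le_trans _ _ (\sum_(k < n) (e / n.+1%:R * `|h|)))//; last first.
    rewrite sumr_const card_ord -[leLHS]mulr_natr mulrAC ler_wpM2r// mulrAC.
    by rewrite ler_pdivrMr// ler_pM2l// ler_nat.
  apply: ler_sum => k _; rewrite pS; have [c cs ->] := partial_MVT k (p k) (h 0 k) C1F.
  rewrite -mulrBr normrM mulrC ler_pM// distrC ltW// dP//.
  rewrite mx_norm_ball /ball_/= (le_lt_trans _ hd)//.
  rewrite [leLHS]/Num.norm/= mx_normrE; apply/bigmax_leP; split=> // -[i j] _ /=.
  rewrite !mxE (ord1 i) eqxx/=.
  have [->|jk] := eqVneq j k.
    by rewrite ltnn addr0 mulr1 opprD addNKr normrN (le_trans cs).
  rewrite mulr0 addr0 opprD addNKr normrN; case: ifP => _ //; by rewrite normr0.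
Unshelve. all: by end_near. Qed.

Lemma C1_is_derive F x v : C1 F -> is_derive x v F (lform (grad F x) v).
Proof.
move=> C1F; have [dF dE] := C1_differentiable x C1F.
apply: DeriveDef; first exact: diff_derivable.
by rewrite deriveE// dE.
Qed.

Lemma C1_chain F (c : R -> 'rV[R]_n) (c' : 'rV[R]_n) (t : R) : C1 F ->
  (forall i, is_derive t 1 (fun s => c s 0 i) (c' 0 i)) ->
  is_derive t 1 (F \o c) (lform (grad F (c t)) c').
Proof.
move=> C1F dc; have [dF dE] := C1_differentiable (c t) C1F.
have dc1 : derivable c t 1.
  by apply/derivable_mxP => i j; rewrite (ord1 i); exact: is_derive_derivable (dc j).
have dct : differentiable c t by exact/derivable1_diffP.
have dFc : differentiable (F \o c) t by exact: differentiable_comp.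
apply: DeriveDef; first exact: diff_derivable.
rewrite deriveE// diff_comp//= dE; congr lform.
rewrite -deriveE// derive_mx//; apply/rowP => j; rewrite mxE.
exact: is_derive_val (dc j).
Qed.

Lemma Ck_continuous k F : Ck k F -> continuous F.
Proof. by case: k => [//|k] []. Qed.

Lemma CkW k F : Ck k.+1 F -> Ck k F.
Proof.
elim: k F => [|k IH] F [cF dF] //; split=> // i; split; first exact: (dF i).1.
exact/IH/(dF i).2.
Qed.

Lemma Ck_leq k l F : (k <= l)%N -> Ck l F -> Ck k F.
Proof. by elim: l => [|l IH]; [rewrite leqn0 => /eqP->|rewrite leq_eqVlt => /predU1P[->//|/IH H] /CkW]. Qed.

Lemma smoothP F : smooth F <-> forall k, Ck k F.
Proof.
split=> [sF k|cF].
  elim: k F sF => [|k IH] F sF; first by move=> x; exact: (sF [::] x).1.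
  split=> [x|i]; first exact: (sF [::] x).1.
  split=> [x|]; first exact: (sF [::] x).2.
  by apply: IH => s x; have := sF (rcons s i) x; rewrite -cats1 foldr_cat.
move=> s; elim/last_ind: s F cF => [|s i IH] F cF x /=.
  split; first exact: (cF 0%N).
  by move=> i; exact: ((cF 1%N).2 i).1.
rewrite -cats1 foldr_cat /=; apply: IH => k.
exact: ((cF k.+1).2 i).2.
Qed.

Lemma partial_cst i (c : R) : partial i (fun=> c) = (fun=> 0) :> ('rV[R]_n -> R).
Proof. by apply/funext => x; rewrite /partial derive_cst. Qed.

Lemma is_derive_coord i j x :
  is_derive x (delta_mx 0 i) (fun y : 'rV[R]_n => y 0 j) (j == i)%:R.
Proof.
apply: (@is_derive_slice R _ R id (fun y : 'rV[R]_n => y 0 j) _ (j == i)%:R) => c.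
by rewrite !mxE eqxx.
Qed.

Lemma partial_coord i j : partial i (fun x : 'rV[R]_n => x 0 j) = (fun=> (j == i)%:R).
Proof. by apply/funext => x; exact: is_derive_val (is_derive_coord i j x). Qed.

Lemma partialD i f g : C1 f -> C1 g ->
  partial i (fun x => f x + g x) = (fun x => partial i f x + partial i g x).
Proof.
move=> [_ df] [_ dg]; apply/funext => x.
exact: (deriveD ((df i).1 x) ((dg i).1 x)).
Qed.

Lemma partialM i f g : C1 f -> C1 g ->
  partial i (fun x => f x * g x) = (fun x => f x * partial i g x + g x * partial i f x).
Proof.
move=> [_ df] [_ dg]; apply/funext => x.
exact: (deriveM ((df i).1 x) ((dg i).1 x)).
Qed.

Lemma Ck_cst k (c : R) : Ck k (fun=> c).
Proof.
elim: k c => [|k IH] c; first exact: cts_cst.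
split=> [|i]; first exact: cts_cst.
by split=> [x|]; [exact: derivable_cst|rewrite partial_cst].
Qed.

Lemma Ck_coord k j : Ck k (fun x : 'rV[R]_n => x 0 j).
Proof.
case: k => [|k]; first exact: coord_continuous.
split=> [|i]; first exact: coord_continuous.
split=> [x|]; last by rewrite partial_coord; exact: Ck_cst.
exact: is_derive_derivable (is_derive_coord i j x).
Qed.

Lemma CkD k f g : Ck k f -> Ck k g -> Ck k (fun x => f x + g x).
Proof.
elim: k f g => [|k IH] f g Cf Cg; first exact: ctsD.
have [cf df] := Cf; have [cg dg] := Cg.
split=> [|i]; first exact: ctsD.
split=> [x|]; first by apply: derivableD; [exact: (df i).1|exact: (dg i).1].
rewrite partialD; first by apply: IH; [exact: (df i).2|exact: (dg i).2].
  exact: (Ck_leq (ltn0Sn k) Cf).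
exact: (Ck_leq (ltn0Sn k) Cg).
Qed.

Lemma CkM k f g : Ck k f -> Ck k g -> Ck k (fun x => f x * g x).
Proof.
elim: k f g => [|k IH] f g Cf Cg; first exact: ctsM.
have [cf df] := Cf; have [cg dg] := Cg.
split=> [|i]; first exact: ctsM.
split=> [x|]; first by apply: derivableM; [exact: (df i).1|exact: (dg i).1].
rewrite partialM; [|exact: (Ck_leq (ltn0Sn k) Cf)|exact: (Ck_leq (ltn0Sn k) Cg)].
by apply: CkD; apply: IH; [exact: CkW|exact: (dg i).2|exact: CkW|exact: (df i).2].
Qed.

Lemma Ck_sum k I (r : seq I) (P : pred I) (F : I -> 'rV[R]_n -> R) :
  (forall i, Ck k (F i)) -> Ck k (fun x => \sum_(i <- r | P i) F i x).
Proof.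
move=> CF; elim: r => [|i r IH].
  by under eq_fun do rewrite big_nil; exact: Ck_cst.
under eq_fun do rewrite big_cons.
by case: (P i) => //; exact: CkD.
Qed.

Lemma partial_sum i I (r : seq I) (P : pred I) (F : I -> 'rV[R]_n -> R) :
  (forall j, C1 (F j)) -> partial i (fun x => \sum_(j <- r | P j) F j x) =
  (fun x => \sum_(j <- r | P j) partial i (F j) x).
Proof.
move=> CF; elim: r => [|j r IH].
  under eq_fun do rewrite big_nil; rewrite partial_cst.
  by apply/funext => x; rewrite big_nil.
under eq_fun do rewrite big_cons; under [RHS]eq_fun do rewrite big_cons.
case: (P j) => //; rewrite partialD//; first by rewrite IH.
exact: (@Ck_sum 1).
Qed.

Lemma is_derive_shift i F x v : C1 F ->
  is_derive x (delta_mx 0 i) (fun x => F (x + v)) (partial i F (x + v)).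
Proof.
move=> [_ dF]; apply: (@is_derive_slice _ _ _ F (fun x : 'rV[R]_n => x + v) _ (delta_mx 0 i)) => [h|].
  by rewrite addrA.
by apply: derivableP; exact: (dF i).1.
Qed.

Lemma partial_shift i F v : C1 F ->
  partial i (fun x => F (x + v)) = (fun x => partial i F (x + v)).
Proof. by move=> C1F; apply/funext => x; exact: is_derive_val (is_derive_shift i x v C1F). Qed.

Lemma C1_shift F v : C1 F -> C1 (fun x => F (x + v)).
Proof.
move=> C1F; have cS : continuous (fun x : 'rV[R]_n => x + v).
  apply: continuous_row => k; under eq_fun do rewrite mxE.
  by apply: ctsD; [exact: coord_continuous|exact: cts_cst].
split=> [x|i]; first exact: (continuous_comp (cS x) (C1F.1 _)).
split=> [x|]; first exact: is_derive_derivable (is_derive_shift i x v C1F).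
by rewrite partial_shift// => x; exact: (continuous_comp (cS x) ((C1F.2 i).2 _)).
Qed.

(** The double difference on the left is symmetric in [i] and [j]; the symmetry
    of second derivatives follows by letting [s] tend to [0]. *)
Lemma partial_partial_MVT i j F x (s : R) : Ck 2 F -> 0 <= s ->
  exists2 y, `|x - y| <= s + s &
    F (x + s *: delta_mx 0 i + s *: delta_mx 0 j) - F (x + s *: delta_mx 0 i)
    - (F (x + s *: delta_mx 0 j) - F x) = s * (s * partial j (partial i F) y).
Proof.
move=> CF s0; have C1F : C1 F := CkW CF.
have C1s := C1_shift (s *: delta_mx 0 j) C1F.
have C1g : C1 (fun y => F (y + s *: delta_mx 0 j) - F y).
  have := CkD C1s (CkM (Ck_cst 1 (-1)) C1F).
  by under eq_fun do rewrite mulN1r.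
have [c cs E] := partial_MVT i x s C1g.
have Eg : partial i (fun y => F (y + s *: delta_mx 0 j) - F y) =
    fun y => partial i F (y + s *: delta_mx 0 j) - partial i F y.
  apply/funext => y; rewrite -(is_derive_val (is_derive_shift i y (s *: delta_mx 0 j) C1F)).
  exact: (deriveB ((C1s.2 i).1 y) ((C1F.2 i).1 y)).
have [c' c's E'] := partial_MVT j (x + c *: delta_mx 0 i) s (CF.2 i).2.
have nd (k : 'I_n) : `|(delta_mx 0 k : 'rV[R]_n)| <= 1.
  rewrite [leLHS]/Num.norm/= mx_normrE; apply/bigmax_leP; split=> // -[a b] _ /=.
  by rewrite mxE; case: (_ && _); rewrite ?normr0 ?normr1.
exists (x + c *: delta_mx 0 i + c' *: delta_mx 0 j); last first.
  by rewrite E Eg E'.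
rewrite -addrA opprD addNKr normrN (le_trans (ler_normD _ _))// !normrZ.
by rewrite lerD// (le_trans (ler_piMr _ (nd _)))// -(ger0_norm s0).
Qed.

Lemma partialC i j F : Ck 2 F -> partial i (partial j F) = partial j (partial i F).
Proof.
move=> CF; apply/funext => x; apply/eqP; rewrite -subr_eq0 -normr_le0.
apply/ler_addgt0Pr => e e0; rewrite add0r.
have e20 : 0 < e / 2 by rewrite divr_gt0.
have near_ij k l : \forall y \near x,
    `|partial k (partial l F) x - partial k (partial l F) y| < e / 2.
  have ckl : continuous (partial k (partial l F)) := (((CF.2 l).2).2 k).2.
  by have /cvgrPdist_lt := ckl x; exact.
have [d /= d0 dP] := (nbhs_ballP x _).1 (filterI (near_ij i j) (near_ij j i)).
pose s := d / 4; have s0 : 0 < s by rewrite divr_gt0.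
have ssd : s + s < d by rewrite /s; lra.
have [y ys Ey] := partial_partial_MVT i j x CF (ltW s0).
have [z zs Ez] := partial_partial_MVT j i x CF (ltW s0).
have yz : partial j (partial i F) y = partial i (partial j F) z.
  apply: (mulfI (lt0r_neq0 s0)); apply: (mulfI (lt0r_neq0 s0)).
  have swap (a b c a' : R) : a - b - (c - a') = a - c - (b - a') by ring.
  have xE : x + s *: delta_mx 0 j + s *: delta_mx 0 i = x + s *: delta_mx 0 i + s *: delta_mx 0 j.
    exact: addrAC.
  by apply: etrans (esym Ey) (etrans (swap _ _ _ _) _); rewrite -xE.
have near_y w : `|x - w| <= s + s -> ball x d w.
  by move=> xw; rewrite mx_norm_ball /ball_/= (le_lt_trans xw).
have [_ /= Hy] := dP y (near_y _ ys); have [/= Hz _] := dP z (near_y _ zs).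
move: Hy Hz; rewrite yz; set A := partial i _ x; set B := partial j _ x; set D := partial i _ z.
clearbody A B D; move=> Hy Hz; rewrite (_ : A - B = (A - D) - (B - D)); last by ring.
have := ler_normB (A - D) (B - D); clear -Hy Hz; lra.
Qed.

End c1.

(** * Bochner's inequality at a point *)

(** [x] is a point, [p] and [H] are the gradient and the Hessian there of a
    function [f]. *)
Section bochner_algebra.
Context {R : realFieldType} {n : nat}.
Variables (x p : 'I_n -> R) (H : 'I_n -> 'I_n -> R).
Hypothesis Hsym : forall i j, H i j = H j i.

Let r2 := \sum_i x i ^+ 2.
Let s := \sum_i x i * p i.
Let pp := \sum_i p i ^+ 2.
Let y i := \sum_j H i j * x j.
Let q := \sum_i x i * y i.
Let yy := \sum_i y i ^+ 2.
Let py := \sum_i p i * y i.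
Let t := \sum_i H i i.
Let HH i j := \sum_m H i m * H j m.
Let hh := \sum_i HH i i.

Lemma sum_delta (f : 'I_n -> R) k : \sum_m (k == m)%:R * f m = f k.
Proof.
rewrite (bigD1 k)//= eqxx mul1r big1 ?addr0// => m mk.
by rewrite eq_sym (negPf mk) mul0r.
Qed.

Lemma sum2_prod (f g : 'I_n -> R) : \sum_i \sum_j f i * g j = (\sum_i f i) * \sum_j g j.
Proof. by rewrite mulr_suml; apply: eq_bigr => i _; rewrite mulr_sumr. Qed.

Lemma sum2_delta (f : 'I_n -> 'I_n -> R) : \sum_i \sum_j (i == j)%:R * f i j = \sum_i f i i.
Proof. by apply: eq_bigr => i _; rewrite sum_delta. Qed.

Lemma sum2D (F G : 'I_n -> 'I_n -> R) :
  \sum_k \sum_l (F k l + G k l) = \sum_k \sum_l F k l + \sum_k \sum_l G k l.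
Proof. by rewrite -big_split/=; apply: eq_bigr => k _; rewrite -big_split. Qed.

Lemma sum2Ml (F : 'I_n -> 'I_n -> R) c :
  \sum_k \sum_l (c * F k l) = c * \sum_k \sum_l F k l.
Proof. by rewrite mulr_sumr; apply: eq_bigr => k _; rewrite mulr_sumr. Qed.

(** The partial derivative along [m] of the rotation derivative
    [x_k p_l - x_l p_k] of [f]. *)
Let v k l m := (k == m)%:R * p l - (l == m)%:R * p k + x k * H l m - x l * H k m.

Lemma sum_xv k l : \sum_m x m * v k l m = x k * (p l + y l) - x l * (p k + y k).
Proof.
have E m : x m * v k l m = p l * ((k == m)%:R * x m) + - p k * ((l == m)%:R * x m)
    + x k * (H l m * x m) + - x l * (H k m * x m) by rewrite /v; ring.
under eq_bigr do rewrite E.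
rewrite !big_split/= -!mulr_sumr !sum_delta -/(y l) -/(y k); ring.
Qed.

Lemma sum_v2 k l : \sum_m v k l m ^+ 2 =
  p l ^+ 2 + p k ^+ 2 - 2 * ((k == l)%:R * (p l * p k))
  + 2 * (p l * (x k * H l k) - (x l * p l) * H k k - (p k * x k) * H l l + p k * (x l * H k l))
  + (x k ^+ 2 * HH l l + x l ^+ 2 * HH k k - 2 * (x k * x l * HH k l)).
Proof.
have E m : v k l m ^+ 2 = p l ^+ 2 * ((k == m)%:R * 1) + p k ^+ 2 * ((l == m)%:R * 1)
    + (- 2 * p l * p k) * ((k == m)%:R * (l == m)%:R)
    + (2 * p l * x k) * ((k == m)%:R * H l m) + (- 2 * p l * x l) * ((k == m)%:R * H k m)
    + (- 2 * p k * x k) * ((l == m)%:R * H l m) + (2 * p k * x l) * ((l == m)%:R * H k m)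
    + x k ^+ 2 * (H l m * H l m) + x l ^+ 2 * (H k m * H k m) + (- 2 * x k * x l) * (H k m * H l m).
  by rewrite /v; case: eqP => _; case: eqP => _; rewrite ?mulr1n ?mulr0n; ring.
under eq_bigr do rewrite E.
rewrite !big_split/= -!mulr_sumr !sum_delta -/(HH l l) -/(HH k k) -/(HH k l).
rewrite [l == k]eq_sym; ring.
Qed.

Lemma y_sum k : y k = \sum_j x j * H j k.
Proof. by apply: eq_bigr => j _; rewrite Hsym mulrC. Qed.

Lemma sum_xHp : \sum_k \sum_l p l * (x k * H l k) = py.
Proof.
rewrite exchange_big/=; apply: eq_bigr => l _; rewrite -mulr_sumr; congr (_ * _).
by apply: eq_bigr => k _; rewrite mulrC.
Qed.

Lemma sum_xxHH : \sum_k \sum_l x k * x l * HH k l = yy.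
Proof.
transitivity (\sum_m \sum_k \sum_l (x k * H k m) * (x l * H l m)).
  rewrite [RHS]exchange_big/=; apply: eq_bigr => k _.
  rewrite [RHS]exchange_big/=; apply: eq_bigr => l _.
  by rewrite mulr_sumr; apply: eq_bigr => m _; ring.
by apply: eq_bigr => m _; rewrite sum2_prod -!y_sum expr2.
Qed.

(** By Lagrange's identity the summand on the left is half the sum over [i] and
    [j] of [(x_i v_j - x_j v_i) ^ 2], so the left side is half the sum of the
    squares of all second-order rotation derivatives of [f]. *)
Lemma bochner_identity :
  \sum_k \sum_l (r2 * (\sum_m v k l m ^+ 2) - (\sum_m x m * v k l m) ^+ 2) =
  2 * ((r2 ^+ 2 * hh - 2 * r2 * yy + q ^+ 2) - 2 * s * (r2 * t - q) + s ^+ 2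
       + (n%:R - 2) * (r2 * pp)).
Proof.
have E k l : r2 * (\sum_m v k l m ^+ 2) - (\sum_m x m * v k l m) ^+ 2 =
   r2 * (1 * p l ^+ 2) + r2 * (p k ^+ 2 * 1) + (- 2 * r2) * ((k == l)%:R * (p l * p k))
   + (2 * r2) * (p l * (x k * H l k)) + (- 2 * r2) * (H k k * (x l * p l))
   + (- 2 * r2) * ((x k * p k) * H l l) + (2 * r2) * (p k * (x l * H k l))
   + r2 * (x k ^+ 2 * HH l l) + r2 * (HH k k * x l ^+ 2) + (- 2 * r2) * (x k * x l * HH k l)
   + - 1 * (x k ^+ 2 * (p l + y l) ^+ 2) + - 1 * ((p k + y k) ^+ 2 * x l ^+ 2)
   + 2 * ((x k * (p k + y k)) * (x l * (p l + y l))).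
  by rewrite sum_xv sum_v2; ring.
under eq_bigr => k _ do under eq_bigr do rewrite E.
rewrite !sum2D !sum2Ml !sum2_prod sum2_delta sum_xHp sum_xxHH -/t -/s -/r2 -/pp -/hh.
have -> : \sum_k \sum_l p k * (x l * H k l) = py.
  by rewrite exchange_big/= -sum_xHp.
have -> : \sum_(k < n) pp = n%:R * pp by rewrite sumr_const card_ord mulr_natl.
have -> : \sum_(i < n) (1 : R) = n%:R by rewrite sumr_const card_ord.
have -> : \sum_j (p j + y j) ^+ 2 = pp + 2 * py + yy.
  rewrite mulr_sumr -!big_split/=; apply: eq_bigr => i _; ring.
have -> : \sum_j x j * (p j + y j) = s + q.
  rewrite -!big_split/=; apply: eq_bigr => i _; ring.
ring.
Qed.

(** Cauchy-Schwarz for the trace of the tangential part of the Hessian, which is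
    a symmetric matrix of size [n - 1]. *)
Lemma hess_trace_free : (1 < n)%N -> 0 < r2 -> (r2 * t - q) ^+ 2 <=
  (n%:R - 1) * (r2 ^+ 2 * hh - 2 * r2 * yy + q ^+ 2).
Proof.
move=> n1 r20; set m := n%:R - 1; set tau := r2 * t - q.
have m0 : 0 < m by rewrite subr_gt0 ltr1n.
(* With [P = r2 I - x x^T], this is the matrix [m P H P - tau P]; the trace of
   [P H P] is [r2 tau] and that of [P] is [r2 m], hence [Z] is trace-free. *)
pose Z i j := m * (r2 ^+ 2 * H i j - r2 * (x i * y j + y i * x j) + q * (x i * x j))
  - tau * (r2 * (i == j)%:R - x i * x j).
have Z0 : 0 <= \sum_i \sum_j Z i j ^+ 2.
  by apply: sumr_ge0 => i _; apply: sumr_ge0 => j _; exact: sqr_ge0.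
pose a := m * r2 ^+ 2; pose b := - m * r2; pose c := m * q + tau; pose d := - tau * r2.
have E i j : Z i j ^+ 2 = a ^+ 2 * (H i j * H i j) + b ^+ 2 * (x i ^+ 2 * y j ^+ 2)
   + b ^+ 2 * (y i ^+ 2 * x j ^+ 2) + c ^+ 2 * (x i ^+ 2 * x j ^+ 2) + d ^+ 2 * ((i == j)%:R * 1)
   + (2 * a * b) * (y j * (x i * H j i)) + (2 * a * b) * (y i * (H i j * x j))
   + (2 * a * c) * (x i * (H i j * x j)) + (2 * a * d) * ((i == j)%:R * H i j)
   + (2 * b ^+ 2) * ((x i * y i) * (x j * y j)) + (2 * b * c) * (x i ^+ 2 * (x j * y j))
   + (2 * b * c) * ((x i * y i) * x j ^+ 2) + (4 * b * d) * ((i == j)%:R * (x i * y j))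
   + (2 * c * d) * ((i == j)%:R * (x i * x j)).
  rewrite /Z (Hsym j i) /a /b /c /d; case: eqP => [->|_]; rewrite ?mulr1n ?mulr0n; ring.
move: Z0; under eq_bigr => i _ do under eq_bigr do rewrite E.
rewrite !sum2D !sum2Ml !sum2_prod !sum2_delta -/r2 -/t -/q -/yy.
have -> : \sum_i \sum_j H i j * H i j = hh by [].
have -> : \sum_i \sum_j y j * (x i * H j i) = yy.
  rewrite exchange_big/=; apply: eq_bigr => i _; rewrite -mulr_sumr expr2; congr (_ * _).
  by apply: eq_bigr => j _; rewrite mulrC.
have -> : \sum_i \sum_j y i * (H i j * x j) = yy.
  by apply: eq_bigr => i _; rewrite -mulr_sumr expr2.
have -> : \sum_i \sum_j x i * (H i j * x j) = q.
  by apply: eq_bigr => i _; rewrite -mulr_sumr.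
have -> : \sum_(i < n) (1 : R) = n%:R by rewrite sumr_const card_ord.
have -> : n%:R = m + 1 by rewrite subrK.
move=> Z0.
have {Z0} : 0 <= (m * r2 ^+ 2) * (m * (r2 ^+ 2 * hh - 2 * r2 * yy + q ^+ 2) - tau ^+ 2).
  move: Z0; congr (_ <= _); rewrite /a /b /c /d /tau; ring.
by rewrite pmulr_rge0 ?subr_ge0// mulr_gt0// exprn_gt0.
Qed.

(** Bochner's inequality on spheres: the trace-free part of the spherical Hessian
    is dropped, and the factor [n - 2] is the Ricci curvature. *)
Lemma bochner_pointwise : (1 < n)%N -> 0 < r2 ->
  (r2 * t - q - (n%:R - 1) * s) ^+ 2 + (n%:R - 1) * (n%:R - 2) * (r2 * pp - s ^+ 2) <=
  (n%:R - 1) * (2^-1 * \sum_k \sum_l (r2 * (\sum_m v k l m ^+ 2) - (\sum_m x m * v k l m) ^+ 2)).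
Proof.
move=> n1 r20; rewrite bochner_identity mulKf ?pnatr_eq0//.
have := hess_trace_free n1 r20; set A := _ - _ + _ => A0.
rewrite -subr_ge0; move: A0; rewrite -subr_ge0; congr (_ <= _); ring.
Qed.

End bochner_algebra.

(** * Rotations, the Euler field and the Laplacian of spheres *)

(** Sealed, so that iterated partial derivatives are never compared as limits. *)
HB.lock Definition pd {R : realType} {n : nat} (i : 'I_n) (f : 'rV[R]_n -> R) :
  'rV[R]_n -> R := partial i f.

Section rotations.
Context {R : realType} {n : nat}.
Implicit Types (f g : 'rV[R]_n -> R) (x : 'rV[R]_n) (i j k l : 'I_n).

Lemma smooth_Ck m f : smooth f -> Ck m f.
Proof. by move=> /smoothP; exact. Qed.

Lemma smooth_cst (c : R) : smooth (fun _ : 'rV[R]_n => c).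
Proof. by apply/smoothP => m; exact: Ck_cst. Qed.

Lemma smooth_coord i : smooth (fun x => x 0 i).
Proof. by apply/smoothP => m; exact: Ck_coord. Qed.

Lemma smoothD f g : smooth f -> smooth g -> smooth (fun x => f x + g x).
Proof. by move=> /smoothP sf /smoothP sg; apply/smoothP => m; exact: CkD. Qed.

Lemma smoothM f g : smooth f -> smooth g -> smooth (fun x => f x * g x).
Proof. by move=> /smoothP sf /smoothP sg; apply/smoothP => m; exact: CkM. Qed.

Lemma smoothB f g : smooth f -> smooth g -> smooth (fun x => f x - g x).
Proof.
move=> sf sg; have := smoothD sf (smoothM (smooth_cst (-1)) sg).
by under eq_fun do rewrite mulN1r.
Qed.

Lemma smooth_sum I (r : seq I) (P : pred I) (F : I -> 'rV[R]_n -> R) :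
  (forall a, smooth (F a)) -> smooth (fun x => \sum_(a <- r | P a) F a x).
Proof. by move=> sF; apply/smoothP => m; apply: Ck_sum => a; exact: smooth_Ck. Qed.

Lemma smooth_partial i f : smooth f -> smooth (partial i f).
Proof. by move=> /smoothP sf; apply/smoothP => m; exact: ((sf m.+1).2 i).2. Qed.

Lemma pdE i f : pd i f = partial i f.
Proof. by rewrite unlock. Qed.

Lemma smooth_pd i f : smooth f -> smooth (pd i f).
Proof. by rewrite pdE; exact: smooth_partial. Qed.

Lemma is_derive_pd i f x : Ck 1 f -> is_derive x (delta_mx 0 i) f (pd i f x).
Proof. by rewrite pdE => -[_ df]; apply: derivableP; exact: (df i).1. Qed.

Lemma is_derive_pdE i f g : (forall x, is_derive x (delta_mx 0 i) f (g x)) -> pd i f = g.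
Proof. by move=> dfg; rewrite pdE; apply/funext => x; exact: is_derive_val. Qed.

Lemma pd_coord i j : pd i (fun x => x 0 j) = (fun _ => (j == i)%:R).
Proof. by rewrite pdE partial_coord. Qed.

Lemma pd_cst i (c : R) : pd i (fun _ => c) = (fun _ => 0).
Proof. by rewrite pdE partial_cst. Qed.

Lemma pdD i f g : Ck 1 f -> Ck 1 g ->
  pd i (fun x => f x + g x) = (fun x => pd i f x + pd i g x).
Proof. by move=> Cf Cg; rewrite !pdE partialD. Qed.

Lemma pdM i f g : Ck 1 f -> Ck 1 g ->
  pd i (fun x => f x * g x) = (fun x => f x * pd i g x + g x * pd i f x).
Proof. by move=> Cf Cg; rewrite !pdE partialM. Qed.

Lemma pdZ i (c : R) f : Ck 1 f -> pd i (fun x => c * f x) = (fun x => c * pd i f x).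
Proof.
move=> Cf; rewrite pdM//; last exact: Ck_cst.
by apply/funext => x; rewrite pd_cst mulr0 addr0.
Qed.

Lemma pdB i f g : Ck 1 f -> Ck 1 g ->
  pd i (fun x => f x - g x) = (fun x => pd i f x - pd i g x).
Proof.
move=> Cf Cg; under eq_fun do rewrite -mulN1r.
rewrite pdD//; last by apply: CkM => //; exact: Ck_cst.
by rewrite pdZ//; apply/funext => x; rewrite mulN1r.
Qed.

Lemma pd_sum i I (r : seq I) (P : pred I) (F : I -> 'rV[R]_n -> R) :
  (forall a, Ck 1 (F a)) -> pd i (fun x => \sum_(a <- r | P a) F a x) =
  (fun x => \sum_(a <- r | P a) pd i (F a) x).
Proof.
move=> CF; rewrite pdE partial_sum//; apply/funext => x.
by apply: eq_bigr => a _; rewrite pdE.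
Qed.

Lemma pdC i j f : smooth f -> pd i (pd j f) = pd j (pd i f).
Proof. by move=> sf; rewrite !pdE; apply: partialC; exact: smooth_Ck. Qed.

Lemma laplacianE f : laplacian f = (fun x => \sum_i pd i (pd i f) x).
Proof. by apply/funext => x; apply: eq_bigr => i _; rewrite !pdE. Qed.

Lemma gradE f x i : grad f x 0 i = pd i f x.
Proof. by rewrite mxE pdE. Qed.

(** The fields that generate the rotations: they are tangent to spheres and
    commute with all rotation-invariant operators. *)
Definition rot i j f x := x 0 i * pd j f x - x 0 j * pd i f x.
Definition euler f x := \sum_k x 0 k * pd k f x.
Definition sqnorm x := \sum_i x 0 i ^+ 2.

(** [r ^ 2] times the angular part of the Laplacian, which is the Laplacian of
    the unit sphere; this form is free of divisions. *)
Definition sph f x :=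
  sqnorm x * laplacian f x - euler (euler f) x - (n%:R - 2) * euler f x.

Lemma smooth_rot i j f : smooth f -> smooth (rot i j f).
Proof.
move=> sf; apply: smoothB; apply: smoothM; do ?exact: smooth_coord;
  exact: smooth_pd.
Qed.

Lemma smooth_euler f : smooth f -> smooth (euler f).
Proof.
move=> sf; apply: smooth_sum => k; apply: smoothM; first exact: smooth_coord.
exact: smooth_pd.
Qed.

Lemma smooth_sqnorm : smooth sqnorm.
Proof.
apply: smooth_sum => k; under eq_fun do rewrite expr2.
by apply: smoothM; exact: smooth_coord.
Qed.

Lemma smooth_laplacian f : smooth f -> smooth (laplacian f).
Proof. by rewrite laplacianE => sf; apply: smooth_sum => k; do 2 apply: smooth_pd. Qed.

Lemma smooth_sph f : smooth f -> smooth (sph f).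
Proof.
move=> sf; apply: smoothB; first apply: smoothB.
- by apply: smoothM; [exact: smooth_sqnorm|exact: smooth_laplacian].
- by do 2 apply: smooth_euler.
- by apply: smoothM; [exact: smooth_cst|exact: smooth_euler].
Qed.

Local Ltac smt := repeat first
  [ match goal with
    | H : smooth ?f |- smooth ?f => exact: H
    | |- forall _, _ => intro
    | |- Ck _ _ => apply: smooth_Ck
    | |- smooth (pd _ _) => apply: smooth_pd
    | |- smooth (fun x => pd _ _ x) => apply: smooth_pd
    | |- smooth (fun x => rot _ _ _ x) => apply: smooth_rot
    | |- smooth (fun x => euler _ x) => apply: smooth_euler
    | |- smooth (fun x => laplacian _ x) => apply: smooth_laplacian
    | |- smooth (fun x => sph _ x) => apply: smooth_sph
    | |- smooth (fun x => sqnorm x) => apply: smooth_sqnorm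
    | |- smooth (rot _ _ _) => apply: smooth_rot
    | |- smooth (euler _) => apply: smooth_euler
    | |- smooth (laplacian _) => apply: smooth_laplacian
    | |- smooth (sph _) => apply: smooth_sph
    | |- smooth sqnorm => exact: smooth_sqnorm
    | |- smooth (fun _ => ?c) => exact: (smooth_cst c)
    | |- smooth (fun x => fun_of_matrix x _ _) => exact: smooth_coord
    | |- smooth (fun x => _ - _) => apply: smoothB
    | |- smooth (fun x => _ + _) => apply: smoothD
    | |- smooth (fun x => _ * _) => apply: smoothM
    end ].


Lemma pd_rot k i j f : smooth f -> pd k (rot i j f) =
  (fun x => rot i j (pd k f) x + ((i == k)%:R * pd j f x - (j == k)%:R * pd i f x)).
Proof.
move=> sf; rewrite /rot pdB; [|by smt|by smt].
rewrite !pdM; do ?by smt.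
rewrite !pd_coord.
rewrite (pdC k j sf) (pdC k i sf).
apply/funext => x; ring.
Qed.

Lemma pd_euler k f : smooth f ->
  pd k (euler f) = (fun x => pd k f x + euler (pd k f) x).
Proof.
move=> sf; rewrite /euler pd_sum; last by smt.
apply/funext => x; rewrite -[X in X + _](sum_delta (fun m => pd m f x)) -big_split/=.
apply: eq_bigr => m _; rewrite pdM; [|by smt|by smt].
by rewrite pd_coord (pdC k m sf) eq_sym; ring.
Qed.

Lemma rot_euler i j f : smooth f -> rot i j (euler f) = euler (rot i j f).
Proof.
move=> sf; apply/funext => x; rewrite /rot !pd_euler// /euler.
have E k : x 0 k * pd k (rot i j f) x = x 0 i * (x 0 k * pd k (pd j f) x)
   + - x 0 j * (x 0 k * pd k (pd i f) x)
   + ((i == k)%:R * (x 0 k * pd j f x) + (j == k)%:R * (- x 0 k * pd i f x)).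
  rewrite pd_rot// /rot (pdC k j sf) (pdC k i sf); ring.
rewrite -/(rot i j f); under [RHS]eq_bigr do rewrite E.
rewrite !big_split/= -!mulr_sumr !sum_delta; ring.
Qed.


Lemma rot_laplacian i j f : smooth f -> rot i j (laplacian f) = laplacian (rot i j f).
Proof.
move=> sf; apply/funext => x.
have E k : pd k (pd k (rot i j f)) x = rot i j (pd k (pd k f)) x
    + (i == k)%:R * (2 * pd j (pd k f) x) + (j == k)%:R * (- 2 * pd i (pd k f) x).
  rewrite pd_rot// pdD; do ?by smt.
  rewrite pd_rot; last by smt.
  rewrite pdB; do ?by smt.
  rewrite !pdZ; do ?by smt.
  rewrite (pdC k j sf) (pdC k i sf); ring.
rewrite !laplacianE {1}/rot !pd_sum; do ?by smt.
rewrite [RHS](eq_bigr _ (fun k _ => E k)) !big_split/= !sum_delta.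
rewrite (pdC i j sf) sumrN -!mulr_sumr; ring.
Qed.

Lemma pd_sqnorm k : pd k sqnorm = (fun x => 2 * x 0 k).
Proof.
rewrite /sqnorm pd_sum; last by move=> a; under eq_fun do rewrite expr2; smt.
apply/funext => x; rewrite -[RHS](sum_delta (fun m => 2 * x 0 m)).
apply: eq_bigr => m _; under eq_fun do rewrite expr2.
rewrite pdM; do ?by smt.
rewrite pd_coord eq_sym; ring.
Qed.

Lemma rot_sqnormM i j f : smooth f ->
  rot i j (fun x => sqnorm x * f x) = (fun x => sqnorm x * rot i j f x).
Proof.
move=> sf; apply/funext => x; rewrite /rot !pdM; do ?by smt.
rewrite !pd_sqnorm; ring.
Qed.

Lemma rotB i j f g : smooth f -> smooth g ->
  rot i j (fun x => f x - g x) = (fun x => rot i j f x - rot i j g x).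
Proof. by move=> sf sg; apply/funext => x; rewrite /rot !pdB; do ?(by smt); ring. Qed.

Lemma rotZ i j (c : R) f : smooth f ->
  rot i j (fun x => c * f x) = (fun x => c * rot i j f x).
Proof. by move=> sf; apply/funext => x; rewrite /rot !pdZ; do ?(by smt); ring. Qed.

Lemma rotM i j f g : smooth f -> smooth g ->
  rot i j (fun x => f x * g x) = (fun x => f x * rot i j g x + g x * rot i j f x).
Proof. by move=> sf sg; apply/funext => x; rewrite /rot !pdM; do ?(by smt); ring. Qed.

Lemma rot_sph i j f : smooth f -> rot i j (sph f) = sph (rot i j f).
Proof.
move=> sf; rewrite /sph rotB; do ?by smt.
rewrite rotB; do ?by smt.
rewrite rot_sqnormM; do ?by smt.
rewrite rotZ; do ?by smt.
by rewrite rot_laplacian// !rot_euler; do ?by smt.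
Qed.

Lemma euler2E f x : smooth f -> euler (euler f) x =
  euler f x + \sum_k x 0 k * \sum_l pd k (pd l f) x * x 0 l.
Proof.
move=> sf; rewrite {1}/euler; under eq_bigr do rewrite pd_euler// mulrDr.
rewrite big_split/=; congr (_ + _); apply: eq_bigr => k _; congr (_ * _).
by apply: eq_bigr => l _; rewrite (pdC l k sf) mulrC.
Qed.

Lemma sphE f x : smooth f -> sph f x =
  sqnorm x * (\sum_k pd k (pd k f) x)
  - (\sum_k x 0 k * \sum_l pd k (pd l f) x * x 0 l) - (n%:R - 1) * euler f x.
Proof. by move=> sf; rewrite /sph euler2E// laplacianE; ring. Qed.

(** The Laplacian of spheres is the Casimir operator of the rotations; every pair
    [i != j] is counted twice. *)
Lemma sum_rot2 f x : smooth f ->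
  \sum_i \sum_j rot i j (rot i j f) x = 2 * sph f x.
Proof.
move=> sf; rewrite sphE//.
have E i j : rot i j (rot i j f) x = (x 0 i ^+ 2) * pd j (pd j f) x
   + - 2 * (x 0 i * (pd i (pd j f) x * x 0 j)) + pd i (pd i f) x * (x 0 j ^+ 2)
   + 2 * ((i == j)%:R * (x 0 i * pd j f x)) + - 1 * ((x 0 i * pd i f x) * 1)
   + - 1 * (1 * (x 0 j * pd j f x)).
  rewrite {1}/rot !pd_rot// /rot !eqxx (pdC j i sf).
  by rewrite [j == i]eq_sym; case: eqP => [->|_]; rewrite ?mulr1n ?mulr0n; ring.
under eq_bigr => i _ do under eq_bigr do rewrite E.
rewrite !sum2D !sum2Ml !sum2_prod sum2_delta -/(sqnorm x) -/(euler f x).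
have -> : \sum_i \sum_j x 0 i * (pd i (pd j f) x * x 0 j) =
    \sum_k x 0 k * \sum_l pd k (pd l f) x * x 0 l.
  by apply: eq_bigr => i _; rewrite mulr_sumr.
have -> : \sum_(i < n) (1 : R) = n%:R by rewrite sumr_const card_ord.
rewrite sumr_const card_ord -[euler f x *+ n]mulr_natl; ring.
Qed.

Lemma sum_rot_sqr f x : \sum_i \sum_j rot i j f x ^+ 2 =
  2 * (sqnorm x * (\sum_k pd k f x ^+ 2) - euler f x ^+ 2).
Proof.
have E i j : rot i j f x ^+ 2 = x 0 i ^+ 2 * pd j f x ^+ 2 + pd i f x ^+ 2 * x 0 j ^+ 2
   + - 2 * ((x 0 i * pd i f x) * (x 0 j * pd j f x)).
  by rewrite /rot; ring.
under eq_bigr => i _ do under eq_bigr do rewrite E.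
rewrite !sum2D !sum2Ml !sum2_prod -/(sqnorm x) -/(euler f x); ring.
Qed.

(** Bochner's inequality without derivatives of the metric: all its terms are
    rotation derivatives, which [Iint_rot_parts] can integrate by parts. *)
Lemma bochner_rot f x : smooth f -> (1 < n)%N -> 0 < sqnorm x ->
  (sph f x) ^+ 2 + (n%:R - 1) * (n%:R - 2) * (2^-1 * \sum_i \sum_j rot i j f x ^+ 2) <=
  (n%:R - 1) * (4^-1 * \sum_k \sum_l \sum_i \sum_j rot i j (rot k l f) x ^+ 2).
Proof.
move=> sf n1 x0; rewrite sum_rot_sqr mulKf ?pnatr_eq0//.
have Hsym i j : pd i (pd j f) x = pd j (pd i f) x by rewrite pdC.
have := @bochner_pointwise R n (fun i => x 0 i) (fun i => pd i f x)
  (fun i j => pd i (pd j f) x) Hsym n1 x0.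
rewrite -/(sqnorm x) -/(euler f x) => H.
rewrite sphE//; apply: (le_trans H); rewrite le_eqVlt; apply/orP; left; apply/eqP.
congr (_ * _); rewrite [RHS](_ : _ = 2^-1 * (2^-1 * \sum_k \sum_l \sum_i \sum_j rot i j (rot k l f) x ^+ 2)).
  congr (_ * _); rewrite mulr_sumr; apply: eq_bigr => k _; rewrite mulr_sumr; apply: eq_bigr => l _.
  have v m : (k == m)%:R * pd l f x - (l == m)%:R * pd k f x + x 0 k * pd l (pd m f) x
      - x 0 l * pd k (pd m f) x = pd m (rot k l f) x.
    by rewrite pd_rot// /rot; ring.
  rewrite sum_rot_sqr mulKf ?pnatr_eq0// /euler.
  by under eq_bigr do rewrite v; under [X in _ - X ^+ 2]eq_bigr do rewrite v.
by rewrite mulrA; congr (_ * _); rewrite -invfM -natrM.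
Qed.

End rotations.

(** * Radial weights *)

Section derive_rules.
Context {R : realType} {V : normedModType R}.
Implicit Types (f g : V -> R) (x v : V) (d e : R).

Lemma is_derive_ext f x v d e : is_derive x v f d -> d = e -> is_derive x v f e.
Proof. by move=> ? <-. Qed.

Lemma is_derive_add f g x v d e : is_derive x v f d -> is_derive x v g e ->
  is_derive x v (fun y => f y + g y) (d + e).
Proof. by move=> df dg; exact: is_deriveD. Qed.

Lemma is_derive_sub f g x v d e : is_derive x v f d -> is_derive x v g e ->
  is_derive x v (fun y => f y - g y) (d - e).
Proof. by move=> df dg; exact: is_deriveB. Qed.

Lemma is_derive_mul f g x v d e : is_derive x v f d -> is_derive x v g e ->
  is_derive x v (fun y => f y * g y) (d * g x + f x * e).
Proof.
move=> df dg; apply: is_derive_ext (is_deriveM df dg) _.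
by rewrite addrC [d * _]mulrC.
Qed.

Lemma is_derive_const (c : R) x v : is_derive x v (fun _ => c) 0.
Proof. exact: is_derive_cst. Qed.

End derive_rules.

Section weights.
Context {R : realType} {n : nat}.
Implicit Types (f g F : 'rV[R]_n -> R) (x : 'rV[R]_n) (i j k : 'I_n).

Lemma enorm_ge0 x : 0 <= enorm x. Proof. exact: sqrtr_ge0. Qed.

Lemma sqnorm_ge0 x : 0 <= sqnorm x.
Proof. by apply: sumr_ge0 => i _; exact: sqr_ge0. Qed.

Lemma enorm_sqr x : enorm x ^+ 2 = sqnorm x.
Proof. by rewrite sqr_sqrtr// sqnorm_ge0. Qed.

Lemma coord_le_enorm x i : `|x 0 i| <= enorm x.
Proof.
rewrite -sqrtr_sqr ler_sqrt ?sqnorm_ge0// (bigD1 i)//= lerDl.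
by apply: sumr_ge0 => k _; exact: sqr_ge0.
Qed.

Lemma sqnormZ c x : sqnorm (c *: x) = c ^+ 2 * sqnorm x.
Proof. by rewrite /sqnorm mulr_sumr; apply: eq_bigr => i _; rewrite mxE exprMn. Qed.

Lemma enormZ c x : enorm (c *: x) = `|c| * enorm x.
Proof. by rewrite /enorm -/(sqnorm _) sqnormZ sqrtrM ?sqr_ge0// sqrtr_sqr. Qed.

Lemma enorm_continuous : continuous (@enorm R n).
Proof.
move=> x; apply: (@continuous_comp _ _ _ sqnorm Num.sqrt); last exact: sqrt_continuous.
exact: (Ck_continuous (smooth_Ck 0 smooth_sqnorm)).
Qed.

(** Radii in place of a support: all operations below preserve them, so that no
    closure or compactness argument is ever repeated. *)
Definition annular (a b : R) f := forall x, f x != 0 -> a <= enorm x <= b.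

Lemma annular_eq0 a b f x : annular a b f -> ~~ (a <= enorm x <= b) -> f x = 0.
Proof. by move=> af; apply: contraNeq => /af. Qed.

Lemma annular_near a b f x : annular a b f -> ~~ (a <= enorm x <= b) ->
  \forall y \near x, f y = 0.
Proof.
move=> af xab; have ax := @enorm_continuous x.
suff H : \forall y \near nbhs x, ~~ (a <= enorm y <= b).
  by apply: (filterS _ H) => y; exact: annular_eq0.
move: xab; rewrite negb_and -!ltNge => /orP[xa|xb].
  apply: (filterS _ (cvgr_lt _ ax _ xa)) => y ya.
  by rewrite negb_and -!ltNge ya.
apply: (filterS _ (cvgr_gt _ ax _ xb)) => y yb.
by rewrite negb_and -!ltNge yb orbT.
Qed.

Lemma annular_pd a b f i : Ck 1 f -> annular a b f -> annular a b (pd i f).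
Proof.
move=> Cf af x; apply: contraR => xab; apply/eqP; rewrite pdE /partial.
have fx := annular_near af xab.
rewrite (near_eq_derive _ (g := cst 0)); last exact: fx.
exact: derive_cst.
Qed.

Lemma annularMl a b f g : annular a b g -> annular a b (fun x => f x * g x).
Proof. by move=> ag x fg; apply: ag; apply: contraNneq fg => ->; rewrite mulr0. Qed.

Lemma annularMr a b f g : annular a b f -> annular a b (fun x => f x * g x).
Proof. by move=> ag x fg; apply: ag; apply: contraNneq fg => ->; rewrite mul0r. Qed.

Lemma annularD a b f g : annular a b f -> annular a b g -> annular a b (fun x => f x + g x).
Proof.
move=> af ag x fg; apply: contraNT fg => xab.
by rewrite (annular_eq0 af xab) (annular_eq0 ag xab) addr0.
Qed.

Lemma annularB a b f g : annular a b f -> annular a b g -> annular a b (fun x => f x - g x).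
Proof.
move=> af ag x fg; apply: contraNT fg => xab.
by rewrite (annular_eq0 af xab) (annular_eq0 ag xab) subr0.
Qed.

Lemma annular_sum a b I (r : seq I) (P : pred I) (F : I -> 'rV[R]_n -> R) :
  (forall c, annular a b (F c)) -> annular a b (fun x => \sum_(c <- r | P c) F c x).
Proof.
move=> aF x Fx; apply: contraNT Fx => xab; rewrite big1// => i _.
exact: annular_eq0 xab.
Qed.

Lemma annular_test a b f : continuous f -> annular a b f -> test_fun f.
Proof.
move=> cf af; split=> //; exists b => x /af /andP[_ xb] i.
exact: le_trans (coord_le_enorm _ _) xb.
Qed.

Lemma annular_rot a b f i j : smooth f -> annular a b f -> annular a b (rot i j f).
Proof.
by move=> sf af; apply: annularB; apply: annularMl; apply: annular_pd => //; exact: smooth_Ck.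
Qed.

Lemma annular_euler a b f : smooth f -> annular a b f -> annular a b (euler f).
Proof.
by move=> sf af; apply: annular_sum => k; apply: annularMl; apply: annular_pd => //; exact: smooth_Ck.
Qed.

Lemma annular_laplacian a b f : smooth f -> annular a b f -> annular a b (laplacian f).
Proof.
move=> sf af; rewrite laplacianE; apply: annular_sum => k.
apply: (@annular_pd a b (pd k f)); first by apply: smooth_Ck; exact: smooth_pd.
by apply: annular_pd => //; exact: smooth_Ck.
Qed.

Lemma annular_sph a b f : smooth f -> annular a b f -> annular a b (sph f).
Proof.
move=> sf af; apply: annularB; first apply: annularB.
- by apply: annularMl; exact: annular_laplacian.
- by apply: annular_euler; [exact: smooth_euler|exact: annular_euler].
- by apply: annularMl; exact: annular_euler.
Qed.

Lemma Iint_pd a b F i : Ck 1 F -> annular a b F -> Iint (pd i F) = 0.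
Proof.
move=> CF aF; apply: (@Iint_partial R n i F) => [||x].
- by apply: annular_test aF; exact: Ck_continuous CF.
- apply: (@annular_test a b); last exact: annular_pd.
  by rewrite pdE; exact: (CF.2 i).2.
- exact: is_derive_pd.
Qed.

Lemma is_derive_along (V : normedModType R) (F : V -> R) (x v : V) (d : R) :
  is_derive x v F d <-> is_derive (0 : R) 1 (fun t : R => F (x + t *: v)) d.
Proof.
have E : (fun h : R => h^-1 *: (((fun t : R => F (x + t *: v)) \o shift 0) (h *: (1 : R)) - F (x + 0 *: v))) =
         (fun h : R => h^-1 *: ((F \o shift x) (h *: v) - F x)).
  apply/funext => h /=; rewrite scale0r addr0 addr0; congr (_ *: (F _ - _)).
  by rewrite addrC /GRing.scale/= mulr1.
by split => -[dF1 dF2]; apply: DeriveDef; move: dF1 dF2; rewrite /derivable /derive E.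
Qed.

Lemma is_derive_comp1 (V : normedModType R) (h : R -> R) (G : V -> R) (x v : V) (dh dG : R) :
  is_derive (G x) 1 h dh -> is_derive x v G dG -> is_derive x v (fun y => h (G y)) (dh * dG).
Proof.
move=> hd /is_derive_along Gd; apply/is_derive_along.
have hd' : is_derive (G (x + 0 *: v)) 1 h dh by rewrite scale0r addr0.
exact: (@is_derive1_comp _ h (fun t => G (x + t *: v))).
Qed.

Lemma is_derive_sqnorm x i : is_derive x (delta_mx 0 i) sqnorm (2 * x 0 i).
Proof.
have := is_derive_pd i x (smooth_Ck 1 smooth_sqnorm).
by rewrite pd_sqnorm.
Qed.

Lemma is_derive_enorm x i : 0 < enorm x ->
  is_derive x (delta_mx 0 i) (@enorm R n) (x 0 i / enorm x).
Proof.
move=> x0; have s0 : 0 < sqnorm x by rewrite -enorm_sqr exprn_gt0.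
have d1 : is_derive (sqnorm x) 1 (@Num.sqrt R) (2 * Num.sqrt (sqnorm x))^-1.
  exact: is_derive1_sqrt.
have := is_derive_comp1 d1 (is_derive_sqnorm x i).
by congr (is_derive _ _ _ _); rewrite -/(enorm x) invfM; field; rewrite gt_eqF.
Qed.


Variable rho : \bar R.

Definition continuous_on (h : R -> R) := forall r, itv0 rho r -> {for r, continuous h}.

(** Regularity on the open interval only: a weight may blow up at its ends. *)
Definition C1_on (h : R -> R) :=
  (forall r, itv0 rho r -> derivable h r 1) /\ continuous_on (derive1 h).

Definition wt (h : R -> R) f x := h (enorm x) * f x.

Lemma C1_on_continuous h : C1_on h -> continuous_on h.
Proof.
move=> [dh _] r /dh dhr; apply: differentiable_continuous.
exact/derivable1_diffP.
Qed.

Variables (a b : R).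
Hypotheses (a0 : 0 < a) (b_rho : (b%:E < rho)%E).

Lemma annulus_itv0 x : a <= enorm x <= b -> itv0 rho (enorm x).
Proof.
move=> /andP[ax xb]; split; first exact: lt_le_trans ax.
by apply: le_lt_trans b_rho; rewrite lee_fin.
Qed.

Lemma wt_annular h f : annular a b f -> annular a b (wt h f).
Proof. exact: annularMl. Qed.

Lemma wt_continuous h f : continuous_on h -> continuous f -> annular a b f ->
  continuous (wt h f).
Proof.
move=> ch cf af x; have [xab|xab] := boolP (a <= enorm x <= b).
  have hc : {for x, continuous (h \o @enorm R n)}.
    by apply: continuous_comp; [exact: enorm_continuous|exact/ch/annulus_itv0].
  exact: (cvgM hc (cf x)).
have wx : wt h f x = 0 by rewrite /wt (annular_eq0 af xab) mulr0.
have w0 : \forall y \near x, 0 = wt h f y.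
  by apply: (filterS _ (annular_near af xab)) => y fy; rewrite /wt fy mulr0.
rewrite /continuous_at wx; apply: (cvg_trans (near_eq_cvg w0)).
exact: cvg_cst.
Qed.

Lemma wt_test h f : continuous_on h -> continuous f -> annular a b f -> test_fun (wt h f).
Proof.
move=> ch cf af; apply: (@annular_test a b); first exact: wt_continuous.
exact: wt_annular.
Qed.

Lemma is_derive_wt h f x i : C1_on h -> Ck 1 f -> annular a b f ->
  is_derive x (delta_mx 0 i) (wt h f)
    (wt h (pd i f) x + wt (fun r => derive1 h r / r) (fun x => x 0 i * f x) x).
Proof.
move=> [dh ch] Cf af; have [xab|xab] := boolP (a <= enorm x <= b).
  have xr := annulus_itv0 xab; have [x0 _] := xr.
  have d1 : is_derive (enorm x) 1 h (derive1 h (enorm x)).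
    by rewrite derive1E; apply: derivableP; exact: dh.
  have d2 := is_derive_comp1 d1 (is_derive_enorm i x0).
  apply: is_derive_ext (is_derive_mul d2 (is_derive_pd i x Cf)) _.
  by rewrite /wt; ring.
have w0 : \forall y \near x, cst 0 y = wt h f y.
  by apply: (filterS _ (annular_near af xab)) => y fy; rewrite /wt fy mulr0.
have -> : wt h (pd i f) x + wt (fun r => derive1 h r / r) (fun x => x 0 i * f x) x = 0.
  rewrite /wt (annular_eq0 af xab) (annular_eq0 (annular_pd Cf af) xab); ring.
apply: (near_eq_is_derive w0); exact: is_derive_cst.
Qed.

Lemma pd_wt h f i : C1_on h -> Ck 1 f -> annular a b f -> pd i (wt h f) =
  (fun x => wt h (pd i f) x + wt (fun r => derive1 h r / r) (fun x => x 0 i * f x) x).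
Proof. by move=> Ch Cf af; apply: is_derive_pdE => x; exact: is_derive_wt. Qed.

Lemma wt_Ck1 h f : C1_on h -> Ck 1 f -> annular a b f -> Ck 1 (wt h f).
Proof.
move=> Ch Cf af; split=> [|i].
  apply: wt_continuous => //; [exact: C1_on_continuous|exact: Ck_continuous Cf].
split=> [x|]; first exact: is_derive_derivable (is_derive_wt _ _ Ch Cf af).
rewrite -pdE pd_wt// -[Ck 0 _]/(continuous _); apply: ctsD; apply: wt_continuous.
- exact: C1_on_continuous.
- by rewrite pdE; exact: (Cf.2 i).2.
- exact: annular_pd.
- move=> r rr; apply: cvgM; first exact: Ch.2.
  by apply: cvgV; [rewrite gt_eqF//; exact: rr.1|exact: cvg_id].
- by apply: ctsM; [exact: coord_continuous|exact: Ck_continuous Cf].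
- exact: annularMl.
Qed.

Lemma Iint_rot F i j : Ck 1 F -> annular a b F -> Iint (rot i j F) = 0.
Proof.
move=> CF aF; have [<-|ij] := eqVneq i j.
  rewrite (_ : rot i i F = fun=> 0); first by rewrite /Iint Rintegral_cst//= mul0r.
  by apply/funext => x; rewrite /rot subrr.
have Cx k : Ck 1 (fun x => x 0 k * F x) by apply: CkM => //; exact: Ck_coord.
have ax k : annular a b (fun x => x 0 k * F x) by exact: annularMl.
have tx k l : test_fun (pd k (fun x => x 0 l * F x)).
  apply: (@annular_test a b); last exact: annular_pd.
  by rewrite pdE; exact: ((Cx l).2 k).2.
have -> : rot i j F = (fun x => pd j (fun x => x 0 i * F x) x
    + (- 1) * pd i (fun x => x 0 j * F x) x).
  have E k l : pd k (fun x => x 0 l * F x) = (fun x => x 0 l * pd k F x + F x * (l == k)%:R).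
    by rewrite pdM; [rewrite pd_coord|exact: Ck_coord|].
  apply/funext => x; rewrite !E (negPf ij) eq_sym (negPf ij) /rot; ring.
have tN : test_fun (fun x => -1 * pd i (fun x => x 0 j * F x) x).
  case: (tx i j) => cG [M GM]; split; first by apply: ctsM => //; exact: cts_cst.
  by exists M => x; rewrite mulN1r oppr_eq0; exact: GM.
by rewrite IintD// IintZ// !(@Iint_pd a b)// mulr0 addr0.
Qed.

(** A rotation field annihilates radial functions. This is why no derivative of a
    weight shows up when rotations are integrated by parts. *)
Lemma rot_wt h f i j : C1_on h -> Ck 1 f -> annular a b f ->
  rot i j (wt h f) = wt h (rot i j f).
Proof.
by move=> Ch Cf af; apply/funext => x; rewrite {1}/rot !pd_wt// /wt /rot; ring.
Qed.

Lemma Iint_wt_rot h f i j : C1_on h -> smooth f -> annular a b f ->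
  Iint (wt h (rot i j f)) = 0.
Proof.
move=> Ch sf af; have Cf := smooth_Ck 1 sf.
by rewrite -rot_wt//; apply: Iint_rot; [exact: wt_Ck1|exact: wt_annular].
Qed.

Lemma Iint_rot_parts h f g i j : C1_on h -> smooth f -> smooth g -> annular a b f ->
  Iint (wt h (fun x => f x * rot i j g x)) = - Iint (wt h (fun x => g x * rot i j f x)).
Proof.
move=> Ch sf sg af; have cc f' : smooth f' -> continuous f' by move=> /(smooth_Ck 0).
have cs := C1_on_continuous Ch.
apply/eqP; rewrite -addr_eq0 -IintD.
- rewrite -[X in _ == X](Iint_wt_rot i j Ch (smoothM sf sg)); last exact: annularMr.
  apply/eqP; congr Iint; apply/funext => x; rewrite rotM// /wt; ring.
- apply: wt_test => //; last exact: annularMr.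
  by apply: ctsM; apply: cc => //; exact: smooth_rot.
- apply: wt_test => //; last by apply: annularMl; exact: annular_rot.
  by apply: ctsM; apply: cc => //; exact: smooth_rot.
Qed.

End weights.

(** * Testing positivity on rays *)

Section cutoff.
Context {R : realType}.
Implicit Types (s m : R).

Lemma is_derive_id1 s : is_derive s 1 (fun t : R => t) 1.
Proof. exact: is_derive_id. Qed.

Lemma is_derive_compR (h g : R -> R) s (dh dg : R) :
  is_derive (g s) 1 h dh -> is_derive s 1 g dg -> is_derive s 1 (fun t => h (g t)) (dh * dg).
Proof. by move=> dh' dg'; exact: (@is_derive1_comp _ h g). Qed.

Lemma is_derive_pow s k : is_derive s 1 (fun t : R => t ^+ k) (k%:R * s ^+ k.-1).
Proof.
apply: DeriveDef; first exact: exprn_derivable.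
by rewrite exp_derive; exact: mulr1.
Qed.

Lemma cts_max0 : continuous (fun s : R => Num.max 0 s).
Proof. by move=> s; apply: continuous_max; [exact: cvg_cst|exact: cvg_id]. Qed.

Lemma is_derive_sqr_pos s :
  is_derive s 1 (fun t : R => Num.max 0 t ^+ 2) (2 * Num.max 0 s).
Proof.
have [s0|s0|s0] : [\/ s < 0, 0 < s | s = 0].
  by case: (ltgtP s 0) => ?; [constructor 1|constructor 2|constructor 3].
- apply: (near_eq_is_derive (f := fun=> 0)); last first.
    by apply: is_derive_ext (is_derive_const _ _ _) _; rewrite max_l ?mulr0// ltW.
  by near=> t; rewrite max_l ?expr0n// ltW//; near: t; exact: lt_nbhsl.
- apply: (near_eq_is_derive (f := fun t : R => t ^+ 2)); last first.
    by apply: is_derive_ext (is_derive_pow _ _) _; rewrite max_r ?expr1// ltW.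
  by near=> t; rewrite max_r// ltW//; near: t; exact: lt_nbhsr.
- rewrite s0; apply/is_derive1_caratheodory; exists (fun t => Num.max 0 t); split.
  + move=> t; rewrite maxxx expr0n/= !subr0.
    by have [t0|t0] := leP 0 t; rewrite ?expr2// !mul0r.
  + exact: cts_max0.
  + by rewrite maxxx mulr0.
Unshelve. all: by end_near. Qed.

(** Piecewise quadratic, with second derivative [- 4] on the first half of
    [[m, m + 1]] and [4] on the second half. *)
Lemma C1_cutoff m : exists2 th : (R -> R) * (R -> R),
  [/\ continuous th.1, continuous th.2 & forall s, is_derive s 1 th.1 (th.2 s)] &
  [/\ forall s, s <= m -> th.1 s = 1, forall s, m + 1 <= s -> th.1 s = 0,
      forall s, th.2 s <= 0, forall s, s <= m -> th.2 s = 0 &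
      forall s, m + 1 <= s -> th.2 s = 0].
Proof.
pose p (s : R) : R := Num.max 0 s ^+ 2; pose p' (s : R) : R := 2 * Num.max 0 s.
pose th (s : R) : R := 1 - 2 * (p (s - m) - 2 * p (s - (m + 2^-1)) + p (s - (m + 1))).
pose th' (s : R) : R := - 2 * (p' (s - m) - 2 * p' (s - (m + 2^-1)) + p' (s - (m + 1))).
have cp' c : continuous (fun s => p' (s - c)).
  apply: ctsM; first exact: cts_cst.
  move=> s; apply: (@continuous_comp _ _ _ (fun s => s - c) (fun s => Num.max 0 s)); last exact: cts_max0.
  by apply: ctsB => t; [exact: cvg_id|exact: cvg_cst].
have dp c s : is_derive s 1 (fun s => p (s - c)) (p' (s - c)).
  have d1 : is_derive s 1 (fun s => s - c) 1.
    by apply: is_derive_ext (is_derive_sub (is_derive_id1 s) (is_derive_const c s 1)) _; rewrite subr0.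
  by apply: is_derive_ext (is_derive_compR (is_derive_sqr_pos _) d1) _; rewrite mulr1.
have dth s : is_derive s 1 th (th' s).
  have d2 := is_derive_mul (is_derive_const 2 s 1) (dp (m + 2^-1) s).
  have d3 := is_derive_add (is_derive_sub (dp m s) d2) (dp (m + 1) s).
  have d4 := is_derive_sub (is_derive_const 1 s 1) (is_derive_mul (is_derive_const 2 s 1) d3).
  by apply: is_derive_ext d4 _; rewrite /th'; ring.
exists (th, th'); split => //=.
- by move=> s; apply: is_derive_continuous (dth s).
- apply: ctsM; first exact: cts_cst.
  apply: ctsD; last exact: cp'.
  by apply: ctsB; [exact: cp'|apply: ctsM; [exact: cts_cst|exact: cp']].
- move=> s sm; rewrite /th /p !max_l; lra.
- move=> s sm; rewrite /th /p !max_r; [|lra..]; by field.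
- move=> s; rewrite /th' /p'; have [?|?] := leP 0 (s - m); have [?|?] := leP 0 (s - (m + 2^-1));
  have [?|?] := leP 0 (s - (m + 1)); clear cp' dp dth; lra.
- move=> s sm; rewrite /th' /p' !max_l; lra.
- move=> s sm; rewrite /th' /p' !max_r; [|lra..]; by field.
Qed.

End cutoff.

Section polar.
Context {R : realType} {n : nat}.
Implicit Types (f g : 'rV[R]_n -> R) (x w : 'rV[R]_n) (t : R).
Local Notation mu := (@lebesgue_measure R).

Lemma cts_comp (T U : topologicalType) (V : topologicalType) (f : U -> V) (c : T -> U) :
  continuous c -> continuous f -> continuous (fun z => f (c z)).
Proof. by move=> cc cf z; exact: continuous_comp (cc z) (cf _). Qed.

Lemma cts_fst (T U : topologicalType) : continuous (fun z : T * U => z.1).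
Proof. by move=> z; exact: cvg_fst. Qed.

Lemma cts_snd (T U : topologicalType) : continuous (fun z : T * U => z.2).
Proof. by move=> z; exact: cvg_snd. Qed.

Lemma cts_snd_coord (T : topologicalType) i : continuous (fun z : T * 'rV[R]_n => z.2 0 i).
Proof. exact: (cts_comp (@cts_snd _ _) (@coord_continuous _ _ _ 0 i)). Qed.

Lemma is_derive_pd_dir g x v : Ck 1 g ->
  is_derive x v g (\sum_i v 0 i * pd i g x).
Proof.
move=> Cg; apply: is_derive_ext (C1_is_derive x v Cg) _.
by rewrite /lform; apply: eq_bigr => i _; rewrite mxE pdE.
Qed.

Lemma is_derive_ray g w t : Ck 1 g ->
  is_derive t 1 (fun s => g (s *: w)) (\sum_i w 0 i * pd i g (t *: w)).
Proof.
move=> Cg; apply: (@is_derive_line _ _ g (fun s : R => s *: w) w) => [s|].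
  by rewrite -scalerDl addrC subrK.
exact: is_derive_pd_dir.
Qed.

Lemma is_derive_dilation g x t i : Ck 1 g ->
  is_derive x (delta_mx 0 i) (fun y => g (t *: y)) (t * pd i g (t *: x)).
Proof.
move=> Cg; apply: (@is_derive_slice _ _ _ g (fun y : 'rV[R]_n => t *: y) _ (t *: delta_mx 0 i)) => [h|].
  by rewrite scalerDr !scalerA mulrC.
apply: is_derive_ext (is_derive_pd_dir _ _ Cg) _.
under eq_bigr do rewrite !mxE eqxx -mulrA.
by rewrite -mulr_sumr; under eq_bigr do rewrite eq_sym; rewrite sum_delta.
Qed.

Lemma cts_ray g w : continuous g -> continuous (fun t : R => g (t *: w)).
Proof.
move=> cg; apply: cts_comp cg; apply: continuous_row => i.
under eq_fun do rewrite mxE.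
by apply: ctsM => [t|]; [exact: cvg_id|exact: cts_cst].
Qed.

(** Beyond the support of [g], the segment from the origin to [x] crosses all of
    the support that lies on its ray. *)
Lemma Rintegral_ray_scale (k : nat) g x (a b : R) : continuous g -> annular a b g ->
  0 < a -> b < enorm x -> (forall w, enorm w = 1 ->
     0 <= \int[mu]_(t in `[a, b]) (t ^+ k * g (t *: w))) ->
  0 <= \int[mu]_(t in `[0, 1]) (t ^+ k * g (t *: x)).
Proof.
move=> cg ag a0 bx gw; set c := enorm x.
have [ab|ba] := leP a b; last first.
  rewrite (_ : (fun t => _) = cst 0); first by rewrite Rintegral_cst// mul0r.
  apply/funext => t; rewrite (annular_eq0 ag) ?mulr0//.
  by apply/negP => /andP[/le_trans] /[apply]; rewrite leNgt ba.
have c0 : 0 < c by rewrite (lt_trans _ bx)// (lt_le_trans a0).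
have [w w1 xE] : exists2 w, enorm w = 1 & x = c *: w.
  exists (c^-1 *: x); last by rewrite scalerA mulfV ?scale1r// gt_eqF.
  by rewrite enormZ ger0_norm ?invr_ge0 ?(ltW c0)// mulVf// gt_eqF.
pose F (s : R) := s ^+ k * g (s *: w).
have cF : continuous F.
  by apply: ctsM; [apply: ctsX => t; exact: cvg_id|exact: cts_ray].
have F0 s : 0 <= s -> ~~ (a <= s <= b) -> F s = 0.
  move=> s0 sab; rewrite /F (annular_eq0 ag) ?mulr0//.
  by rewrite enormZ w1 mulr1 ger0_norm.
have [A dA] := antiderivative 0 c cF.
have E1 : \int[mu]_(t in `[a, b]) F t = A c - A 0.
  rewrite -(Rintegral_derive (ltW c0) cF dA).
  rewrite [LHS]Rintegral_mkcond [RHS]Rintegral_mkcond; apply: eq_Rintegral => s _.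
  rewrite !patchE !mem_setE !in_itv/=.
  have [sab|sab] := boolP (a <= s <= b).
    have /andP[as_ sb] := sab.
    by rewrite (le_trans (ltW a0) as_) (le_trans sb (ltW bx)).
  by case: ifP => // /andP[s0 _]; rewrite F0.
have : 0 <= (A c - A 0) / c ^+ k.+1 by rewrite divr_ge0 ?exprn_ge0 ?(ltW c0)// -E1 gw.
suff -> : \int[mu]_(t in `[0, 1]) (t ^+ k * g (t *: x)) = (A c - A 0) / c ^+ k.+1 by [].
rewrite mulrBl -{1}[c]mul1r -[X in _ - A X / _](mul0r c).
apply: (@Rintegral_derive _ _ (fun t => A (t * c) / c ^+ k.+1)) => //.
- by apply: ctsM; [apply: ctsX => t; exact: cvg_id|exact: cts_ray].
- move=> t /andP[t0 t1].
  have d1 : is_derive t 1 (fun t => t * c) c.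
    apply: is_derive_ext (is_derive_mul (is_derive_id1 t) (is_derive_const c t 1)) _.
    by rewrite mul1r mulr0 addr0.
  have tc : 0 <= t * c <= c.
    by rewrite mulr_ge0 ?(ltW c0)// ger_pMl.
  have d2 := @is_derive_compR _ A (fun t => t * c) t _ _ (dA _ tc) d1.
  apply: is_derive_ext (is_derive_mul d2 (is_derive_const (c ^+ k.+1)^-1 t 1)) _.
  have -> : t *: x = (t * c) *: w by rewrite -scalerA -xE.
  have cn0 : c != 0 by rewrite gt_eqF.
  rewrite mulr0 addr0 /F exprMn exprS; move: (g _) => G; field.
  by rewrite expf_neq0 ?andbT.
Qed.

Lemma test_funD f g : test_fun f -> test_fun g -> test_fun (fun x => f x + g x).
Proof.
move=> [cf [M fM]] [cg [M' gM]]; split; first exact: ctsD.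
exists (Num.max M M') => x H i; rewrite le_max.
have [fx|fx] := eqVneq (f x) 0; last by rewrite fM.
by rewrite fx add0r in H; rewrite gM// orbT.
Qed.

Lemma test_funZ c f : test_fun f -> test_fun (fun x => c * f x).
Proof.
move=> [cf [M fM]]; split; first by apply: ctsM => //; exact: cts_cst.
by exists M => x H; apply: fM; apply: contraNneq H => ->; rewrite mulr0.
Qed.

Lemma test_fun_sum I (r : seq I) (F : I -> 'rV[R]_n -> R) :
  (forall i, test_fun (F i)) -> test_fun (fun x => \sum_(i <- r) F i x) /\
  Iint (fun x => \sum_(i <- r) F i x) = \sum_(i <- r) Iint (F i).
Proof.
move=> tF; elim: r => [|i r [tr IH]].
  under eq_fun do rewrite big_nil; rewrite big_nil /Iint Rintegral_cst// mul0r; split=> //.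
  by split; [exact: cts_cst|exists 0 => x; rewrite eqxx].
under eq_fun do rewrite big_cons; rewrite big_cons IintD// IH; split=> //.
exact: test_funD.
Qed.

(** In place of polar coordinates: the field
    [X(x) = x * int_0^1 g (t x) t^(n-1) dt] has divergence [g]. Let [eta] be a
    radial cutoff equal to [1] on the support of [g]. Then
    [0 = int div (eta X) = int g + int (grad eta . X)], and the last integrand is
    nonpositive: [eta] decreases along rays and, beyond the support of [g], [X]
    points outwards by hypothesis. *)
Lemma polar_ge0 g (a b : R) : (0 < n)%N -> Ck 1 g -> annular a b g -> 0 < a ->
  (forall w, enorm w = 1 -> 0 <= \int[mu]_(t in `[a, b]) (t ^+ n.-1 * g (t *: w))) ->
  0 <= Iint g.
Proof.
move=> n0 Cg ag a0 gw.
have [[th th'] /= [cth cth' dth] [th1 th0 th'0 th'1 th'0']] := C1_cutoff (b ^+ 2).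
pose eta x := th (sqnorm x).
(* The divergence of the field [t ^ (n - 1) eta(x) g(t x) x]. *)
pose Phi t x := t ^+ n.-1 * (eta x * (n%:R * g (t *: x) + t * \sum_i x 0 i * pd i g (t *: x))
  + 2 * sqnorm x * th' (sqnorm x) * g (t *: x)).
have cg := Ck_continuous Cg.
have csq : continuous sqnorm := Ck_continuous (smooth_Ck 0 (@smooth_sqnorm R n)).
have cpd i : continuous (pd i g) by rewrite pdE; exact: (Cg.2 i).2.
have csc : continuous (fun z : R * 'rV[R]_n => z.1 *: z.2).
  apply: continuous_row => i; under eq_fun do rewrite mxE.
  by apply: ctsM; [exact: cts_fst|exact: cts_snd_coord].
have cPhi : continuous (fun z : R * 'rV[R]_n => Phi z.1 z.2).
  have csq2 : continuous (fun z : R * 'rV[R]_n => sqnorm z.2) by apply: cts_comp csq; exact: cts_snd.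
  apply: ctsM; first by apply: ctsX; exact: cts_fst.
  apply: ctsD; apply: ctsM.
  - exact: cts_comp cth.
  - apply: ctsD; apply: ctsM; [exact: cts_cst|exact: cts_comp cg|exact: cts_fst|].
    apply: cts_sum => i; apply: ctsM; first exact: cts_snd_coord.
    exact: cts_comp (cpd i).
  - by apply: ctsM; [apply: ctsM => //; exact: cts_cst|exact: cts_comp cth'].
  - exact: cts_comp cg.
have eta0 x : b ^+ 2 + 1 <= sqnorm x -> eta x = 0 by move=> ?; rewrite /eta th0.
have PhiM t x : 0 <= t <= 1 -> Phi t x != 0 -> forall i, `|x 0 i| <= Num.sqrt (b ^+ 2 + 1).
  move=> _ P0 i; apply: le_trans (coord_le_enorm x i) _.
  apply: ler_wsqrtr; apply: contraNT P0; rewrite -ltNge => /ltW xb.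
  by rewrite /Phi eta0// th'0'// mulr0 !mul0r add0r mulr0.
apply: (@Iint_average R n 0 1 (Num.sqrt (b ^+ 2 + 1)) Phi) => //.
- move=> t _.
  pose G i x := x 0 i * (g (t *: x) * eta x).
  have dG i x : is_derive x (delta_mx 0 i) (G i)
      (g (t *: x) * eta x + x 0 i * (t * pd i g (t *: x) * eta x
        + g (t *: x) * (th' (sqnorm x) * (2 * x 0 i)))).
    have d1 := is_derive_comp1 (dth (sqnorm x)) (is_derive_sqnorm x i).
    have d2 := is_derive_mul (is_derive_dilation x t i Cg) d1.
    apply: is_derive_ext (is_derive_mul (is_derive_coord i i x) d2) _.
    by rewrite eqxx mul1r.
  have bG i x : x 0 i * (g (t *: x) * eta x) != 0 -> forall j, `|x 0 j| <= Num.sqrt (b ^+ 2 + 1).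
    move=> H j; apply: le_trans (coord_le_enorm x j) _.
    apply: ler_wsqrtr; apply: contraNT H; rewrite -ltNge => /ltW xb.
    by rewrite eta0// !mulr0.
  pose dGi i x := g (t *: x) * eta x + x 0 i * (t * pd i g (t *: x) * eta x
        + g (t *: x) * (th' (sqnorm x) * (2 * x 0 i))).
  have ctx : continuous (fun x : 'rV[R]_n => t *: x).
    apply: continuous_row => i; under eq_fun do rewrite mxE.
    by apply: ctsM; [exact: cts_cst|exact: coord_continuous].
  have ceta : continuous eta by exact: cts_comp cth.
  have tG i : test_fun (G i).
    split; last by exists (Num.sqrt (b ^+ 2 + 1)); exact: bG.
    apply: ctsM; first exact: coord_continuous.
    by apply: ctsM => //; exact: cts_comp cg.
  have tdG i : test_fun (dGi i).
    split.
      apply: ctsD; first by apply: ctsM => //; exact: cts_comp cg.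
      apply: ctsM; first exact: coord_continuous.
      apply: ctsD; apply: ctsM => //.
      - by apply: ctsM; [exact: cts_cst|exact: cts_comp (cpd i)].
      - exact: cts_comp cg.
      - apply: ctsM; first exact: cts_comp cth'.
        by apply: ctsM; [exact: cts_cst|exact: coord_continuous].
    exists (Num.sqrt (b ^+ 2 + 1)) => x H j; apply: le_trans (coord_le_enorm x j) _.
    apply: ler_wsqrtr; apply: contraNT H; rewrite -ltNge => /ltW xb.
    by rewrite /dGi eta0// th'0'// !(mul0r, mulr0, addr0).
  have I0 i : Iint (dGi i) = 0 by apply: (@Iint_partial R n i (G i)).
  have -> : Phi t = (fun x => t ^+ n.-1 * \sum_i dGi i x).
    apply/funext => x; rewrite /Phi; congr (_ * _).
    have E i : dGi i x = g (t *: x) * eta x * 1 + t * eta x * (x 0 i * pd i g (t *: x))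
       + 2 * g (t *: x) * th' (sqnorm x) * x 0 i ^+ 2 by rewrite /dGi; ring.
    rewrite [RHS](eq_bigr _ (fun i _ => E i)).
    rewrite !big_split/= -!mulr_sumr -/(sqnorm x).
    have -> : \sum_(i < n) (1 : R) = n%:R by rewrite sumr_const card_ord.
    ring.
  have [ts Is] := test_fun_sum (index_enum 'I_n) tdG.
  by rewrite IintZ// Is big1 ?mulr0.
- exact: annular_test ag.
- move=> x.
  have -> : \int[mu]_(t in `[0, 1]) Phi t x = eta x * g x
     + 2 * sqnorm x * th' (sqnorm x) * \int[mu]_(t in `[0, 1]) (t ^+ n.-1 * g (t *: x)).
    have cF : continuous (fun t : R => t ^+ n.-1 * g (t *: x)).
      by apply: ctsM; [apply: ctsX => t; exact: cvg_id|exact: cts_ray].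
    have [A dA] := antiderivative 0 1 cF.
    rewrite (Rintegral_derive ler01 cF dA).
    pose B t := eta x * (t ^+ n * g (t *: x)) + 2 * sqnorm x * th' (sqnorm x) * A t.
    transitivity (B 1 - B 0); last first.
      by rewrite /B expr1n scale1r mul1r expr0n eqn0Ngt n0/= mul0r mulr0; ring.
    apply: (@Rintegral_derive R (fun t => Phi t x) B) => //.
      have c0 : continuous (fun t : R => (t, x) : R * 'rV[R]_n).
        by move=> t; exact: (cvg_pair cvg_id (cvg_cst _)).
      exact: (cts_comp c0 cPhi).
    move=> t t01.
    have d1 := is_derive_mul (is_derive_pow t n) (is_derive_ray x t Cg).
    have d2 := is_derive_mul (is_derive_const (eta x) t 1) d1.
    have d3 := is_derive_mul (is_derive_const (2 * sqnorm x * th' (sqnorm x)) t 1) (dA t t01).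
    apply: is_derive_ext (is_derive_add d2 d3) _; rewrite /Phi.
    by rewrite -[in t ^+ n](prednK n0) exprS; ring.
  have -> : eta x * g x = g x.
    have [->|/ag/andP[ax xb]] := eqVneq (g x) 0; first by rewrite mulr0.
    rewrite /eta th1 ?mul1r// -enorm_sqr ler_sqr ?nnegrE ?enorm_ge0//.
    exact: le_trans (enorm_ge0 x) xb.
  rewrite gerDl; have [xb|xb] := leP (sqnorm x) (b ^+ 2).
    by rewrite th'1// mulr0 mul0r.
  apply: mulr_le0_ge0.
    by apply: mulr_ge0_le0 => //; rewrite mulr_ge0// sqnorm_ge0.
  have [b0|b0] := ltP b 0.
    rewrite (_ : (fun t => _) = cst 0); first by rewrite Rintegral_cst// mul0r.
    apply/funext => t; rewrite (annular_eq0 ag) ?mulr0//.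
    by apply/negP => /andP[_ /le_lt_trans/(_ b0)]; rewrite ltNge enorm_ge0.
  apply: (Rintegral_ray_scale cg ag a0) => //.
  by rewrite -(ltr_sqr (x := b)) ?nnegrE ?enorm_ge0// enorm_sqr.
Qed.

End polar.

(** * Wirtinger's inequality on the circle *)

Section wirtinger.
Context {R : realType}.
Local Notation mu := (@lebesgue_measure R).
Implicit Types (v w : R -> R) (s : R).

Lemma Rintegral_ge0_derive (f B dB : R -> R) (a b : R) : a <= b -> continuous f ->
  (forall s, a <= s <= b -> is_derive s 1 B (dB s)) ->
  (forall s, a <= s <= b -> dB s <= f s) -> B a <= B b ->
  0 <= \int[mu]_(s in `[a, b]) f s.
Proof.
move=> ab cf dBP dBf BB; apply: le_trans (le_Rintegral_derive ab cf dBP dBf).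
by rewrite subr_ge0.
Qed.

(** The first Dirichlet eigenvalue of an interval of length [pi]: the square is
    completed with the positive solution [cos (l (s - m))], which stays away from
    [0] up to the ends because [l < 1]. *)
Lemma wirtinger_half_lt (p l : R) w dw : continuous dw ->
  (forall s, is_derive s 1 w (dw s)) -> w p = 0 -> w (p + pi) = 0 -> 0 < l < 1 ->
  0 <= \int[mu]_(s in `[p, p + pi]) (dw s ^+ 2 - l ^+ 2 * w s ^+ 2).
Proof.
move=> cdw dww wp wpp /andP[l0 l1].
have p0 : 0 < pi :> R := pi_gt0 R.
have cw : continuous w by move=> s; apply: is_derive_continuous (dww s).
pose m := p + pi / 2; pose u s := l * (s - m).
have du s : is_derive s 1 u l.
  apply: is_derive_ext (is_derive_mul (is_derive_const l s 1)
    (is_derive_sub (is_derive_id1 s) (is_derive_const m s 1))) _.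
  by rewrite mul0r add0r subr0 mulr1.
have cu s : p <= s <= p + pi -> cos (u s) != 0.
  move=> /andP[ps sp]; rewrite gt_eqF//; apply: cos_gt0_pihalf.
  rewrite -ltr_norml /u normrM gtr0_norm//.
  have sm : `|s - m| <= pi / 2 by rewrite ler_norml /m; apply/andP; split; lra.
  apply: (@le_lt_trans _ _ (l * (pi / 2))); first by rewrite ler_pM2l.
  by rewrite gtr_pMl ?divr_gt0.
apply: (@Rintegral_ge0_derive _ (fun s => - (l * (tan (u s) * w s ^+ 2)))
  (fun s => - (l * (cos (u s) ^- 2 * l * w s ^+ 2 + tan (u s) * (2 * w s * dw s))))).
- by rewrite lerDl ltW.
- by apply: ctsB; [exact: ctsX|apply: ctsM; [exact: cts_cst|exact: ctsX]].
- move=> s ps.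
  have d1 : is_derive s 1 (fun s => tan (u s)) (cos (u s) ^- 2 * l).
    by apply: is_derive_compR (is_derive_tan (cu s ps)) (du s).
  have d2 : is_derive s 1 (fun s => w s ^+ 2) (2 * w s * dw s).
    apply: is_derive_ext (is_derive_compR (is_derive_pow (w s) 2) (dww s)) _.
    by rewrite expr1.
  have d3 := is_derive_mul (is_derive_const (- l) s 1) (is_derive_mul d1 d2).
  under eq_fun do rewrite -mulNr; apply: is_derive_ext d3 _; ring.
- move=> s ps; rewrite -subr_ge0.
  have -> : cos (u s) ^- 2 = 1 + tan (u s) ^+ 2 by rewrite cos2_tan2// cu.
  rewrite (_ : _ - _ = (dw s + l * tan (u s) * w s) ^+ 2) ?sqr_ge0//; ring.
- by rewrite wp wpp expr0n/= !mulr0.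
Qed.

Lemma wirtinger_half (p : R) w dw : continuous dw ->
  (forall s, is_derive s 1 w (dw s)) -> w p = 0 -> w (p + pi) = 0 ->
  0 <= \int[mu]_(s in `[p, p + pi]) (dw s ^+ 2 - w s ^+ 2).
Proof.
move=> cdw dww wp wpp.
have cw : continuous w by move=> s; apply: is_derive_continuous (dww s).
have pp : p <= p + pi by rewrite lerDl ltW// pi_gt0.
have [P dP] := antiderivative p (p + pi) (@ctsX _ _ _ 2 cdw).
have [Q dQ] := antiderivative p (p + pi) (@ctsX _ _ _ 2 cw).
have E l : \int[mu]_(s in `[p, p + pi]) (dw s ^+ 2 - l * w s ^+ 2) =
    (P (p + pi) - P p) - l * (Q (p + pi) - Q p).
  transitivity ((fun s => P s - l * Q s) (p + pi) - (fun s => P s - l * Q s) p); last by rewrite /=; ring.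
  apply: (@Rintegral_derive _ _ (fun s => P s - l * Q s)) => //.
  - by apply: ctsB; [exact: ctsX|apply: ctsM; [exact: cts_cst|exact: ctsX]].
  - move=> s ps.
    apply: is_derive_ext (is_derive_sub (dP s ps) (is_derive_mul (is_derive_const l s 1) (dQ s ps))) _.
    by rewrite mul0r add0r.
have H l : 0 < l < 1 -> 0 <= (P (p + pi) - P p) - l ^+ 2 * (Q (p + pi) - Q p).
  by move=> l01; rewrite -E; exact: wirtinger_half_lt.
under eq_Rintegral do rewrite -[X in _ - X]mul1r.
rewrite E mul1r; move: H; set A := P _ - _; set D := Q _ - _ => H.
rewrite leNgt; apply/negP => AD.
have A0 : 0 <= A.
  rewrite /A -(Rintegral_derive pp (@ctsX _ _ _ 2 cdw) dP).
  by apply: Rintegral_ge0 => s _; exact: sqr_ge0.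
have D0 : 0 < D by lra.
(* If [A < D], this [l] contradicts [H]: it satisfies [A = (4 l - 3) D], and
   [4 l - 3 < l ^ 2] for [l < 1]. *)
pose l := (3 * D + A) / (4 * D).
have l01 : 0 < l < 1.
  by rewrite /l divr_gt0 ?ltr_pdivrMr ?mul1r ?mulr_gt0//=; lra.
have := H _ l01.
have -> : A = (4 * l - 3) * D by rewrite /l; field; rewrite gt_eqF.
rewrite -mulrBl pmulr_lge0// => Hl.
have : (l - 1) * (l - 3) <= 0 by move: Hl; lra.
have /andP[l0 l1] := l01.
by rewrite leNgt nmulr_rgt0; [lra|lra].
Qed.

Lemma Rintegral_period (f : R -> R) (T a : R) : 0 <= a -> 0 <= T -> continuous f ->
  (forall s, f (s + T) = f s) ->
  \int[mu]_(s in `[a, a + T]) f s = \int[mu]_(s in `[0, T]) f s.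
Proof.
move=> a0 T0 cf fT; have [A dA] := antiderivative 0 (a + T) cf.
have -> : \int[mu]_(s in `[a, a + T]) f s = A (a + T) - A a.
  apply: (@Rintegral_derive _ _ A); rewrite ?lerDl// => s /andP[as_ sT].
  by apply: dA; rewrite (le_trans a0).
have -> : \int[mu]_(s in `[0, T]) f s = A T - A 0.
  apply: (@Rintegral_derive _ _ A) => // s /andP[as_ sT].
  by apply: dA; rewrite as_ (le_trans sT)// lerDr.
have : \int[mu]_(s in `[0, a]) 0 = (A (a + T) - A a) - (A T - A 0).
  transitivity ((fun s => A (s + T) - A s) a - (fun s => A (s + T) - A s) 0); last by rewrite /= add0r; ring.
  apply: (@Rintegral_derive _ (fun=> 0) (fun s => A (s + T) - A s)) => //.
    exact: cts_cst.
  move=> s /andP[s0 sa].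
  have d1 : is_derive s 1 (fun s => s + T) 1.
    apply: is_derive_ext (is_derive_add (is_derive_id1 s) (is_derive_const T s 1)) _.
    by rewrite addr0.
  have sT : 0 <= s + T <= a + T by rewrite addr_ge0//= lerD2r.
  have d2 := @is_derive_compR _ A (fun s => s + T) s _ _ (dA _ sT) d1.
  have s0a : 0 <= s <= a + T by rewrite s0 (le_trans sa)// lerDl.
  by apply: is_derive_ext (is_derive_sub d2 (dA _ s0a)) _; rewrite fT mulr1 subrr.
by rewrite Rintegral_cst// mul0r => /esym/eqP; rewrite subr_eq0 => /eqP.
Qed.

(** By the intermediate value theorem [v] takes the same value [c] at two
    antipodal points; they cut the circle into two intervals on which [v - c] has
    Dirichlet conditions. Since [v] has mean zero, [c] can only help. *)
Lemma wirtinger v dv : continuous dv -> (forall s, is_derive s 1 v (dv s)) ->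
  (forall s, v (s + 2 * pi) = v s) -> (forall s, dv (s + 2 * pi) = dv s) ->
  \int[mu]_(s in `[0, 2 * pi]) v s = 0 ->
  0 <= \int[mu]_(s in `[0, 2 * pi]) (dv s ^+ 2 - v s ^+ 2).
Proof.
move=> cdv dvv vT dvT v0.
have p0 : 0 < pi :> R := pi_gt0 R.
have cv : continuous v by move=> s; apply: is_derive_continuous (dvv s).
have [p /[!in_itv]/= /andP[p_ge0 pp] vp] : exists2 p, p \in `[0, pi] & v (p + pi) - v p = 0.
  apply: IVT; first exact: ltW.
    apply: continuous_subspaceT; apply: ctsB => //; apply: cts_comp cv.
    by apply: ctsD => [s|]; [exact: cvg_id|exact: cts_cst].
  rewrite add0r; have -> : v (pi + pi) = v 0 by rewrite -[RHS]vT add0r mulr_natl mulr2n.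
  rewrite -[v 0 - v pi]opprB; set d := v pi - v 0.
  by have [d0|d0] := leP 0 d; rewrite ge_min le_max ?oppr_le0 ?oppr_ge0 ?d0 ?(ltW d0) ?orbT.
have {}vp : v (p + pi) = v p by apply/eqP; rewrite -subr_eq0 vp.
set c := v p in vp.
have dw s : is_derive s 1 (fun s => v s - c) (dv s).
  by apply: is_derive_ext (is_derive_sub (dvv s) (is_derive_const c s 1)) _; rewrite subr0.
have half1 := @wirtinger_half p (fun s => v s - c) dv cdv dw.
have half2 := @wirtinger_half (p + pi) (fun s => v s - c) dv cdv dw.
have T0 : 0 <= 2 * pi :> R by rewrite mulr_ge0// ltW.
have cf : continuous (fun s => dv s ^+ 2 - v s ^+ 2) by apply: ctsB; exact: ctsX.
rewrite -(Rintegral_period p_ge0 T0 cf); last by move=> s; rewrite vT dvT.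
move: v0; rewrite -(Rintegral_period p_ge0 T0 cv vT) => v0.
have E2 : p + pi + pi = p + 2 * pi by ring.
have [A dA] := antiderivative p (p + 2 * pi) cf.
have [B dB] := antiderivative p (p + 2 * pi) cv.
have pT : p <= p + 2 * pi by rewrite lerDl.
rewrite (Rintegral_derive pT cv dB) in v0; rewrite (Rintegral_derive pT cf dA).
have cw : continuous (fun s => dv s ^+ 2 - (v s - c) ^+ 2).
  by apply: ctsB; apply: ctsX => //; apply: ctsB => //; exact: cts_cst.
pose G s := A s + 2 * c * B s - c ^+ 2 * s.
have dG s : p <= s <= p + 2 * pi -> is_derive s 1 G (dv s ^+ 2 - (v s - c) ^+ 2).
  move=> ps; have d1 := is_derive_mul (is_derive_const (2 * c) s 1) (dB s ps).
  have d2 := is_derive_mul (is_derive_const (c ^+ 2) s 1) (is_derive_id1 s).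
  apply: is_derive_ext (is_derive_sub (is_derive_add (dA s ps) d1) d2) _; ring.
have EG x y : p <= x -> x <= y -> y <= p + 2 * pi ->
    \int[mu]_(s in `[x, y]) (dv s ^+ 2 - (v s - c) ^+ 2) = G y - G x.
  move=> px xy yp; apply: (@Rintegral_derive _ _ G) => // s /andP[xs sy].
  by apply: dG; rewrite (le_trans px xs) (le_trans sy yp).
have {half1} : 0 <= G (p + pi) - G p.
  rewrite -EG//; [|lra|lra].
  by apply: half1; rewrite ?vp subrr.
have {half2} : 0 <= G (p + 2 * pi) - G (p + pi).
  rewrite -EG//; [|lra|lra].
  by rewrite -E2; apply: half2; rewrite ?E2 ?vT ?vp subrr.
rewrite /G => H1 H2.
have : 0 <= c ^+ 2 * (2 * pi) by rewrite mulr_ge0// sqr_ge0.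
have : c * (B (p + 2 * pi) - B p) = 0 by rewrite v0 mulr0.
lra.
Qed.

End wirtinger.

(** * Testing positivity on the orbits of a rotation *)

Section rotation_average.
Context {R : realType} {n : nat}.
Variables (i j : 'I_n).
Hypothesis ij : i != j.
Implicit Types (f g : 'rV[R]_n -> R) (x y : 'rV[R]_n) (t : R).
Local Notation mu := (@lebesgue_measure R).

Definition turn t x : 'rV[R]_n := \row_k
  (if k == i then cos t * x 0 i - sin t * x 0 j
   else if k == j then sin t * x 0 i + cos t * x 0 j else x 0 k).

Let ji : j != i. Proof. by rewrite eq_sym. Qed.

Lemma turn_i t x : turn t x 0 i = cos t * x 0 i - sin t * x 0 j.
Proof. by rewrite mxE eqxx. Qed.

Lemma turn_j t x : turn t x 0 j = sin t * x 0 i + cos t * x 0 j.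
Proof. by rewrite mxE (negPf ji) eqxx. Qed.

Lemma turn_linear t h x y : turn t (h *: x + y) = h *: turn t x + turn t y.
Proof.
apply/rowP => k; rewrite !mxE; case: eqP => _; first by ring.
by case: eqP => _; ring.
Qed.

Lemma turn0 x : turn 0 x = x.
Proof.
apply/rowP => k; rewrite !mxE cos0 sin0 !mul0r !mul1r subr0 add0r.
by case: eqP => [->//|_]; case: eqP => [->|].
Qed.

Lemma turn_period t x : turn (t + 2 * pi) x = turn t x.
Proof. by rewrite /turn mulr_natl cosD2pi sinD2pi. Qed.

Lemma turn2pi x : turn (2 * pi) x = x.
Proof. by rewrite -[2 * pi]add0r turn_period turn0. Qed.

Lemma sum_two (F : 'I_n -> R) (al be : R) :
  \sum_k (if k == i then al else if k == j then be else 0) * F k = al * F i + be * F j.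
Proof.
rewrite (bigD1 i)//= eqxx; congr (_ + _); rewrite (bigD1 j)//= (negPf ji) eqxx.
rewrite big1 ?addr0// => k /andP[ki kj].
by rewrite (negPf ki) (negPf kj) mul0r.
Qed.

Lemma sqnorm_turn t x : sqnorm (turn t x) = sqnorm x.
Proof.
rewrite /sqnorm (bigD1 i)//= [RHS](bigD1 i)//= (bigD1 j)//= [in RHS](bigD1 j)//=.
rewrite turn_i turn_j !addrA; congr (_ + _).
  have := cos2Dsin2 t; set c := cos t; set s := sin t => cs.
  by rewrite -[RHS]mul1r -cs; ring.
by apply: eq_bigr => k /andP[ki kj]; rewrite mxE (negPf ki) (negPf kj).
Qed.

Lemma enorm_turn t x : enorm (turn t x) = enorm x.
Proof. by rewrite /enorm -!/(sqnorm _) sqnorm_turn. Qed.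

Lemma cts_turn : continuous (fun z : R * 'rV[R]_n => turn z.1 z.2).
Proof.
have cc : continuous (fun z : R * 'rV[R]_n => cos z.1).
  by apply: cts_comp (@continuous_cos R); exact: cts_fst.
have cs : continuous (fun z : R * 'rV[R]_n => sin z.1).
  by apply: cts_comp (@continuous_sin R); exact: cts_fst.
apply: continuous_row => k; under eq_fun do rewrite mxE.
case: eqP => _.
  by apply: ctsB; apply: ctsM => //; exact: cts_snd_coord.
case: eqP => _; last exact: cts_snd_coord.
by apply: ctsD; apply: ctsM => //; exact: cts_snd_coord.
Qed.

Lemma cts_turn_x t : continuous (turn t).
Proof.
apply: continuous_row => k; under eq_fun do rewrite mxE.
case: eqP => _.
  by apply: ctsB; apply: ctsM; do ?[exact: cts_cst|exact: coord_continuous].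
case: eqP => _; last exact: coord_continuous.
by apply: ctsD; apply: ctsM; do ?[exact: cts_cst|exact: coord_continuous].
Qed.

Lemma is_derive_turn g x t : Ck 1 g ->
  is_derive t 1 (fun s => g (turn s x)) (rot i j g (turn t x)).
Proof.
move=> Cg; pose c' : 'rV[R]_n := \row_k
  (if k == i then - turn t x 0 j else if k == j then turn t x 0 i else 0).
have dc k : is_derive t 1 (fun s => turn s x 0 k) (c' 0 k).
  rewrite mxE; under eq_fun do rewrite mxE.
  have dcos := is_derive_cos t; have dsin := is_derive_sin t.
  have dcx (a : R) := is_derive_mul dcos (is_derive_const a t 1).
  have dsx (a : R) := is_derive_mul dsin (is_derive_const a t 1).
  case: eqP => _.
    by apply: is_derive_ext (is_derive_sub (dcx _) (dsx _)) _; rewrite turn_j; ring.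
  case: eqP => _; last exact: is_derive_const.
  by apply: is_derive_ext (is_derive_add (dsx _) (dcx _)) _; rewrite turn_i; ring.
apply: is_derive_ext (C1_chain Cg dc) _.
rewrite /lform; under eq_bigr do rewrite gradE mxE.
by rewrite sum_two /rot; ring.
Qed.

Lemma is_derive_turn_pd g x t k : Ck 1 g ->
  is_derive x (delta_mx 0 k) (fun y => g (turn t y))
    (\sum_m turn t (delta_mx 0 k) 0 m * pd m g (turn t x)).
Proof.
move=> Cg; apply: (@is_derive_slice _ _ _ g (turn t) _ (turn t (delta_mx 0 k))) => [h|].
  exact: turn_linear.
exact: is_derive_pd_dir.
Qed.

Lemma turn_C1 g t : Ck 1 g -> Ck 1 (fun y => g (turn t y)).
Proof.
move=> Cg.
have ct := @cts_turn_x t.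
split; first exact: (cts_comp ct (Ck_continuous Cg)).
move=> k; split=> [x|]; first exact: is_derive_derivable (is_derive_turn_pd x t k Cg).
rewrite -pdE (is_derive_pdE (fun x => is_derive_turn_pd x t k Cg)) -[Ck 0 _]/(continuous _).
apply: cts_sum => m; apply: ctsM; first exact: cts_cst.
by apply: (cts_comp ct); rewrite pdE; exact: (Cg.2 m).2.
Qed.

Lemma rot_turn g t : Ck 1 g ->
  rot i j (fun y => g (turn t y)) = (fun x => rot i j g (turn t x)).
Proof.
move=> Cg; apply/funext => x.
have E k : pd k (fun y => g (turn t y)) =
    (fun x => \sum_m turn t (delta_mx 0 k) 0 m * pd m g (turn t x)).
  by apply: is_derive_pdE => y; exact: is_derive_turn_pd.
have ti : \sum_m turn t (delta_mx 0 i) 0 m * pd m g (turn t x) =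
    cos t * pd i g (turn t x) + sin t * pd j g (turn t x).
  rewrite -(sum_two (fun m => pd m g (turn t x))); apply: eq_bigr => m _; congr (_ * _).
  rewrite !mxE !eqxx (negPf ji)/=; case: eqP => [_|/eqP mi]; first by rewrite mulr1 mulr0 subr0.
  by case: eqP => [_|_]; rewrite ?mulr1 ?mulr0 ?addr0// (negPf mi).
have tj : \sum_m turn t (delta_mx 0 j) 0 m * pd m g (turn t x) =
    - sin t * pd i g (turn t x) + cos t * pd j g (turn t x).
  rewrite -(sum_two (fun m => pd m g (turn t x))); apply: eq_bigr => m _; congr (_ * _).
  rewrite !mxE !eqxx (negPf ij)/=; case: eqP => [_|/eqP mi]; first by rewrite mulr1 mulr0 sub0r.
  by case: eqP => [_|/eqP mj]; rewrite ?mulr1 ?mulr0 ?add0r// (negPf mj).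
rewrite /rot !E ti tj turn_i turn_j; ring.
Qed.

Lemma cts_turn_t x : continuous (fun t => turn t x).
Proof.
have c0 : continuous (fun t : R => (t, x) : R * 'rV[R]_n).
  by move=> t; exact: (cvg_pair cvg_id (cvg_cst _)).
exact: (cts_comp c0 cts_turn).
Qed.

(** Integrating by parts in [t], the integral of [t * rot i j (g o turn t)] over
    [[0, 2 pi]] is [2 pi g] minus the integral of [g] along the orbit, and a
    rotation derivative has zero integral over space. *)
Lemma rotation_average_ge0 g (a b : R) : Ck 1 g -> annular a b g ->
  (forall x, 0 <= \int[mu]_(t in `[0, 2 * pi]) g (turn t x)) -> 0 <= Iint g.
Proof.
move=> Cg ag gt0; have cg := Ck_continuous Cg.
have pi2 : 0 < 2 * pi :> R by rewrite mulr_gt0// pi_gt0.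
have crot : continuous (rot i j g).
  by apply: ctsB; apply: ctsM; rewrite ?pdE; [exact: coord_continuous|exact: (Cg.2 _).2
    |exact: coord_continuous|exact: (Cg.2 _).2].
have Ct t : Ck 1 (fun y => g (turn t y)) := turn_C1 t Cg.
have at_ t : annular a b (fun y => g (turn t y)).
  by move=> x /ag; rewrite enorm_turn.
have tg : test_fun g := annular_test cg ag.
have trot t : test_fun (rot i j (fun y => g (turn t y))).
  apply: (@annular_test _ _ a b).
    by rewrite rot_turn//; apply: cts_comp crot; exact: cts_turn_x.
  by apply: annularB; apply: annularMl; apply: annular_pd.
suff : 0 <= Iint (fun x => 2 * pi * g x) by rewrite IintZ// pmulr_rge0.
apply: (@Iint_average R n 0 (2 * pi) b (fun t x => t * rot i j g (turn t x))).
- by apply: ctsM; [exact: cts_fst|exact: (cts_comp cts_turn crot)].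
- move=> t x _ H k; apply: le_trans (coord_le_enorm x k) _.
  have : rot i j (fun y => g (turn t y)) x != 0.
    by rewrite rot_turn//; apply: contraNneq H => ->; rewrite mulr0.
  move=> {}H; have : annular a b (rot i j (fun y => g (turn t y))).
    by apply: annularB; apply: annularMl; apply: annular_pd.
  by move=> /(_ _ H) /andP[].
- move=> t _; have It := Iint_rot i j (Ct t) (at_ t).
  have tt := trot t; rewrite (rot_turn t Cg) in It tt.
  by rewrite IintZ// It mulr0.
- exact: test_funZ.
- move=> x.
  have cgt : continuous (fun t => g (turn t x)) := cts_comp (@cts_turn_t x) cg.
  have [A dA] := antiderivative 0 (2 * pi) cgt.
  have -> : \int[mu]_(t in `[0, 2 * pi]) (t * rot i j g (turn t x)) =
      2 * pi * g x - (A (2 * pi) - A 0).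
    transitivity ((fun t => t * g (turn t x) - A t) (2 * pi) - (fun t => t * g (turn t x) - A t) 0).
      apply: (@Rintegral_derive R _ (fun t => t * g (turn t x) - A t)).
      - exact: ltW.
      - apply: ctsM => [t|]; [exact: cvg_id|exact: (cts_comp (@cts_turn_t x) crot)].
      - move=> t t2; have d1 := is_derive_mul (is_derive_id1 t) (is_derive_turn x t Cg).
        by apply: is_derive_ext (is_derive_sub d1 (dA t t2)) _; ring.
    by rewrite /= turn2pi; ring.
  rewrite gerBl -(Rintegral_derive (ltW pi2) cgt dA); exact: gt0.
Qed.

(** Along an orbit [rot i j] is the derivative in the angle, so [rot i j f] has
    mean zero there and Wirtinger's inequality applies to it. *)
Lemma wirtinger_rot (rho : \bar R) (a b : R) h f : 0 < a -> (b%:E < rho)%E ->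
  C1_on rho h -> (forall r, itv0 rho r -> 0 <= h r) -> smooth f -> annular a b f ->
  0 <= Iint (wt h (fun x => rot i j (rot i j f) x ^+ 2 - rot i j f x ^+ 2)).
Proof.
move=> a0 brho Ch h0 sf af; have srf := smooth_rot i j sf; have srrf := smooth_rot i j srf.
have arf := @annular_rot _ _ a b f i j sf af.
have arrf := @annular_rot _ _ a b _ i j srf arf.
have sF : smooth (fun x => rot i j (rot i j f) x ^+ 2 - rot i j f x ^+ 2).
  by under eq_fun do rewrite !expr2; apply: smoothB; exact: smoothM.
have aF : annular a b (fun x => rot i j (rot i j f) x ^+ 2 - rot i j f x ^+ 2).
  by under eq_fun do rewrite !expr2; apply: annularB; exact: annularMl.
apply: (@rotation_average_ge0 _ a b).
- by apply: (wt_Ck1 a0 brho Ch) => //; exact: smooth_Ck.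
- exact: wt_annular.
move=> x; rewrite /wt.
have cd : continuous (fun t => rot i j (rot i j f) (turn t x)).
  by apply: (cts_comp (@cts_turn_t x)); exact: (Ck_continuous (smooth_Ck 0 srrf)).
have cv : continuous (fun t => rot i j f (turn t x)).
  by apply: (cts_comp (@cts_turn_t x)); exact: (Ck_continuous (smooth_Ck 0 srf)).
have pi2 : 0 <= 2 * pi :> R by rewrite mulr_ge0// ltW// pi_gt0.
have [xab|xab] := boolP (a <= enorm x <= b); last first.
  apply: Rintegral_ge0 => t _.
  by rewrite (annular_eq0 aF) ?mulr0// enorm_turn.
under eq_Rintegral do rewrite enorm_turn.
rewrite RintegralZl//; last first.
  by apply: continuous_integrable_itv; apply: ctsB; exact: ctsX.
apply: mulr_ge0; first by apply: h0; exact: (annulus_itv0 a0 brho xab).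
apply: (@wirtinger R (fun t => rot i j f (turn t x))) => //.
- by move=> t; exact: (is_derive_turn x t (smooth_Ck 1 srf)).
- by move=> t; rewrite turn_period.
- by move=> t; rewrite turn_period.
- transitivity ((fun t => f (turn t x)) (2 * pi) - (fun t => f (turn t x)) 0); last first.
    by rewrite /= turn2pi turn0 subrr.
  apply: (@Rintegral_derive R _ (fun t => f (turn t x)) 0 (2 * pi) pi2 cv).
  by move=> t _; exact: (is_derive_turn x t (smooth_Ck 1 sf)).
Qed.

End rotation_average.

(** * The spectral gap of spheres *)

Section weighted_integrals.
Context {R : realType} {n : nat}.
Variables (rho : \bar R) (a b : R).
Hypotheses (a0 : 0 < a) (b_rho : (b%:E < rho)%E).
Implicit Types (h : R -> R) (f g u v : 'rV[R]_n -> R) (x : 'rV[R]_n).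

Definition ring_fun f := smooth f /\ annular a b f.

Lemma ring_funD f g : ring_fun f -> ring_fun g -> ring_fun (fun x => f x + g x).
Proof. by move=> [sf af] [sg ag]; split; [exact: smoothD|exact: annularD]. Qed.

Lemma ring_funB f g : ring_fun f -> ring_fun g -> ring_fun (fun x => f x - g x).
Proof. by move=> [sf af] [sg ag]; split; [exact: smoothB|exact: annularB]. Qed.

Lemma ring_funM f g : ring_fun f -> ring_fun g -> ring_fun (fun x => f x * g x).
Proof. by move=> [sf af] [sg ag]; split; [exact: smoothM|exact: annularMl]. Qed.

Lemma ring_funZ c f : ring_fun f -> ring_fun (fun x => c * f x).
Proof.
by move=> [sf af]; split; [apply: smoothM => //; exact: smooth_cst|exact: annularMl].
Qed.

Lemma ring_funX2 f : ring_fun f -> ring_fun (fun x => f x ^+ 2).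
Proof. by move=> rf; under eq_fun do rewrite expr2; exact: ring_funM. Qed.

Lemma ring_fun_sum I (r : seq I) (F : I -> 'rV[R]_n -> R) :
  (forall c, ring_fun (F c)) -> ring_fun (fun x => \sum_(c <- r) F c x).
Proof.
by move=> rF; split; [apply: smooth_sum => c|apply: annular_sum => c]; case: (rF c).
Qed.

Lemma ring_fun_rot i j f : ring_fun f -> ring_fun (rot i j f).
Proof. by move=> [sf af]; split; [exact: smooth_rot|exact: annular_rot]. Qed.

Lemma ring_fun_euler f : ring_fun f -> ring_fun (euler f).
Proof. by move=> [sf af]; split; [exact: smooth_euler|exact: annular_euler]. Qed.

Lemma ring_fun_sph f : ring_fun f -> ring_fun (sph f).
Proof. by move=> [sf af]; split; [exact: smooth_sph|exact: annular_sph]. Qed.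

Definition wint h f := Iint (wt h f).

Section one_weight.
Variable h : R -> R.
Hypothesis Ch : C1_on rho h.

Lemma ring_wt_test f : ring_fun f -> test_fun (wt h f).
Proof.
move=> [sf af]; apply: (wt_test a0 b_rho (C1_on_continuous Ch)) af.
exact: (Ck_continuous (smooth_Ck 0 sf)).
Qed.

Lemma wint_ext f g : (forall x, f x = g x) -> wint h f = wint h g.
Proof. by move=> fg; congr (Iint _); apply/funext => x; rewrite /wt fg. Qed.

Lemma wintD f g : ring_fun f -> ring_fun g ->
  wint h (fun x => f x + g x) = wint h f + wint h g.
Proof.
move=> rf rg; rewrite /wint -IintD; [|exact: ring_wt_test..].
by congr (Iint _); apply/funext => x; rewrite /wt mulrDr.
Qed.

Lemma wintZ c f : ring_fun f -> wint h (fun x => c * f x) = c * wint h f.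
Proof.
move=> rf; rewrite /wint -IintZ; last exact: ring_wt_test.
by congr (Iint _); apply/funext => x; rewrite /wt mulrCA.
Qed.

Lemma wintB f g : ring_fun f -> ring_fun g ->
  wint h (fun x => f x - g x) = wint h f - wint h g.
Proof.
move=> rf rg; rewrite (wint_ext (g := fun x => f x + (- 1) * g x)); last first.
  by move=> x; rewrite mulN1r.
by rewrite wintD ?wintZ ?mulN1r//; exact: ring_funZ.
Qed.

Lemma wint_sum I (r : seq I) (F : I -> 'rV[R]_n -> R) : (forall c, ring_fun (F c)) ->
  wint h (fun x => \sum_(c <- r) F c x) = \sum_(c <- r) wint h (F c).
Proof.
move=> rF; have [_ <-] := test_fun_sum r (fun c => ring_wt_test (rF c)).
by congr (Iint _); apply/funext => x; rewrite /wt mulr_sumr.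
Qed.

Lemma wint_parts i j f g : ring_fun f -> ring_fun g ->
  wint h (fun x => f x * rot i j g x) = - wint h (fun x => g x * rot i j f x).
Proof. by move=> [sf af] [sg _]; exact: (Iint_rot_parts a0 b_rho). Qed.

Lemma wint_ge0 f : (forall r, itv0 rho r -> 0 <= h r) -> ring_fun f ->
  (forall x, 0 < enorm x -> 0 <= f x) -> 0 <= wint h f.
Proof.
move=> h0 [_ af] f0; apply: Iint_ge0 => x; rewrite /wt.
have [xab|xab] := boolP (a <= enorm x <= b); last by rewrite (annular_eq0 af xab) mulr0.
have xr := annulus_itv0 a0 b_rho xab.
by apply: mulr_ge0; [exact: h0|apply: f0; case: xr].
Qed.

(** Green's formula on spheres: the Laplacian of spheres is half the sum of the
    squares of the rotations, and each rotation is skew for radial weights. *)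
Lemma wint_green g u : ring_fun g -> ring_fun u ->
  \sum_i \sum_j wint h (fun x => rot i j u x * rot i j g x) =
  - (2 * wint h (fun x => g x * sph u x)).
Proof.
move=> rg ru; have ru1 i j := ring_fun_rot i j ru; have ru2 i j := ring_fun_rot i j (ru1 i j).
have -> : \sum_i \sum_j wint h (fun x => rot i j u x * rot i j g x) =
    - (\sum_i \sum_j wint h (fun x => g x * rot i j (rot i j u) x)).
  rewrite -sumrN; apply: eq_bigr => i _; rewrite -sumrN; apply: eq_bigr => j _.
  exact: wint_parts.
congr (- _); rewrite -wintZ; last by apply: ring_funM => //; exact: ring_fun_sph.
under eq_bigr => i _ do rewrite -(wint_sum _ (fun j => ring_funM rg (ru2 i j))).
rewrite -wint_sum; last by move=> i; apply: ring_fun_sum => j; exact: ring_funM.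
apply: wint_ext => x; rewrite [RHS]mulrCA -sum_rot2; last by case: ru.
by rewrite mulr_sumr; apply: eq_bigr => i _; rewrite mulr_sumr.
Qed.

(** Two applications of Green's formula, with [rot_sph] in between. *)
Lemma wint_sph_sqr u : ring_fun u ->
  4^-1 * (\sum_k \sum_l \sum_i \sum_j wint h (fun x => rot i j (rot k l u) x ^+ 2)) =
  wint h (fun x => sph u x ^+ 2).
Proof.
move=> ru; have rs := ring_fun_sph ru; have [su _] := ru.
have -> : \sum_k \sum_l \sum_i \sum_j wint h (fun x => rot i j (rot k l u) x ^+ 2) =
    - (2 * \sum_k \sum_l wint h (fun x => rot k l u x * rot k l (sph u) x)).
  rewrite mulr_sumr -sumrN; apply: eq_bigr => k _.
  rewrite mulr_sumr -sumrN; apply: eq_bigr => l _.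
  have rk := ring_fun_rot k l ru.
  rewrite rot_sph// -(wint_green rk rk); apply: eq_bigr => i _; apply: eq_bigr => j _.
  by apply: wint_ext => x; rewrite expr2.
rewrite wint_green// (wint_ext (g := fun x => sph u x ^+ 2)) => [|x]; last by rewrite expr2.
by field.
Qed.

End one_weight.

Definition gamma u x := 2^-1 * \sum_i \sum_j rot i j u x ^+ 2.

Lemma ring_fun_gamma u : ring_fun u -> ring_fun (gamma u).
Proof.
move=> ru; apply: ring_funZ; do 2! apply: ring_fun_sum => ?.
by apply: ring_funX2; exact: ring_fun_rot.
Qed.

End weighted_integrals.

Lemma rot_diag (R : realType) n (i : 'I_n) f (x : 'rV[R]_n) : rot i i f x = 0.
Proof. by rewrite /rot subrr. Qed.

Lemma rot_anti (R : realType) n (i j : 'I_n) f (x : 'rV[R]_n) : rot j i f x = - rot i j f x.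
Proof. by rewrite /rot opprB. Qed.

Lemma rotN (R : realType) n (i j : 'I_n) f (x : 'rV[R]_n) : smooth f ->
  rot i j (fun x => - f x) x = - rot i j f x.
Proof.
move=> sf; rewrite (_ : (fun x => - f x) = (fun x => (- 1) * f x)).
  by rewrite rotZ// mulN1r.
by apply/funext => y; rewrite mulN1r.
Qed.

(** The first positive eigenvalue of the unit sphere is [n - 1], in the form of an
    inequality between the squares of the Laplacian and of the gradient. For
    [n >= 3] this is the integral of Bochner's inequality. On the circle that
    inequality is void, and the statement is Wirtinger's inequality. For [n = 1]
    the constant is zero. *)
Lemma spherical_gap (R : realType) n (rho : \bar R) (a b : R) h (u : 'rV[R]_n -> R) :
  0 < a -> (b%:E < rho)%E -> C1_on rho h -> (forall r, itv0 rho r -> 0 <= h r) ->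
  (0 < n)%N -> ring_fun a b u ->
  0 <= wint h (fun x => sph u x ^+ 2 - (n%:R - 1) * gamma u x).
Proof.
move=> a0 brho Ch h0; case: n u => // -[|[|m]] u _ ru.
- apply: (wint_ge0 a0 brho h0).
    apply: ring_funB; first by apply: ring_funX2; exact: ring_fun_sph.
    by apply: ring_funZ; exact: ring_fun_gamma.
  by move=> x _; rewrite subrr mul0r subr0 sqr_ge0.
- have [su au] := ru; have i01 : (0 : 'I_2) != 1 by [].
  have := wirtinger_rot i01 a0 brho Ch h0 su au.
  congr (0 <= Iint _); apply/funext => x; rewrite /wt; congr (_ * (_ - _)).
    have := sum_rot2 x su; rewrite !big_ord_recl !big_ord0.
    set i0 := ord0; set i1 := lift _ _.
    have -> : i0 = 0 by exact/val_inj.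
    have -> : i1 = 1 by exact/val_inj.
    rewrite !rot_diag (_ : rot 1 0 u = fun x => - rot 0 1 u x); last first.
      by apply/funext => y; exact: rot_anti.
    rewrite rot_anti rotN; last exact: smooth_rot.
    by move=> E; congr (_ ^+ 2); lra.
  rewrite /gamma !big_ord_recl !big_ord0.
  set i0 := ord0; set i1 := lift _ _.
  have -> : i0 = 0 by exact/val_inj.
  have -> : i1 = 1 by exact/val_inj.
  by rewrite !rot_diag (rot_anti 0 1) sqrrN; field.
have [su au] := ru; have rs := ring_fun_sph ru; have rg := ring_fun_gamma ru.
have c2 : 0 < (m.+3)%:R - 2 :> R by rewrite subr_gt0 ltr_nat.
rewrite (wintB a0 brho Ch (ring_funX2 rs) (ring_funZ _ rg)) (wintZ a0 brho Ch)//.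
set T := wint h _; set G := wint h _.
pose Q x := 4^-1 * \sum_k \sum_l \sum_i \sum_j rot i j (rot k l u) x ^+ 2.
have rq k l i j : ring_fun a b (fun x => rot i j (rot k l u) x ^+ 2).
  by apply: ring_funX2; do 2! apply: ring_fun_rot.
have rQ : ring_fun a b Q by apply: ring_funZ; do 4! apply: ring_fun_sum => ?; exact: rq.
have QT : wint h Q = T.
  rewrite /T -(wint_sph_sqr a0 brho Ch ru) (wintZ a0 brho Ch); last first.
    by do 4! apply: ring_fun_sum => ?; exact: rq.
  congr (_ * _).
  do 4! (rewrite (wint_sum a0 brho Ch) => [|?]; [apply: eq_bigr => ? _|
    do ? apply: ring_fun_sum => ?; exact: rq]).
  by [].
have : 0 <= wint h (fun x => ((m.+3)%:R - 1) * Q x -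
    (sph u x ^+ 2 + ((m.+3)%:R - 1) * ((m.+3)%:R - 2) * gamma u x)).
  apply: (wint_ge0 a0 brho h0).
    apply: ring_funB; first exact: ring_funZ.
    by apply: ring_funD; [exact: ring_funX2|exact: ring_funZ].
  move=> x x0; rewrite subr_ge0; apply: bochner_rot => //.
  by rewrite -enorm_sqr exprn_gt0.
rewrite (wintB a0 brho Ch (ring_funZ _ rQ) (ring_funD (ring_funX2 rs) (ring_funZ _ rg))).
rewrite (wintD a0 brho Ch (ring_funX2 rs) (ring_funZ _ rg)).
rewrite (wintZ a0 brho Ch _ rQ) (wintZ a0 brho Ch _ rg).
rewrite QT -/T -/G => H; rewrite -(pmulr_rge0 _ c2).
by clearbody T G; apply: le_trans H _; rewrite le_eqVlt; apply/orP; left; apply/eqP; ring.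
Qed.

(** * The Bessel inequality on a ray *)

Section line_calculus.
Context {R : realType}.
Implicit Types (f g h q c V W : R -> R) (r s t : R) (rho : \bar R).
Local Notation mu := (@lebesgue_measure R).

Lemma is_derive_inv f t d : f t != 0 -> is_derive t 1 f d ->
  is_derive t 1 (fun s => (f s)^-1) (- d / f t ^+ 2).
Proof.
move=> f0 fd; apply: is_derive_ext (is_deriveV f0 fd) _.
by rewrite -exprVn /GRing.scale /= mulNr mulrC mulNr.
Qed.

Lemma is_derive_powdiv t m k : t != 0 ->
  is_derive t 1 (fun s : R => s ^+ m / s ^+ k) ((m%:R - k%:R) * (t ^+ m / t ^+ k) / t).
Proof.
move=> t0; have tk : t ^+ k != 0 by rewrite expf_neq0.
have P j : j%:R * t ^+ j.-1 = j%:R * t ^+ j / t.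
  by case: j => [|j]; rewrite ?mul0r//= -mulrA exprSr mulfK.
have D := is_derive_mul (is_derive_pow t m)
  (@is_derive_inv (fun s => s ^+ k) t _ tk (is_derive_pow t k)).
by apply: is_derive_ext D _; rewrite !P; field; rewrite t0.
Qed.

Lemma itv0_near rho r : itv0 rho r -> \forall s \near r, itv0 rho s.
Proof.
move=> [r0 rrho]; have P1 : \forall s \near r, 0 < s by exact: lt_nbhsr.
have P2 : \forall s \near r, (s%:E < rho)%E.
  case: rho rrho => [c| |//] rc; last by near=> s; exact: ltry.
  by move: rc; rewrite lte_fin => rc; near=> s; rewrite lte_fin; near: s; exact: lt_nbhsl.
by apply: filterS2 P1 P2 => s.
Unshelve. all: by end_near.
Qed.

Lemma C1_on_derive rho h dh : (forall r, itv0 rho r -> is_derive r 1 h (dh r)) ->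
  continuous_on rho dh -> C1_on rho h.
Proof.
move=> H cdh; split=> [r /H[]//|r rr].
have E s : itv0 rho s -> derive1 h s = dh s by move=> /H D; rewrite derive1E (is_derive_val D).
have C : dh s @[s --> r] --> derive1 h r by rewrite E//; exact: cdh.
apply: cvg_trans C; apply: near_eq_cvg.
by apply: filterS (itv0_near rr) => s ss; rewrite E.
Qed.

Lemma smooth_on_is_derive rho V k r : smooth_on (itv0 rho) V -> itv0 rho r ->
  is_derive r 1 (derive1n k V) (derive1n k.+1 V r).
Proof. by move=> sV rr; rewrite derive1nS derive1E; exact/derivableP/sV. Qed.

Lemma smooth_on_continuous rho V k : smooth_on (itv0 rho) V ->
  continuous_on rho (derive1n k V).
Proof. by move=> sV r rr; apply: is_derive_continuous; exact: smooth_on_is_derive rr. Qed.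

Lemma continuous_on_divX rho V k : continuous_on rho V ->
  continuous_on rho (fun r => V r / r ^+ k).
Proof.
move=> cV r rr; have [r0 _] := rr; apply: continuousM; first exact: cV.
apply: continuousV; first by rewrite expf_neq0// gt_eqF.
exact: exprn_continuous.
Qed.

Lemma C1_on_divX rho V k : smooth_on (itv0 rho) V -> C1_on rho (fun r => V r / r ^+ k).
Proof.
move=> sV; apply: (C1_on_derive (dh := fun r => derive1 V r / r ^+ k - k%:R * (V r / r ^+ k.+1))).
  move=> r rr; have [r0 _] := rr; have {}r0 : r != 0 by rewrite gt_eqF.
  have D := is_derive_mul (smooth_on_is_derive 0 sV rr) (is_derive_powdiv 0 k r0).
  rewrite [X in is_derive _ _ X](_ : _ = (fun s => V s * (s ^+ 0 / s ^+ k))); last first.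
    by apply/funext => s; rewrite expr0 mul1r.
  by apply: is_derive_ext D _; rewrite /= exprS; field; rewrite r0 expf_neq0.
move=> r rr; apply: continuousB.
  exact: (@continuous_on_divX rho (derive1 V) k (@smooth_on_continuous rho V 1 sV) r rr).
have cVk := @continuous_on_divX rho V k.+1 (@smooth_on_continuous rho V 0 sV) r rr.
exact: (@continuousM _ _ (fun _ => k%:R) (fun s => V s / s ^+ k.+1) r (@cts_cst R _ _ r) cVk).
Qed.

Section compact_support.
Variables (rho : \bar R) (a b : R).
Hypotheses (a0 : 0 < a) (b_rho : (b%:E < rho)%E).

Lemma segment_itv0 r : a <= r <= b -> itv0 rho r.
Proof.
move=> /andP[ar rb]; split; first exact: lt_le_trans ar.
by apply: le_lt_trans b_rho; rewrite lee_fin.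
Qed.

Lemma zero_extension_continuous q c : continuous_on rho q -> continuous c ->
  (forall r, ~~ (a <= r <= b) -> c r = 0) -> continuous (fun r => q r * c r).
Proof.
move=> cq cc c0 r; have [rab|rab] := boolP (a <= r <= b).
  by apply: continuousM; [exact: cq (segment_itv0 rab)|exact: cc].
have rn : \forall s \near r, ~~ (a <= s <= b).
  move: rab; rewrite negb_and -!ltNge => /orP[ra|br].
    by near=> s; rewrite negb_and -!ltNge; apply/orP; left; near: s; exact: lt_nbhsl.
  by near=> s; rewrite negb_and -!ltNge; apply/orP; right; near: s; exact: lt_nbhsr.
rewrite /continuous_at (c0 _ rab) mulr0; apply: cvg_near_cst.
by apply: filterS rn => s /c0 ->; rewrite mulr0.
Unshelve. all: by end_near.
Qed.

Lemma Rintegral_itv0 f : (forall r, ~~ (a <= r <= b) -> f r = 0) ->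
  \int[mu]_(r in itv0 rho) f r = \int[mu]_(r in `[a, b]) f r.
Proof.
move=> f0; rewrite Rintegral_mkcond [RHS]Rintegral_mkcond; apply: eq_Rintegral => r _.
rewrite !patchE; case: ifPn => rr; case: ifPn => rab//.
  by apply: f0; apply: contra rab => rab; rewrite inE /= in_itv.
by case/negP: rr; rewrite inE; apply: segment_itv0; move: rab; rewrite inE /= in_itv.
Qed.

End compact_support.

Lemma Rintegral_itvD f g (a b : R) : continuous f -> continuous g ->
  \int[mu]_(r in `[a, b]) (f r + g r) =
  \int[mu]_(r in `[a, b]) f r + \int[mu]_(r in `[a, b]) g r.
Proof. by move=> cf cg; apply: RintegralD => //; exact: continuous_integrable_itv. Qed.

Lemma Rintegral_itvZ k f (a b : R) : continuous f ->
  \int[mu]_(r in `[a, b]) (k * f r) = k * \int[mu]_(r in `[a, b]) f r.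
Proof. by move=> cf; apply: RintegralZl => //; exact: continuous_integrable_itv. Qed.

(** [e] is the Euler derivative of a function [f] along a ray, that is
    [t * f' t], and [F] is the energy density of [f]. Put [k = f' / t]. Then
    [F = t^(m+2) (V k'^2 - (W + N V' / t) k^2) + (N V t^N k^2)'] with [N = m + 1],
    so the Bessel pair in dimension [N + 2] applies to [k]: with its solution
    [phi], the first term is a derivative plus [t^(m+2) V (k' - phi' / phi k)^2]. *)
Lemma bessel_ray_ge0 (m : nat) rho V W (a b : R) (F e de : R -> R) :
  0 < a -> a <= b -> (b%:E < rho)%E -> smooth_on (itv0 rho) V ->
  bessel_pair (m.+1 + 2) rho V (fun r => W r + m.+1%:R * (derive1 V r / r)) ->
  (forall t, a <= t <= b -> is_derive t 1 e (de t)) -> e a = 0 -> e b = 0 ->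
  continuous F ->
  (forall t, a <= t <= b -> F t = t ^+ m *
    (V t / t ^+ 4 * (t * de t + (m.+1%:R - 2) * e t) ^+ 2 - W t / t ^+ 2 * e t ^+ 2)) ->
  0 <= \int[mu]_(t in `[a, b]) F t.
Proof.
move=> a0 ab brho sV [V0 [phi Hphi]] De ea eb cF FE.
pose s t := t ^+ m.+2 * V t * derive1 phi t.
pose k t := e t * (t ^+ 0 / t ^+ 2).
pose dk t := de t * (t ^+ 0 / t ^+ 2) + e t * ((0%:R - 2%:R) * (t ^+ 0 / t ^+ 2) / t).
(* [A * k^2] collects the two derivatives that are split off. *)
pose A t := s t / phi t + m.+1%:R * (V t * (t ^+ m.+1 / t ^+ 0)).
pose dA t := derive1 s t / phi t - s t * derive1 phi t / phi t ^+ 2 +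
  m.+1%:R * (derive1 V t * t ^+ m.+1 + V t * (m.+1%:R * t ^+ m)).
have itv t : a <= t <= b -> itv0 rho t by exact: (segment_itv0 a0 brho).
have n0 t : a <= t <= b -> t != 0 by case/itv => t0 _; rewrite gt_eqF.
have Dk t : a <= t <= b -> is_derive t 1 k (dk t).
  by move=> tab; exact: is_derive_mul (De _ tab) (is_derive_powdiv 0 2 (n0 _ tab)).
have Dphi t : a <= t <= b -> is_derive t 1 phi (derive1 phi t).
  by move=> /itv /Hphi[_ d _ _]; rewrite derive1E; exact/derivableP.
have Ds t : a <= t <= b -> is_derive t 1 s (derive1 s t).
  move=> /itv /Hphi; rewrite addn2 /= => -[_ _ d _].
  by rewrite derive1E; exact/derivableP.
have phi0 t : a <= t <= b -> phi t != 0 by move=> /itv /Hphi[p _ _ _]; rewrite gt_eqF.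
have DA t : a <= t <= b -> is_derive t 1 A (dA t).
  move=> tab; have t0 := n0 _ tab; have p0 := phi0 _ tab.
  have D1 := is_derive_mul (Ds _ tab) (is_derive_inv p0 (Dphi _ tab)).
  have D2 := is_derive_mul (smooth_on_is_derive 0 sV (itv _ tab)) (is_derive_powdiv m.+1 0 t0).
  have D3 := is_derive_mul (is_derive_const (m.+1%:R) t 1) D2.
  apply: is_derive_ext (is_derive_add D1 D3) _.
  by rewrite /dA /= expr0 (exprS t m); field; rewrite t0 p0.
have DB t : a <= t <= b ->
    is_derive t 1 (fun t => A t * (k t * k t)) (dA t * (k t * k t) + A t * (dk t * k t + k t * dk t)).
  by move=> tab; apply: is_derive_mul; [exact: DA|apply: is_derive_mul; exact: Dk].
apply: (Rintegral_ge0_derive ab cF DB); last by rewrite /= /k ea eb !(mul0r, mulr0).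
move=> t tab; have t0 := n0 _ tab; have p0 := phi0 _ tab; rewrite FE//.
have := Hphi t (itv _ tab); rewrite addn2 /= => -[_ _ _ /eqP].
rewrite addr_eq0 => /eqP Es.
have eE : e t = t ^+ 2 * k t by rewrite /k expr0; field; rewrite t0.
have deE : de t = 2 * t * k t + t ^+ 2 * dk t by rewrite /dk /k expr0; field; rewrite t0.
rewrite -subr_ge0 (_ : _ - _ = t ^+ m.+2 * V t * (dk t - derive1 phi t / phi t * k t) ^+ 2).
  apply: mulr_ge0; last exact: sqr_ge0.
  by apply: mulr_ge0; [apply: exprn_ge0; rewrite ltW//; case: (itv _ tab)|exact/V0/itv].
rewrite eE deE /dA /A [derive1 s t]Es /s.
move: (dk t) (k t) (V t) (W t) (derive1 V t) (derive1 phi t) (phi t) p0.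
move=> dk' k' v w v' p' p p0; rewrite expr0 (exprS t m.+1) (exprS t m).
by field; rewrite t0 p0.
Qed.

End line_calculus.

(** * The one-dimensional form *)

Section angular_line.
Context {R : realType}.
Local Notation mu := (@lebesgue_measure R).

Lemma normr_sqr (x : R) : `|x| ^+ 2 = x ^+ 2.
Proof. by rewrite real_normK// num_real. Qed.

Lemma exprz_div (t : R) (m k : nat) : t != 0 ->
  t ^ (m.+1%:Z - k.+1%:Z) = t ^+ m / t ^+ k.
Proof.
move=> t0; rewrite (_ : m.+1%:Z - k.+1%:Z = m%:Z - k%:Z); last by rewrite !intS; ring.
by rewrite expfzDr// exprnN.
Qed.

(** The quadratic form whose positivity on compactly supported functions controls
    the angular part of the energy. *)
Definition line_form (N : nat) (rho : \bar R) (V W c : R -> R) : R :=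
  let int f := \int[lebesgue_measure]_(r in itv0 rho) (f r : R) in
  2 * int (fun r => V r * r ^ (N%:Z - 3) * `|derive1 c r| ^+ 2)
      - int (fun r => derive1n 2 V r * r ^ (N%:Z - 3) * `|c r| ^+ 2)
      - (N%:R - 5) * int (fun r => derive1 V r * r ^ (N%:Z - 4) * `|c r| ^+ 2)
      + (3 * N%:R - 9) * int (fun r => V r * r ^ (N%:Z - 5) * `|c r| ^+ 2)
      - int (fun r => W r * r ^ (N%:Z - 3) * `|c r| ^+ 2).

(** [c1] and [c2] are the first two derivatives of [c]. The density of
    [line_form] differs from [F] by the derivative of
    [2 V t^(N-3) c c' - V' t^(N-3) c^2 + 2 V t^(N-4) c^2], with [N = m + 1]. *)
Lemma angular_line_ge0 (m : nat) (rho : \bar R) (V W : R -> R) (a b : R)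
    (F c c1 c2 : R -> R) :
  0 < a -> a <= b -> (b%:E < rho)%E ->
  smooth_on (itv0 rho) V -> smooth_on (itv0 rho) W ->
  (forall t : R, is_derive t 1 c (c1 t)) -> (forall t : R, is_derive t 1 c1 (c2 t)) ->
  (forall t, ~~ (a < t < b) -> c t = 0) -> (forall t, ~~ (a < t < b) -> c1 t = 0) ->
  0 <= line_form m.+1 rho V W c ->
  continuous F ->
  (forall t, a <= t <= b -> F t = t ^+ m *
    (V t / t ^+ 4 * (m%:R * c t ^+ 2 - 2 * c t * (t ^+ 2 * c2 t + m%:R * (t * c1 t)))
     - W t / t ^+ 2 * c t ^+ 2)) ->
  0 <= \int[mu]_(t in `[a, b]) F t.
Proof.
move=> a0 ab brho sV sW Dc Dc1 c0 c10; rewrite /line_form; lazy zeta.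
have itv t : a <= t <= b -> itv0 rho t by exact: (segment_itv0 a0 brho).
have n0 t : a <= t <= b -> t != 0 by case/itv => t0 _; rewrite gt_eqF.
have cc : continuous c by move=> t; exact: is_derive_continuous (Dc t).
have cc1 : continuous c1 by move=> t; exact: is_derive_continuous (Dc1 t).
have out t : ~~ (a <= t <= b) -> ~~ (a < t < b).
  by apply: contra => /andP[at_ tb]; rewrite !ltW.
pose Q (q e : R -> R) k r := q r / r ^+ k * (r ^+ m * e r ^+ 2).
have cQ (q e : R -> R) k : continuous_on rho q -> continuous e ->
    (forall t, ~~ (a < t < b) -> e t = 0) -> continuous (Q q e k).
  move=> cq ce e0; apply: (@zero_extension_continuous _ rho a b a0 brho (fun r => q r / r ^+ k)).
  - exact: continuous_on_divX.
  - by apply: ctsM; [exact: exprn_continuous|exact: ctsX].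
  - by move=> r /out /e0 ->; rewrite expr0n mulr0.
have QE (q e : R -> R) k : (forall t, ~~ (a < t < b) -> e t = 0) ->
    \int[mu]_(r in itv0 rho) (q r * r ^ (m.+1%:Z - k.+1%:Z) * `|e r| ^+ 2) =
    \int[mu]_(r in `[a, b]) Q q e k r.
  move=> e0; rewrite (@Rintegral_itv0 _ rho a b)//; last first.
    by move=> r /out /e0 ->; rewrite normr0 expr0n mulr0.
  apply: eq_Rintegral => r; rewrite inE /= in_itv /= => rab.
  by rewrite normr_sqr exprz_div ?n0// /Q [_ ^+ m / _]mulrC !mulrA.
have V'E : derive1 c = c1 by apply/funext => t; rewrite derive1E (is_derive_val (Dc t)).
rewrite V'E (QE V c1 2%N)// (QE (derive1n 2 V) c 2%N)// (QE (derive1 V) c 3%N)// (QE V c 4%N)//.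
rewrite (QE W c 2%N)//.
have cQ1 := cQ V c1 2%N (smooth_on_continuous (k := 0) sV) cc1 c10.
have cQ2 := cQ (derive1n 2 V) c 2%N (smooth_on_continuous (k := 2) sV) cc c0.
have cQ3 := cQ (derive1 V) c 3%N (smooth_on_continuous (k := 1) sV) cc c0.
have cQ4 := cQ V c 4%N (smooth_on_continuous (k := 0) sV) cc c0.
have cQ5 := cQ W c 2%N (smooth_on_continuous (k := 0) sW) cc c0.
pose H r := 2 * Q V c1 2%N r + (- 1 * Q (derive1n 2 V) c 2%N r +
  (- (m.+1%:R - 5) * Q (derive1 V) c 3%N r +
   ((3 * m.+1%:R - 9) * Q V c 4%N r + - 1 * Q W c 2%N r))).
have cZ k q : continuous q -> continuous (fun r : R => (k : R) * q r).
  by move=> cq; apply: ctsM => //; exact: cts_cst.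
have cH5 : continuous (fun r => (3 * m.+1%:R - 9) * Q V c 4%N r + - 1 * Q W c 2%N r).
  by apply: ctsD; exact: cZ.
have cH4 : continuous (fun r => - (m.+1%:R - 5) * Q (derive1 V) c 3%N r +
   ((3 * m.+1%:R - 9) * Q V c 4%N r + - 1 * Q W c 2%N r)).
  by apply: ctsD => //; exact: cZ.
have cH3 : continuous (fun r => - 1 * Q (derive1n 2 V) c 2%N r +
  (- (m.+1%:R - 5) * Q (derive1 V) c 3%N r +
   ((3 * m.+1%:R - 9) * Q V c 4%N r + - 1 * Q W c 2%N r))).
  by apply: ctsD => //; exact: cZ.
have cH : continuous H by apply: ctsD => //; exact: cZ.
move=> hyp cF FE.
have {hyp} H0 : 0 <= \int[mu]_(r in `[a, b]) H r.
  move: hyp; rewrite /H Rintegral_itvD ?Rintegral_itvD ?Rintegral_itvZ//; try exact: cZ.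
  by congr (0 <= _); ring.
have [A dA] := antiderivative a b cH.
pose B t := A t - (2 * (V t * (t ^+ m / t ^+ 2) * (c t * c1 t)) -
   derive1 V t * (t ^+ m / t ^+ 2) * (c t * c t) +
   2 * (V t * (t ^+ m / t ^+ 3) * (c t * c t))).
have DB t : a <= t <= b -> is_derive t 1 B (F t).
  move=> tab; have t0 := n0 _ tab.
  have dV := smooth_on_is_derive 0 sV (itv _ tab).
  have dV1 := smooth_on_is_derive 1 sV (itv _ tab).
  have d2 := is_derive_const (2 : R) t 1.
  have dP2 := is_derive_powdiv m 2 t0; have dP3 := is_derive_powdiv m 3 t0.
  have D1 := is_derive_mul d2 (is_derive_mul (is_derive_mul dV dP2) (is_derive_mul (Dc t) (Dc1 t))).
  have D2 := is_derive_mul (is_derive_mul dV1 dP2) (is_derive_mul (Dc t) (Dc t)).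
  have D3 := is_derive_mul d2 (is_derive_mul (is_derive_mul dV dP3) (is_derive_mul (Dc t) (Dc t))).
  apply: is_derive_ext (is_derive_sub (dA _ tab) (is_derive_add (is_derive_sub D1 D2) D3)) _.
  rewrite FE// /H /Q /=.
  move: (c t) (c1 t) (c2 t) (V t) (W t) (derive1 V t) (derive1 (derive1 V) t) => x x1 x2 v w v1 v2.
  by rewrite -(@natr1 R m); field.
apply: (Rintegral_ge0_derive ab cF DB) => //.
rewrite /B !(c0 a) ?(c0 b) ?ltxx ?andbF// !(mul0r, mulr0) !subr0 !addr0 !subr0.
by rewrite -subr_ge0 -(Rintegral_derive ab cH dA).
Qed.

End angular_line.

(** * Radial and angular energies *)

Section rays.
Context {R : realType} {n : nat}.
Implicit Types (f u e : 'rV[R]_n -> R) (x w : 'rV[R]_n) (t : R).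
Local Notation mu := (@lebesgue_measure R).

Definition dir w f x := \sum_k w 0 k * pd k f x.

Lemma smooth_dir w f : smooth f -> smooth (dir w f).
Proof.
by move=> sf; apply: smooth_sum => k; apply: smoothM; [exact: smooth_cst|exact: smooth_pd].
Qed.

Lemma ring_fun_dir a b w f : ring_fun a b f -> ring_fun a b (dir w f).
Proof.
move=> [sf af]; split; first exact: smooth_dir.
by apply: annular_sum => k; apply: annularMl; apply: annular_pd => //; exact: smooth_Ck.
Qed.

Lemma euler_ray f w t : euler f (t *: w) = t * dir w f (t *: w).
Proof. by rewrite /euler mulr_sumr; apply: eq_bigr => k _; rewrite mxE mulrA. Qed.

Lemma euler2_ray f w t : smooth f ->
  euler (euler f) (t *: w) = t * (dir w f (t *: w) + t * dir w (dir w f) (t *: w)).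
Proof.
move=> sf; rewrite euler_ray; congr (t * _).
have d1 := is_derive_ray w t (smooth_Ck 1 (smooth_euler sf)).
have d2 := is_derive_mul (is_derive_id1 t) (is_derive_ray w t (smooth_Ck 1 (smooth_dir w sf))).
have E : (fun s : R => euler f (s *: w)) = (fun s => s * dir w f (s *: w)).
  by apply/funext => s; exact: euler_ray.
by rewrite E in d1; rewrite -[LHS](is_derive_val d1) (is_derive_val d2) mul1r.
Qed.

Lemma enorm_ray w t : enorm w = 1 -> 0 <= t -> enorm (t *: w) = t.
Proof. by move=> w1 t0; rewrite enormZ w1 mulr1 ger0_norm. Qed.

(** Restricting [f] to a line would pick up both halves of its support. *)
Definition cut w f t := if 0 < t then f (t *: w) else 0.

Section cut.
Variables (a b : R) (w : 'rV[R]_n).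
Hypotheses (a0 : 0 < a) (w1 : enorm w = 1).

Lemma cut_eq0 f t : annular a b f -> ~~ (a <= t <= b) -> cut w f t = 0.
Proof.
move=> af tab; rewrite /cut; case: ifPn => // t0; apply: (annular_eq0 af).
by rewrite enorm_ray// ltW.
Qed.

Lemma is_derive_cut f t : ring_fun a b f -> is_derive t 1 (cut w f) (cut w (dir w f) t).
Proof.
move=> rf; have [sf af] := rf; have [t0|t0] := ltrP 0 t.
  rewrite {2}/cut t0; apply: near_eq_is_derive (is_derive_ray w t (smooth_Ck 1 sf)).
  by near=> s; rewrite /cut ifT//; near: s; exact: lt_nbhsr.
have ta : t < a := le_lt_trans t0 a0.
rewrite (cut_eq0 (ring_fun_dir w rf).2); last by rewrite negb_and -ltNge ta.
apply: near_eq_is_derive (is_derive_const (0 : R) t 1).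
near=> s; apply/esym/(cut_eq0 af); rewrite negb_and -ltNge; apply/orP; left.
by near: s; exact: lt_nbhsl.
Unshelve. all: by end_near.
Qed.

Lemma derive1n_cut f k : ring_fun a b f ->
  derive1n k (cut w f) = cut w (iter k (dir w) f) /\ ring_fun a b (iter k (dir w) f).
Proof.
move=> rf; elim: k => [//|k [IH rk]]; split; last exact: ring_fun_dir.
by rewrite derive1nS IH; apply/funext => t; rewrite derive1E (is_derive_val (is_derive_cut t rk)).
Qed.

Lemma cut_test (rho : \bar R) f : (b%:E < rho)%E -> ring_fun a b f ->
  smooth_compact_support1 (itv0 rho) (cut w f).
Proof.
move=> brho rf.
have cl : closure [set r | cut w f r != 0] `<=` [set` `[a, b]].
  have -> : [set` `[a, b]] = closure [set` `[a, b]] :> set R.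
    by apply/closure_id; exact: itv_closed.
  apply: closure_subset => t /= ct; rewrite in_itv /=.
  apply/negPn/negP => /(cut_eq0 rf.2) c0; by rewrite c0 eqxx in ct.
split.
- move=> k t _; have [-> rk] := derive1n_cut k rf.
  exact: is_derive_derivable (is_derive_cut t rk).
- by apply: subclosed_compact cl; [exact: closed_closure|exact: segment_compact].
- by move=> t /cl /=; rewrite in_itv /=; exact: segment_itv0.
Qed.

End cut.

(** [r ^ 2] times the radial part of the Laplacian, which complements [sph]. *)
Definition rad f x := euler (euler f) x + (n%:R - 2) * euler f x.

Lemma ring_fun_rad a b f : ring_fun a b f -> ring_fun a b (rad f).
Proof.
by move=> rf; apply: ring_funD; [|apply: ring_funZ]; do ? apply: ring_fun_euler.
Qed.

End rays.

Section ray_inequalities.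
Context {R : realType} {m : nat}.
Variables (rho : \bar R) (V W : R -> R) (a a1 b1 b : R).
Hypotheses (a0 : 0 < a) (aa1 : a < a1) (bb1 : b1 < b) (ab : a <= b) (brho : (b%:E < rho)%E).
Hypotheses (sV : smooth_on (itv0 rho) V) (sW : smooth_on (itv0 rho) W).
Implicit Types (f u : 'rV[R]_m.+1 -> R) (w x : 'rV[R]_m.+1).
Local Notation mu := (@lebesgue_measure R).
Local Notation hV := (fun r => V r / r ^+ 4).
Local Notation hW := (fun r => W r / r ^+ 2).

Lemma ring_fun_widen f : ring_fun a1 b1 f -> ring_fun a b f.
Proof.
move=> [sf af]; split=> // x /af /andP[ax xb].
by rewrite (le_trans (ltW aa1) ax) (le_trans xb (ltW bb1)).
Qed.

Lemma ray_end f w t : ring_fun a1 b1 f -> enorm w = 1 -> 0 <= t -> ~~ (a < t < b) ->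
  f (t *: w) = 0.
Proof.
move=> [_ af] w1 t0 tab; apply: (annular_eq0 af); rewrite enorm_ray//.
by apply: contra tab => /andP[at_ tb]; rewrite (lt_le_trans aa1 at_) (le_lt_trans tb bb1).
Qed.

Lemma polar_wt_ge0 (F G : 'rV[R]_m.+1 -> R) : ring_fun a b F -> ring_fun a b G ->
  (forall w, enorm w = 1 ->
    (forall t, a <= t <= b -> enorm (t *: w) = t) ->
    continuous (fun t : R => t ^+ m * (wt hV F (t *: w) - wt hW G (t *: w))) ->
    0 <= \int[mu]_(t in `[a, b]) (t ^+ m * (wt hV F (t *: w) - wt hW G (t *: w)))) ->
  0 <= wint hV F - wint hW G.
Proof.
move=> rF rG H; have ChV := C1_on_divX 4 sV; have ChW := C1_on_divX 2 sW.
have CF := wt_Ck1 a0 brho ChV (smooth_Ck 1 rF.1) rF.2.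
have CG := wt_Ck1 a0 brho ChW (smooth_Ck 1 rG.1) rG.2.
have -> : wint hV F - wint hW G = Iint (fun x => wt hV F x + - 1 * wt hW G x).
  have tG := ring_wt_test a0 brho ChW rG.
  have tF := ring_wt_test a0 brho ChV rF.
  by rewrite (IintD tF (test_funZ (- 1) tG)) (IintZ (- 1) tG) mulN1r.
apply: (@polar_ge0 _ _ _ a b) => //.
- by apply: CkD => //; apply: CkM => //; exact: Ck_cst.
- by apply: annularD; [exact: (wt_annular rF.2)|apply: annularMl; exact: (wt_annular rG.2)].
move=> w w1; under eq_Rintegral do rewrite mulN1r.
apply: H => //.
  by move=> t /andP[at_ _]; rewrite enorm_ray// (le_trans (ltW a0) at_).
have cB := ctsB (cts_ray (w := w) (Ck_continuous CF)) (cts_ray (w := w) (Ck_continuous CG)).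
have cX : continuous (fun t : R => t ^+ m) by exact: exprn_continuous.
by have := ctsM cX cB.
Qed.

(** The Bessel inequality for the restrictions of [euler u] to rays. *)
Lemma radial_part_ge0 u : ring_fun a1 b1 u ->
  bessel_pair (m.+1 + 2) rho V (fun r => W r + m.+1%:R * (derive1 V r / r)) ->
  0 <= wint hV (fun x => rad u x ^+ 2) - wint hW (fun x => euler u x ^+ 2).
Proof.
move=> ru HB; have re := ring_fun_euler ru.
apply: polar_wt_ge0.
- by apply: ring_funX2; apply: ring_fun_rad; exact: ring_fun_widen.
- by apply: ring_funX2; exact: ring_fun_widen.
move=> w w1 en cF; have b0 : 0 <= b := le_trans (ltW a0) ab.
apply: (@bessel_ray_ge0 _ m rho V W a b _ (fun t => euler u (t *: w))
  (fun t => dir w (euler u) (t *: w))) => //.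
- by move=> t _; exact: (is_derive_ray w t (smooth_Ck 1 re.1)).
- by apply: ray_end => //; rewrite ?ltW// ltxx.
- by apply: ray_end => //; rewrite ltxx andbF.
by move=> t tab; rewrite /wt en// /rad euler_ray.
Qed.

(** For [f] a rotation derivative this is its share of the mixed energy; on every
    ray it is [line_form] of the restriction of [f]. *)
Lemma angular_part_ge0 f : ring_fun a1 b1 f ->
  (forall c : R -> R, smooth_compact_support1 (itv0 rho) c -> 0 <= line_form m.+1 rho V W c) ->
  0 <= wint hV (fun x => m%:R * f x ^+ 2 - 2 * (f x * rad f x)) - wint hW (fun x => f x ^+ 2).
Proof.
move=> rf hyp; have rfw := ring_fun_widen rf.
have rd w := ring_fun_dir w rf.
apply: polar_wt_ge0.
- apply: ring_funB; first by apply: ring_funZ; exact: ring_funX2.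
  by apply: ring_funZ; apply: ring_funM => //; exact: ring_fun_rad.
- exact: ring_funX2.
move=> w w1 en cF.
have a10 : 0 < a1 := lt_trans a0 aa1.
have b1rho : (b1%:E < rho)%E by apply: lt_trans brho; rewrite lte_fin.
have out e t : ring_fun a1 b1 e -> ~~ (a < t < b) -> cut w e t = 0.
  move=> re tab; rewrite /cut; case: ifPn => // t0.
  by apply: (ray_end re w1 (ltW t0)).
apply: (@angular_line_ge0 _ m rho V W a b _ (cut w f) (cut w (dir w f)) (cut w (dir w (dir w f)))) => //.
- by move=> t; exact: (is_derive_cut a10 w1 t rf).
- by move=> t; exact: (is_derive_cut a10 w1 t (rd w)).
- by move=> t; exact: (out _ t rf).
- by move=> t; exact: (out _ t (rd w)).
- by apply: hyp; exact: (cut_test a10 w1 b1rho rf).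
move=> t tab; have t0 : 0 < t by move: tab => /andP[/(lt_le_trans a0)].
rewrite /wt en// /cut t0 /rad euler2_ray; last by case: rf.
rewrite euler_ray -(natr1 m); congr (_ * (_ * _ - _)).
ring.
Qed.

End ray_inequalities.

(** * The Rellich inequality *)

Section energy.
Context {R : realType} {n : nat}.
Variables (rho : \bar R) (a b : R).
Hypotheses (a0 : 0 < a) (brho : (b%:E < rho)%E).
Implicit Types (u f : 'rV[R]_n -> R) (x : 'rV[R]_n) (h : R -> R).

Lemma wint_gamma h u : C1_on rho h -> ring_fun a b u ->
  \sum_i \sum_j wint h (fun x => rot i j u x ^+ 2) = 2 * wint h (gamma u).
Proof.
move=> Ch ru; have r2 i j := ring_funX2 (ring_fun_rot i j ru).
rewrite (wintZ a0 brho Ch); last by do 2! apply: ring_fun_sum => ?.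
rewrite (wint_sum a0 brho Ch); last by move=> i; apply: ring_fun_sum.
rewrite mulrA divff ?pnatr_eq0// mul1r; apply: eq_bigr => i _.
by rewrite (wint_sum a0 brho Ch).
Qed.

Lemma rot_rad i j u : smooth u -> rot i j (rad u) = rad (rot i j u).
Proof.
move=> su; have se := smooth_euler su.
rewrite [rad u](_ : _ = (fun x => euler (euler u) x - (2 - n%:R) * euler u x)); last first.
  by apply/funext => x; rewrite /rad; ring.
rewrite rotB; [|exact: smooth_euler|by apply: smoothM => //; exact: smooth_cst].
rewrite rotZ// !rot_euler//; apply/funext => x; rewrite /rad; ring.
Qed.

(** The mixed term of the energy is a sum over rotations because these commute
    with [rad]. *)
Lemma wint_cross h u : C1_on rho h -> ring_fun a b u ->
  \sum_i \sum_j wint h (fun x => rot i j u x * rad (rot i j u) x) =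
  - (2 * wint h (fun x => rad u x * sph u x)).
Proof.
move=> Ch ru; have rr := ring_fun_rad ru; have [su _] := ru.
rewrite -(wint_green a0 brho Ch rr ru); apply: eq_bigr => i _; apply: eq_bigr => j _.
by rewrite rot_rad.
Qed.

(** The square of [rad u + sph u] is expanded, the mixed term is distributed over
    the rotations, and [(n - 1)] times the spherical gradient is transferred from
    the last term to the middle one: the gap of spheres pays for it. *)
Lemma energy_split h k u : C1_on rho h -> C1_on rho k -> ring_fun a b u ->
  wint h (fun x => (rad u x + sph u x) ^+ 2) - wint k (fun x => gamma u x + euler u x ^+ 2) =
  (wint h (fun x => rad u x ^+ 2) - wint k (fun x => euler u x ^+ 2)) +
  2^-1 * (\sum_i \sum_j
    (wint h (fun x => (n%:R - 1) * rot i j u x ^+ 2 - 2 * (rot i j u x * rad (rot i j u) x))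
     - wint k (fun x => rot i j u x ^+ 2))) +
  wint h (fun x => sph u x ^+ 2 - (n%:R - 1) * gamma u x).
Proof.
move=> Ch Ck ru; have rr := ring_fun_rad ru; have rs := ring_fun_sph ru.
have re := ring_fun_euler ru; have rg := ring_fun_gamma ru.
have rrot i j := ring_fun_rot i j ru.
have rX i j := ring_funZ (n%:R - 1) (ring_funX2 (rrot i j)).
have rC i j := ring_funM (rrot i j) (ring_fun_rad (rrot i j)).
under eq_bigr => i _ do under eq_bigr => j _ do
  rewrite (wintB a0 brho Ch (rX i j) (ring_funZ 2 (rC i j)))
    (wintZ a0 brho Ch _ (ring_funX2 (rrot i j))) (wintZ a0 brho Ch _ (rC i j)).
have -> : \sum_i \sum_j ((n%:R - 1) * wint h (fun x => rot i j u x ^+ 2) -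
    2 * wint h (fun x => rot i j u x * rad (rot i j u) x) -
    wint k (fun x => rot i j u x ^+ 2)) =
  (n%:R - 1) * (\sum_i \sum_j wint h (fun x => rot i j u x ^+ 2)) -
  2 * (\sum_i \sum_j wint h (fun x => rot i j u x * rad (rot i j u) x)) -
  \sum_i \sum_j wint k (fun x => rot i j u x ^+ 2).
  rewrite !mulr_sumr -!sumrB; apply: eq_bigr => i _.
  by rewrite !mulr_sumr -!sumrB.
rewrite (wint_gamma Ch ru) (wint_gamma Ck ru) (wint_cross Ch ru).
have -> : wint h (fun x => (rad u x + sph u x) ^+ 2) =
    wint h (fun x => rad u x ^+ 2 + (2 * (rad u x * sph u x) + sph u x ^+ 2)).
  by apply: wint_ext => x; ring.
have rm := ring_funM rr rs.
rewrite (wintD a0 brho Ch (ring_funX2 rr) (ring_funD (ring_funZ 2 rm) (ring_funX2 rs))).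
rewrite (wintD a0 brho Ch (ring_funZ 2 rm) (ring_funX2 rs)) (wintZ a0 brho Ch 2 rm).
rewrite (wintD a0 brho Ck rg (ring_funX2 re)).
rewrite (wintB a0 brho Ch (ring_funX2 rs) (ring_funZ _ rg)) (wintZ a0 brho Ch _ rg).
by field.
Qed.

Lemma outside_eball f x : annular a b f -> ~ eball rho x -> f x = 0.
Proof.
move=> af xr; apply: (annular_eq0 af); apply/negP => /andP[_ xb]; apply: xr.
by apply: le_lt_trans brho; rewrite lee_fin.
Qed.

Lemma rellich_lhsE V u : ring_fun a b u ->
  integral_Rn (eball rho) (fun x => V (enorm x) * `|laplacian u x| ^+ 2) =
  wint (fun r => V r / r ^+ 4) (fun x => (rad u x + sph u x) ^+ 2).
Proof.
move=> [su au]; have al := annular_laplacian su au.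
rewrite integral_RnE; last first.
  by move=> x xr; rewrite (outside_eball al xr) normr0 expr0n mulr0.
congr (Iint _); apply/funext => x; rewrite /wt normr_sqr.
have -> : rad u x + sph u x = enorm x ^+ 2 * laplacian u x.
  by rewrite enorm_sqr /rad /sph; ring.
have [xab|xab] := boolP (a <= enorm x <= b); last first.
  by rewrite (annular_eq0 al xab) !(mulr0, expr0n).
have x0 : enorm x != 0 by case/andP: xab => /(lt_le_trans a0) /gt_eqF ->.
by field.
Qed.

Lemma rellich_rhsE W u : ring_fun a b u ->
  integral_Rn (eball rho) (fun x => W (enorm x) * enorm (grad u x) ^+ 2) =
  wint (fun r => W r / r ^+ 2) (fun x => gamma u x + euler u x ^+ 2).
Proof.
move=> [su au].
have gE x : enorm (grad u x) ^+ 2 = \sum_i pd i u x ^+ 2.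
  by rewrite enorm_sqr; apply: eq_bigr => i _; rewrite gradE.
have ag x : ~~ (a <= enorm x <= b) -> enorm (grad u x) ^+ 2 = 0.
  move=> xab; rewrite gE big1// => i _.
  by rewrite (annular_eq0 (annular_pd (smooth_Ck 1 su) au) xab) expr0n.
rewrite integral_RnE; last first.
  move=> x xr; rewrite ag ?mulr0//; apply/negP => /andP[_ xb]; apply: xr.
  by apply: le_lt_trans brho; rewrite lee_fin.
congr (Iint _); apply/funext => x; rewrite /wt.
have -> : gamma u x + euler u x ^+ 2 = enorm x ^+ 2 * enorm (grad u x) ^+ 2.
  by rewrite gE enorm_sqr /gamma sum_rot_sqr; field.
have [xab|xab] := boolP (a <= enorm x <= b); last by rewrite ag// !mulr0.
have x0 : enorm x != 0 by case/andP: xab => /(lt_le_trans a0) /gt_eqF ->.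
by field.
Qed.

End energy.

Lemma exists_between0 (R : realType) (rho : \bar R) (c : R) : 0 <= c -> (c%:E < rho)%E ->
  exists2 d : R, c < d & (d%:E < rho)%E.
Proof.
move=> c0; case: rho => [r| |//]; last by move=> _; exists (c + 1); rewrite ?ltrDl// ltry.
rewrite lte_fin => cr; exists ((c + r) / 2); first by lra.
by rewrite lte_fin; lra.
Qed.

Lemma test_ring (R : realType) n (rho : \bar R) (u : 'rV[R]_n -> R) : (0 < rho)%E ->
  smooth_compact_support (eball rho `\ (0 : 'rV[R]_n)) u ->
  exists a1 b1 : R, [/\ 0 < a1, a1 <= b1, (b1%:E < rho)%E & ring_fun a1 b1 u].
Proof.
move=> rho0 [su cK Ksub]; set K := closure _ in cK Ksub.
have uK x : u x != 0 -> K x by move=> ux; exact: (@subset_closure _ [set x | u x != 0]).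
have [[x Kx]|K0] := pselect (exists x, K x); last first.
  have [d d0 dr] := exists_between0 (lexx 0) rho0.
  by exists d, d; split=> //; split=> // x /uK Kx; case: K0; exists x.
have Kne : K !=set0 by exists x.
have ce : {within K, continuous (@enorm R n)}.
  by apply: continuous_subspaceT; exact: enorm_continuous.
have [p /set_mem Kp pmin] := EVT_min_rV Kne cK ce.
have [q /set_mem Kq qmax] := EVT_max_rV Kne cK ce.
have {}pmin y (Ky : K y) := pmin _ (mem_set Ky).
have {}qmax y (Ky : K y) := qmax _ (mem_set Ky).
have [[_ p0] [qr _]] := (Ksub _ Kp, Ksub _ Kq).
exists (enorm p), (enorm q); split=> //.
- rewrite lt_neqAle enorm_ge0 andbT eq_sym; apply/eqP => pe; apply: p0.
  apply/rowP => i; rewrite mxE; apply/eqP; rewrite -normr_le0.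
  by rewrite (le_trans (coord_le_enorm p i))// pe.
- exact: pmin.
- by split=> // y /uK Ky; apply/andP; split; [exact: pmin|exact: qmax].
Qed.

Lemma radial_rot (R : realType) n (u : 'rV[R]_n -> R) i j x : smooth u -> radial u ->
  rot i j u x = 0.
Proof.
move=> su [g ug]; have [->|ij] := eqVneq i j; first exact: rot_diag.
have d := is_derive_turn ij x 0 (smooth_Ck 1 su).
have E : (fun s : R => u (turn i j s x)) = (fun _ => u x).
  by apply/funext => s; rewrite !ug enorm_turn.
rewrite E in d; rewrite -[in LHS](turn0 i j x) -(is_derive_val d).
by rewrite derive_cst.
Qed.

Lemma wint0 (R : realType) n (h : R -> R) (f : 'rV[R]_n -> R) :
  (forall x, f x = 0) -> wint h f = 0.
Proof.
move=> f0; rewrite /wint /Iint; under eq_Rintegral do rewrite /wt f0 mulr0.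
by rewrite /Rintegral integral0.
Qed.

(** Given the angular part, the radial part and the spherical gap are nonnegative
    in general. The radii are enlarged for the former, so that functions vanish
    at the ends of the intervals of integration. *)
Lemma rellich_of_angular (R : realType) (m : nat) (rho : \bar R) (V W : R -> R) (a1 b1 : R)
    (u : 'rV[R]_m.+1 -> R) :
  0 < a1 -> a1 <= b1 -> (b1%:E < rho)%E ->
  smooth_on (itv0 rho) V -> smooth_on (itv0 rho) W ->
  (forall r, itv0 rho r -> 0 <= V r) ->
  bessel_pair (m.+1 + 2) rho V (fun r => W r + m.+1%:R * (derive1 V r / r)) ->
  ring_fun a1 b1 u ->
  (forall i j, 0 <=
    wint (fun r => V r / r ^+ 4)
      (fun x => m%:R * rot i j u x ^+ 2 - 2 * (rot i j u x * rad (rot i j u) x))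
    - wint (fun r => W r / r ^+ 2) (fun x => rot i j u x ^+ 2)) ->
  integral_Rn (eball rho) (fun x => W (enorm x) * enorm (grad u x) ^+ 2) <=
  integral_Rn (eball rho) (fun x => V (enorm x) * `|laplacian u x| ^+ 2).
Proof.
move=> a10 ab1 b1rho sV sW V0 HB ru Hang.
have b10 : 0 <= b1 := le_trans (ltW a10) ab1.
have [b bb1 brho] := exists_between0 b10 b1rho.
have aa1 : a1 / 2 < a1 by lra.
have a0 : 0 < a1 / 2 by lra.
have ab : a1 / 2 <= b by lra.
have ChV := C1_on_divX 4 sV; have ChW := C1_on_divX 2 sW.
rewrite (rellich_lhsE a10 b1rho _ ru) (rellich_rhsE a10 b1rho _ ru) -subr_ge0.
rewrite (energy_split a10 b1rho ChV ChW ru); apply: addr_ge0; first apply: addr_ge0.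
- exact: (radial_part_ge0 a0 aa1 bb1 ab brho sV sW ru HB).
- apply: mulr_ge0; first by rewrite invr_ge0.
  apply: sumr_ge0 => i _; apply: sumr_ge0 => j _; have := Hang i j.
  by rewrite (_ : m%:R = m.+1%:R - 1 :> R)// -natr1 addrK.
- apply: (spherical_gap a10 b1rho ChV) => // r rr.
  by apply: divr_ge0; [exact: V0|apply: exprn_ge0; rewrite ltW//; case: rr].
Qed.

Unset Implicit Arguments.

Theorem theorem1p3 (R : realType) (N : nat) (rho : \bar R) (V2 W2 : R -> R)
    (N_ge1 : (1 <= N)%N) (rho_gt0 : (0 < rho)%E)
    (V2_smooth : smooth_on (itv0 rho) V2) (W2_smooth : smooth_on (itv0 rho) W2)
    (V2_ge0 : forall r, itv0 rho r -> 0 <= V2 r)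
    (V2_W2_bessel :
      bessel_pair (N + 2) rho V2 (fun r => W2 r + N%:R * (derive1 V2 r / r))) :
  let rellich (u : 'rV[R]_N -> R) :=
    integral_Rn (eball rho) (fun x => V2 (enorm x) * `|laplacian u x| ^+ 2) >=
    integral_Rn (eball rho) (fun x => W2 (enorm x) * enorm (grad u x) ^+ 2) in
  let test_functions := smooth_compact_support (eball rho `\ (0 : 'rV[R]_N)) in
  (forall u, test_functions u -> radial u -> rellich u) /\
  ((forall u : R -> R, smooth_compact_support1 (itv0 rho) u ->
      let int f := \int[lebesgue_measure]_(r in itv0 rho) (f r : R) in
      2 * int (fun r => V2 r * r ^ (N%:Z - 3) * `|derive1 u r| ^+ 2)
      - int (fun r => derive1n 2 V2 r * r ^ (N%:Z - 3) * `|u r| ^+ 2)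
      - (N%:R - 5) * int (fun r => derive1 V2 r * r ^ (N%:Z - 4) * `|u r| ^+ 2)
      + (3 * N%:R - 9) * int (fun r => V2 r * r ^ (N%:Z - 5) * `|u r| ^+ 2)
      - int (fun r => W2 r * r ^ (N%:Z - 3) * `|u r| ^+ 2) >= 0) ->
   forall u, test_functions u -> rellich u).
Proof.
case: N N_ge1 V2_W2_bessel => // m _ HB; split => [u tu radu|hyp u tu];
  have [a1 [b1 [a10 ab1 b1rho ru]]] := test_ring rho_gt0 tu;
  apply: (rellich_of_angular a10 ab1 b1rho V2_smooth W2_smooth V2_ge0 HB ru) => i j.
  have r0 x : rot i j u x = 0 by apply: radial_rot radu; case: tu.
  rewrite wint0; last by move=> x; rewrite r0 expr0n /= mul0r !mulr0 subrr.
  by rewrite wint0 ?subrr// => x; rewrite r0 expr0n.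
have b10 : 0 <= b1 := le_trans (ltW a10) ab1.
have [b bb1 brho] := exists_between0 b10 b1rho.
have aa1 : a1 / 2 < a1 by lra.
have a0 : 0 < a1 / 2 by lra.
have ab : a1 / 2 <= b by lra.
exact: (angular_part_ge0 a0 aa1 bb1 ab brho V2_smooth W2_smooth (ring_fun_rot i j ru) hyp).
Qed.
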